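(* Let $\mathcal V:\mathcal P_p(\mathbb R^d)\to\mathbb R$ be continuous with respect to the Lévy–Prokhorov metric $\Lambda$, and assume that there are $\alpha,\beta\in\mathbb R$, $1\le r<p$ and $\rho\in\mathcal M_p$ such that $$|\mathcal V(\mu)|\le \alpha\,\Lambda(\mu,\rho)^{2r}+\beta,\qquad \mu\in\mathcal M_p .$$ Then $\mathcal U(\mu)$ has a minimizing path for each $\mu\in\mathcal M_p$; that is, for each $\mu\in\mathcal M_p$ there is $\sigma\in AC_{p,\delta}(\mathcal M_p)$ with $\sigma(0)=\mu$ that attains the infimum defining $\mathcal U(\mu)$.
   Context: Fix $d\ge 1$, $p\in(1,\infty)$ and $\delta\in(0,\infty)$. $\mathcal P_p(\mathbb R^d)$ is the set of Borel probability measures $\mu$ on $\mathbb R^d$ with $\int|x|^pd\mu<\infty$; $\mathcal M_p$ denotes $\mathcal P_p(\mathbb R^d)$ equipped with the Wasserstein metric $W_p(\mu,\nu)=\inf\{(\iint|x-y|^pd\pi(x,y))^{1/p}:\pi\in\Gamma(\mu,\nu)\}$, where $\Gamma(\mu,\nu)$ is the set of measures in $\mathcal P_p(\mathbb R^d\times\mathbb R^d)$ with first marginal $\mu$ and second marginal $\nu$. The Lévy–Prokhorov metric is $\Lambda(\mu,\nu)=\inf\{\epsilon>0:\ \mu(A)\le\nu(A^\epsilon)+\epsilon,\ \nu(A)\le\mu(A^\epsilon)+\epsilon \text{ for all Borel } A\subset\mathbb R^d\}$, where $A^\epsilon=\bigcup_{z\in A}B_\epsilon(z)$. A path $\sigma:[0,\infty)\to\mathcal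 M_p$ is locally $p$-absolutely continuous if there is $m\in L^p_{loc}([0,\infty))$ with $W_p(\sigma(s),\sigma(t))\le\int_s^tm(\tau)d\tau$ for $0\le s\le t$; its metric derivative $\|\dot\sigma(t)\|=\lim_{h\to0}W_p(\sigma(t+h),\sigma(t))/|h|$ exists for a.e. $t$. $AC_{p,\delta}(\mathcal M_p)$ is the set of such paths with $\int_0^\infty e^{-\delta t}\|\dot\sigma(t)\|^pdt<\infty$. The generalized value function is $$\mathcal U(\mu)=\inf\left\{\int_0^\infty e^{-\delta t}\left(\tfrac1p\|\dot\sigma(t)\|^p-\mathcal V(\sigma(t))\right)dt:\ \sigma\in AC_{p,\delta}(\mathcal M_p),\ \sigma(0)=\mu\right\}.$$ *)

(* Defs.v *)
From HB Require Import structures.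
From mathcomp Require Import all_boot all_order all_algebra.
From mathcomp Require Import all_classical all_reals all_analysis.

Set Implicit Arguments.
Unset Strict Implicit.
Unset Printing Implicit Defensive.

Import Order.TTheory GRing.Theory Num.Theory.
Import numFieldNormedType.Exports.

Local Open Scope classical_set_scope.
Local Open Scope ring_scope.

(* R^d with its Borel sigma-algebra.  The product type Rd R d * Rd R d carries
   the product sigma-algebra, which is the Borel sigma-algebra of R^d x R^d. *)
Notation Rd R d := (g_sigma_algebraType (@open 'rV[R]_d)).

(* The library norm on row vectors is the sup norm; the Euclidean one is needed
   here. *)
Definition enorm (R : realType) (d : nat) (x : 'rV[R]_d) : R :=
  Num.sqrt (\sum_(i < d) x ord0 i ^+ 2).

Definition edist (R : realType) (d : nat) (x y : 'rV[R]_d) : R := enorm (x - y).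

Definition enorm2 (R : realType) (d : nat) (z : 'rV[R]_d * 'rV[R]_d) : R :=
  Num.sqrt (enorm z.1 ^+ 2 + enorm z.2 ^+ 2).

Record Pp (R : realType) (d : nat) (p : R) := MkPp {
  Pp_meas :> probability (Rd R d) R ;
  Pp_moment : (\int[Pp_meas]_x (enorm x `^ p)%:E < +oo)%E }.

Definition coupling (R : realType) (d : nat) (p : R) (mu nu : Pp d p)
    : set (probability (Rd R d * Rd R d)%type R) :=
  [set pi : probability (Rd R d * Rd R d)%type R |
   [/\ (\int[pi]_z (enorm2 z `^ p)%:E < +oo)%E,
       (forall A : set (Rd R d), measurable A -> pushforward pi fst A = mu A) &
       (forall A : set (Rd R d), measurable A -> pushforward pi snd A = nu A)]].

Definition transport_cost (R : realType) (d : nat) (p : R)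
    (pi : probability (Rd R d * Rd R d)%type R) : \bar R :=
  (\int[pi]_z (edist z.1 z.2 `^ p)%:E)%E.

Definition wasserstein (R : realType) (d : nat) (p : R) (mu nu : Pp d p) : R :=
  fine (ereal_inf [set (transport_cost p pi `^ p^-1)%E | pi in coupling mu nu]).

Definition thicken (R : realType) (d : nat) (e : R) (A : set 'rV[R]_d)
    : set 'rV[R]_d :=
  \bigcup_(z in A) [set x | edist x z < e].

Definition levy_prokhorov (R : realType) (d : nat)
    (mu nu : probability (Rd R d) R) : R :=
  inf [set e : R | 0 < e /\ forall A : set (Rd R d), measurable A ->
    (mu A <= nu (thicken e A) + e%:E)%E /\ (nu A <= mu (thicken e A) + e%:E)%E].

Definition levy_prokhorov_continuous (R : realType) (d : nat) (p : R)
    (V : Pp d p -> R) : Prop :=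
  forall (mu : Pp d p) (e : R), 0 < e ->
    exists2 eta : R, 0 < eta & forall nu : Pp d p,
      levy_prokhorov nu mu < eta -> `|V nu - V mu| < e.

(* A path [0, oo) -> M_p is a function on R of which only the values at
   nonnegative times are ever used. *)

Definition Lp_loc (R : realType) (p : R) (m : R -> R) : Prop :=
  measurable_fun (`[0%R, +oo[ : set R) m /\
  forall T : R, (\int[lebesgue_measure]_(t in `[0%R, T]) (`|m t| `^ p)%:E < +oo)%E.

Definition locally_p_ac (R : realType) (d : nat) (p : R)
    (sigma : R -> Pp d p) : Prop :=
  exists2 m : R -> R, Lp_loc p m &
    forall s t : R, 0 <= s -> s <= t ->
      ((wasserstein (sigma s) (sigma t))%:E <=
       \int[lebesgue_measure]_(tau in `[s, t]) (m tau)%:E)%E.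

(* lim returns the default value 0 at the (negligible) times t at which the
   limit does not exist. *)
Definition metric_derivative (R : realType) (d : nat) (p : R)
    (sigma : R -> Pp d p) (t : R) : R :=
  lim (wasserstein (sigma (t + h)) (sigma t) / `|h|
       @[h --> within [set h | 0 <= t + h] 0^']).

Definition AC_p_delta (R : realType) (d : nat) (p delta : R)
    (sigma : R -> Pp d p) : Prop :=
  locally_p_ac sigma /\
  (\int[lebesgue_measure]_(t in `[0%R, +oo[)
     (expR (- delta * t) * metric_derivative sigma t `^ p)%:E < +oo)%E.

Definition action (R : realType) (d : nat) (p delta : R) (V : Pp d p -> R)
    (sigma : R -> Pp d p) : \bar R :=
  (\int[lebesgue_measure]_(t in `[0%R, +oo[)
     (expR (- delta * t) *
       (p^-1 * metric_derivative sigma t `^ p - V (sigma t)))%:E)%E.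

Definition value_function (R : realType) (d : nat) (p delta : R)
    (V : Pp d p -> R) (mu : Pp d p) : \bar R :=
  ereal_inf [set action delta V sigma
            | sigma in [set sigma | AC_p_delta delta sigma /\ sigma 0 = mu]].

(* Main.v *)
(* Direct method.  As the Levy-Prokhorov metric is at most 1, V is bounded and, by dominated
   convergence, the potential term is continuous along pathwise Levy-Prokhorov limits.

   Metric speed: for a path with W(s, t) <= int_s^t M, each function t |-> W(sigma t, sigma q) has
   a density, and the supremum over rational q of the absolute values of these densities is the
   metric derivative and dominates W on intervals.

   Compactness: let g_k be the speeds of a minimizing sequence starting at mu, G_k the primitive
   of g_k and E_k that of e^(-delta t) g_k^p.  Young's inequality
     g <= c^(1-p) g^p / p + (1 - 1/p) c   for all c > 0
   makes the paths W_p-equicontinuous, with bounded p-th moments on bounded time intervals.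
   Measures with bounded moments are compact for the Levy-Prokhorov metric: coding R^d by
   real numbers, one extracts a subsequence along which the quantile functions of the codes
   converge at all rationals, which yields random variables converging almost everywhere.
   A diagonal argument over rational times gives a limit path sigma.

   Lower semicontinuity: W_p is lower semicontinuous, so W(sigma s, sigma t) <= G t - G s, where
   the limits G and E of G_k and E_k still satisfy Young's inequality for all c.  Hence dG is
   absolutely continuous and sigma has a metric speed g.  Optimizing over c,
     e^(-delta t) (W(sigma t, sigma (t+h)) / h)^p <= e^(2 delta h) (E (t+h) - E t) / h,
   and Fatou's lemma as h -> 0 bounds the energy of g by the limit of the energies of g_k. *)
Require Import Defs.
From HB Require Import structures.
From mathcomp Require Import all_boot all_order all_algebra.
From mathcomp Require Import all_classical all_reals all_analysis.
From mathcomp Require Import ring lra measurable_realfun.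
Import Defs.

Set Implicit Arguments.
Unset Strict Implicit.
Unset Printing Implicit Defensive.

Import Order.TTheory GRing.Theory Num.Theory.
Import numFieldNormedType.Exports.

Local Open Scope classical_set_scope.
Local Open Scope ring_scope.

(** Couplings are glued over a countable partition into small cells instead of along conditional
    laws, so the triangle inequality for W_p is first obtained with an error, which is then sent to
    0. Weak compactness is reduced to the real line: vectors are coded injectively by points of the
    Cantor set, where decoding is continuous as long as nothing escapes to infinity, and monotone
    functions that converge at the rationals converge off a countable set. The moment bounds enter
    through Fatou's lemma, which excludes escape to infinity almost everywhere. No weak limit of the
    speeds in L^p is taken: only the scalar functions G_k and E_k pass to the limit, and Young's
    inequality with a free parameter c is the linear form of the Hölder inequality that survives
    pointwise limits. The metric derivative, defined through a limit, is handled by a Borel function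
    that equals it off a Borel null set; integrals do not see the difference. *)

Lemma eq_ler (R : numDomainType) (x y : R) : x = y -> x <= y.
Proof. by move->. Qed.

(** * Euclidean norm and distance on row vectors *)

Section euclidean.
Context {R : realType} {d : nat}.
Implicit Types x y z : 'rV[R]_d.

Lemma enorm_ge0 x : 0 <= enorm x.
Proof. exact: sqrtr_ge0. Qed.

Lemma edist_ge0 x y : 0 <= edist x y.
Proof. exact: enorm_ge0. Qed.

Lemma sqr_enorm x : enorm x ^+ 2 = \sum_(i < d) x ord0 i ^+ 2.
Proof. by rewrite sqr_sqrtr// sumr_ge0// => i _; rewrite sqr_ge0. Qed.

Lemma coord_le_enorm x i : `|x ord0 i| <= enorm x.
Proof.
rewrite -(@ler_pXn2r _ 2)// ?nnegrE ?normr_ge0 ?enorm_ge0//.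
rewrite sqr_enorm real_normK ?num_real// (bigD1 i)//= lerDl.
by rewrite sumr_ge0// => j _; rewrite sqr_ge0.
Qed.

Lemma enorm_le_sum x : enorm x <= \sum_(i < d) `|x ord0 i|.
Proof.
have s0 : 0 <= \sum_(i < d) `|x ord0 i| by rewrite sumr_ge0.
rewrite -(@ler_pXn2r _ 2)// ?nnegrE ?enorm_ge0// sqr_enorm.
rewrite [leRHS]expr2 mulr_suml ler_sum// => i _.
rewrite -(real_normK (num_real (x ord0 i))) expr2 ler_wpM2l//.
by rewrite (bigD1 i)//= lerDl sumr_ge0.
Qed.

Lemma enormN x : enorm (- x) = enorm x.
Proof. by rewrite /enorm; under eq_bigr do rewrite mxE sqrrN. Qed.

Lemma enorm_eq0 x : enorm x = 0 -> x = 0.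
Proof.
move=> x0; apply/rowP => i; rewrite !mxE; apply/eqP.
by rewrite -normr_le0 -x0 coord_le_enorm.
Qed.

Lemma enorm0 : enorm (0 : 'rV[R]_d) = 0.
Proof.
apply/le_anti; rewrite enorm_ge0 andbT (le_trans (enorm_le_sum _))//.
by rewrite big1// => i _; rewrite mxE normr0.
Qed.

(** With a and b the two norms, each term is bounded by expanding 0 <= (b x_i - a y_i)^2 / (2 a b);
    summing over i yields a b / 2 twice. *)
Lemma cauchy_schwarz_rV x y :
  \sum_(i < d) x ord0 i * y ord0 i <= enorm x * enorm y.
Proof.
have [x0|x0] := eqVneq (enorm x) 0.
  by rewrite x0 mul0r (enorm_eq0 x0) big1// => i _; rewrite mxE mul0r.
have [y0|y0] := eqVneq (enorm y) 0.
  by rewrite y0 mulr0 (enorm_eq0 y0) big1// => i _; rewrite mxE mulr0.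
have xp : 0 < enorm x by rewrite lt_def x0 enorm_ge0.
have yp : 0 < enorm y by rewrite lt_def y0 enorm_ge0.
set a := enorm x in xp x0 *; set b := enorm y in yp y0 *.
have h i : x ord0 i * y ord0 i <=
    (2 * a)^-1 * b * x ord0 i ^+ 2 + (2 * b)^-1 * a * y ord0 i ^+ 2.
  have : 0 <= (2 * a * b)^-1 * (b * x ord0 i - a * y ord0 i) ^+ 2.
    by rewrite mulr_ge0 ?sqr_ge0// invr_ge0 ?mulr_ge0 ?ltW.
  move=> h; rewrite -subr_ge0; apply: le_trans h _; apply: eq_ler.
  by field; rewrite x0 y0.
apply: (le_trans (ler_sum _ (fun i _ => h i))).
rewrite big_split/= -!mulr_sumr -!sqr_enorm -/a -/b; apply: eq_ler.
by field; rewrite x0 y0.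
Qed.

Lemma enormD x y : enorm (x + y) <= enorm x + enorm y.
Proof.
rewrite -(@ler_pXn2r _ 2)// ?nnegrE ?addr_ge0 ?enorm_ge0//.
rewrite sqrrD !sqr_enorm.
under eq_bigr do rewrite mxE sqrrD.
rewrite 2!big_split/= lerD2r lerD2l.
under eq_bigr do rewrite -mulr_natr.
by rewrite -mulr_suml mulr_natr ler_wMn2r// cauchy_schwarz_rV.
Qed.

Lemma edistxx x : edist x x = 0.
Proof. by rewrite /edist subrr enorm0. Qed.

Lemma edistC x y : edist x y = edist y x.
Proof. by rewrite /edist -enormN opprB. Qed.

Lemma edist_triangle y x z : edist x z <= edist x y + edist y z.
Proof. by rewrite /edist -(subrKA y x) enormD. Qed.

Lemma enorm_le_edist x y : enorm x <= enorm y + edist x y.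
Proof. by have := enormD y (x - y); rewrite addrC subrK. Qed.

Lemma edist_le_enorm x y : edist x y <= enorm x + enorm y.
Proof. by rewrite -(enormN y) enormD. Qed.

Lemma coord_le_edist x y i : `|x ord0 i - y ord0 i| <= edist x y.
Proof. by have := coord_le_enorm (x - y) i; rewrite !mxE. Qed.

Lemma edist_le_sum x y : edist x y <= \sum_(i < d) `|x ord0 i - y ord0 i|.
Proof.
by apply: le_trans (enorm_le_sum _) _; rewrite ler_sum// => i _; rewrite !mxE.
Qed.

Lemma enorm2_ge0 (z : 'rV[R]_d * 'rV[R]_d) : 0 <= enorm2 z.
Proof. exact: sqrtr_ge0. Qed.

Lemma enorm2_le (z : 'rV[R]_d * 'rV[R]_d) : enorm2 z <= enorm z.1 + enorm z.2.
Proof.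
rewrite -(@ler_pXn2r _ 2)// ?nnegrE ?addr_ge0 ?enorm_ge0 ?enorm2_ge0//.
rewrite sqr_sqrtr ?addr_ge0 ?sqr_ge0// sqrrD lerD2r lerDl.
by rewrite mulrn_wge0// mulr_ge0 ?enorm_ge0.
Qed.

End euclidean.

(** * Topology and Borel structure of R^d *)

Section measurability.
Context {R : realType} {d : nat}.

(** The ambient topology comes from the sup norm, compared with the Euclidean distance through sup
    <= Euclidean <= sum over the coordinates. The divisor [d.+1] makes the last bound strict and
    covers [d = 0]. *)
Lemma nbhs_edist (x : 'rV[R]_d) (A : set 'rV[R]_d) :
  nbhs x A <-> exists2 e, 0 < e & [set y | edist y x < e] `<=` A.
Proof.
split.
- move/nbhs_ballP => [e /= e0 xA]; exists e => // y /= yx; apply: xA.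
  split=> // i j; rewrite (ord1 i) /ball/=; apply: le_lt_trans yx.
  by rewrite edistC coord_le_edist.
- move=> [e e0 eA]; apply/nbhs_ballP; exists (e / d.+1%:R) => /=.
    by rewrite divr_gt0.
  move=> y xy; apply: eA => /=; rewrite edistC; apply: le_lt_trans (edist_le_sum _ _) _.
  have : \sum_(i < d) `|x ord0 i - y ord0 i| <= \sum_(i < d) (e / d.+1%:R).
    apply: ler_sum => i _; rewrite ltW//.
    by have := xy.2 ord0 i; rewrite /ball/=.
  move/le_lt_trans; apply; rewrite sumr_const card_ord -mulrnAr.
  rewrite -[X in _ < X]mulr1 ltr_pM2l// -mulr_natr mulrC ltr_pdivrMr// mul1r.
  by rewrite ltr_nat.
Qed.

Lemma continuous_enorm : continuous (@enorm R d).
Proof.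
move=> x; have FF : ProperFilter (nbhs x) := nbhs_pfilter x.
apply/cvgrPdist_lt => e e0.
apply/nbhs_edist; exists e => // y /=; apply: le_lt_trans.
rewrite ler_distlC; apply/andP; split.
  by rewrite lerBlDr edistC enorm_le_edist.
by rewrite enorm_le_edist.
Qed.

Lemma open_measurable_Rd (A : set 'rV[R]_d) : open A -> measurable (A : set (Rd R d)).
Proof. by move=> oA; apply: sub_sigma_algebra. Qed.

Lemma closed_measurable_Rd (A : set 'rV[R]_d) :
  closed A -> measurable (A : set (Rd R d)).
Proof.
by move=> cA; rewrite -(setCK A); apply: measurableC; apply: open_measurable_Rd; rewrite openC.
Qed.

Lemma continuous_measurable_Rd (f : 'rV[R]_d -> R) :
  continuous f -> measurable_fun setT (f : Rd R d -> R).
Proof.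
move=> cf; apply: (measurability _ (RGenOpens.measurableE R)) => _ [_ [a [b ->]] <-].
rewrite setTI; apply: open_measurable_Rd.
by move/continuousP : cf; apply; exact: interval_open.
Qed.

Lemma measurable_coord (i : 'I_d) :
  measurable_fun setT (fun x : Rd R d => (x : 'rV[R]_d) ord0 i).
Proof. by apply: continuous_measurable_Rd; exact: coord_continuous. Qed.

Lemma measurable_enorm : measurable_fun setT (@enorm R d : Rd R d -> R).
Proof. by apply: continuous_measurable_Rd; exact: continuous_enorm. Qed.

(** The sigma-algebra is generated by the open sets, so the information on coordinates has to reach
    these: every open set is a countable union of cubes with rational centre and radius 1 / (n +
    1). *)
Lemma measurable_to_Rd dT (T : measurableType dT) (D : set T) (f : T -> Rd R d) :
  measurable D ->
  (forall i, measurable_fun D (fun t => (f t : 'rV[R]_d) ord0 i)) ->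
  measurable_fun D f.
Proof.
move=> mD mf; apply: (@measurability _ _ T (Rd R d) D f (@open 'rV[R]_d) erefl) => _ [U oU <-].
pose q (z : 'rV[rat]_d * nat) (x : 'rV[R]_d) :=
  forall i, `|ratr (z.1 ord0 i) - x ord0 i| < z.2.+1%:R^-1.
rewrite (_ : f @^-1` U = \bigcup_(z in [set z | [set x | q z x] `<=` U])
    (f @^-1` [set x | q z x])); last first.
  apply/seteqP; split => [t /= Ut|t [z qU]]; last exact: qU.
  have /nbhs_edist[e e0 eU] : nbhs (f t) U by exact: open_nbhs_nbhs.
  (* Two points of a cube of radius 1 / (n + 1) are at distance at most 2 d / (n + 1), which this
     choice puts below [e]. *)
  have [n nE] : exists n, 2 * d.+1%:R / e < n.+1%:R.
    exists (Num.trunc (2 * d.+1%:R / e)).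
    by have := truncnS_gt (2 * d.+1%:R / e); rewrite ?num_real//.
  have n0 : 0 < n.+1%:R^-1 :> R by rewrite invr_gt0.
  have hq i : exists r : rat, `|ratr r - (f t : 'rV[R]_d) ord0 i| < n.+1%:R^-1.
    have [r] : exists r : rat, (f t : 'rV[R]_d) ord0 i < ratr r < (f t : 'rV[R]_d) ord0 i + n.+1%:R^-1.
      have /rat_in_itvoo[r] : (f t : 'rV[R]_d) ord0 i < (f t : 'rV[R]_d) ord0 i + n.+1%:R^-1 by rewrite ltrDl.
      by rewrite in_itv/= => ?; exists r.
    by move=> /andP[h1 h2]; exists r; rewrite gtr0_norm ?subr_gt0// ltrBlDl.
  have [g gE] := choice hq.
  exists (\row_i g i, n) => /=; last by move=> i; rewrite mxE gE.
  move=> x /= qx; apply: eU => /=; apply: le_lt_trans (edist_le_sum _ _) _.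
  apply: (@le_lt_trans _ _ (\sum_(i < d) (2 * n.+1%:R^-1 : R))).
    apply: ler_sum => i _.
    rewrite -(subrKA (ratr (g i))) (le_trans (ler_normD _ _))//.
    rewrite mulrDl mul1r; apply: lerD; apply: ltW; last first.
      exact: gE.
    by rewrite distrC; have := qx i; rewrite mxE.
  rewrite sumr_const card_ord -[X in X < _]mulr_natr mulrAC ltr_pdivrMr//.
  move: nE; rewrite ltr_pdivrMr// (mulrC _ e); apply: le_lt_trans.
  by rewrite ler_pM2l// ler_nat.
rewrite setI_bigcupr bigcup_mkcond.
apply: countable_bigcupT_measurable => [|z]; first exact: countableP.
case: ifP => // _.
(* [D] is repeated inside because the coordinates are measurable on [D] only; the outer copy covers
   the empty intersection at [d = 0]. *)
have -> : D `&` f @^-1` [set x | q z x] =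
   D `&` \bigcap_(i in [set: 'I_d]) (D `&` [set t | `|ratr (z.1 ord0 i) - (f t : 'rV[R]_d) ord0 i| < z.2.+1%:R^-1]).
  apply/seteqP; split=> [t [Dt] /= qt|t [Dt qt]]; split=> //=.
    by move=> i _; split=> //; exact: qt.
  by move=> i; exact: (qt i I).2.
apply: measurableI => //; apply: fin_bigcap_measurable; first exact: finite_finset.
move=> i _.
have mi : measurable_fun D (fun t => ratr (z.1 ord0 i) - (f t : 'rV[R]_d) ord0 i).
  by apply: measurable_funB => //; exact: mf.
have := @normr_measurable R setT measurableT _ (measurable_itv `]-oo, z.2.+1%:R^-1[).
rewrite setTI => mn; have := mi mD _ mn.
by congr (measurable (_ `&` _)); apply/seteqP; split=> t/=; rewrite in_itv.
Qed.

Lemma measurable_to_Rd_comp dT (T : measurableType dT) (f : T -> Rd R d) :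
  measurable_fun setT f -> forall i, measurable_fun setT (fun t => (f t : 'rV[R]_d) ord0 i).
Proof. by move=> mf i; apply: (measurableT_comp (measurable_coord i)). Qed.

Lemma measurable_edist dT (T : measurableType dT) (f g : T -> Rd R d) :
  measurable_fun setT f -> measurable_fun setT g ->
  measurable_fun setT (fun t => edist (f t) (g t)).
Proof.
move=> mf mg; apply: (measurableT_comp measurable_enorm).
apply: measurable_to_Rd => // i; rewrite [X in measurable_fun _ X](_ : _ =
  (fun t => (f t : 'rV[R]_d) ord0 i - (g t : 'rV[R]_d) ord0 i)); last first.
  by apply/funext => t; rewrite !mxE.
by apply: measurable_funB; exact: measurable_to_Rd_comp.
Qed.

Lemma measurable_edist12 :
  measurable_fun setT (fun z : Rd R d * Rd R d => edist z.1 z.2).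
Proof. by apply: measurable_edist; [exact: measurable_fst|exact: measurable_snd]. Qed.

Lemma measurable_enorm2 :
  measurable_fun setT (@enorm2 R d : Rd R d * Rd R d -> R).
Proof.
apply: measurableT_comp.
  by apply: continuous_measurable_fun; exact: sqrt_continuous.
apply: measurable_funD; apply: measurable_funX;
  apply: (measurableT_comp measurable_enorm).
  exact: measurable_fst.
exact: measurable_snd.
Qed.

End measurability.

(** * Thickenings of sets *)

Section thickening.
Context {R : realType} {d : nat}.
Implicit Types (A B : set 'rV[R]_d) (e : R).

Lemma open_thicken e A : open (thicken e A).
Proof.
apply: bigcup_open => z Az; rewrite openE => x /= xz; apply/nbhs_edist.
exists (e - edist x z); first by rewrite subr_gt0.
move=> y /= yx; apply: le_lt_trans (edist_triangle x _ _) _.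
by rewrite -ltrBrDr.
Qed.

Lemma measurable_thicken e A : measurable (thicken e A : set (Rd R d)).
Proof. by apply: open_measurable_Rd; exact: open_thicken. Qed.

Lemma thicken_subset e f A : e <= f -> thicken e A `<=` thicken f A.
Proof. by move=> ef x [z Az xz]; exists z => //=; exact: lt_le_trans ef. Qed.

Lemma thicken_comp e f A : thicken e (thicken f A) `<=` thicken (e + f) A.
Proof.
move=> x [y [z Az yz] xy]; exists z => //=.
by apply: le_lt_trans (edist_triangle y _ _) _; exact: ltrD.
Qed.

Lemma subset_thicken e A : 0 < e -> A `<=` thicken e A.
Proof. by move=> e0 x Ax; exists x => //=; rewrite edistxx. Qed.

Lemma closed_thicken A : closed A -> \bigcap_n (thicken n.+1%:R^-1 A) = A.
Proof.
move=> cA; apply/seteqP; split => [x xA|x Ax n _]; last first.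
  by apply: subset_thicken => //; rewrite invr_gt0.
apply: cA => B /nbhs_edist[e e0 eB].
have [n /(_ n (leqnn n)) ne] : exists n, forall m, (n <= m)%N -> m.+1%:R^-1 < e.
  exists (Num.trunc e^-1) => m nm; rewrite invf_plt ?posrE//.
  apply: lt_le_trans (truncnS_gt _) _.
  by rewrite ler_nat ltnS.
have [z Az /= xz] := xA n I; exists z; split => //; apply: eB => /=.
by rewrite edistC (lt_trans xz).
Qed.

End thickening.

(** * Pairs of vectors as vectors of length d + d *)

Section row_pairs.
Context {R : realType} {d : nat}.

Lemma sqr_enorm_row_mx (x y : 'rV[R]_d) :
  enorm (row_mx x y) ^+ 2 = enorm x ^+ 2 + enorm y ^+ 2.
Proof.
by rewrite !sqr_enorm big_split_ord/=; congr (_ + _); apply: eq_bigr => i _;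
  rewrite ?row_mxEl ?row_mxEr.
Qed.

Lemma enorm_row_mx_le (x y : 'rV[R]_d) : enorm (row_mx x y) <= enorm x + enorm y.
Proof.
rewrite -(@ler_pXn2r _ 2)// ?nnegrE ?addr_ge0 ?enorm_ge0// sqr_enorm_row_mx.
by rewrite sqrrD lerD2r lerDl mulrn_wge0// mulr_ge0 ?enorm_ge0.
Qed.

Lemma edist_lsubmx (a b : 'rV[R]_(d + d)) : edist (lsubmx a) (lsubmx b) <= edist a b.
Proof.
rewrite -(@ler_pXn2r _ 2)// ?nnegrE ?edist_ge0// /edist -linearB/=.
by rewrite -[in leRHS](hsubmxK (a - b)) sqr_enorm_row_mx lerDl sqr_ge0.
Qed.

Lemma edist_rsubmx (a b : 'rV[R]_(d + d)) : edist (rsubmx a) (rsubmx b) <= edist a b.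
Proof.
rewrite -(@ler_pXn2r _ 2)// ?nnegrE ?edist_ge0// /edist -linearB/=.
by rewrite -[in leRHS](hsubmxK (a - b)) sqr_enorm_row_mx lerDr sqr_ge0.
Qed.

(** This map turns a coupling into a law on R^(d + d), so that the representation theorem for laws
    on one space applies to couplings too. *)
Lemma measurable_row_mx :
  measurable_fun setT (fun z : Rd R d * Rd R d => row_mx z.1 z.2 : Rd R (d + d)).
Proof.
apply: measurable_to_Rd => // i; under eq_fun do rewrite mxE.
case: fintype.split => k; apply: measurable_to_Rd_comp => //.
Qed.

Lemma measurable_lsubmx : measurable_fun setT (@lsubmx R 1 d d : Rd R (d + d) -> Rd R d).
Proof.
apply: measurable_to_Rd => // i; under eq_fun do rewrite mxE.
exact: measurable_coord.
Qed.

Lemma measurable_rsubmx : measurable_fun setT (@rsubmx R 1 d d : Rd R (d + d) -> Rd R d).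
Proof.
apply: measurable_to_Rd => // i; under eq_fun do rewrite mxE.
exact: measurable_coord.
Qed.

End row_pairs.

(** * Laws and couplings *)

(** A copy of [m] that carries the proof [m1] of its total mass, to which the probability structure
    can be attached. *)
Definition normalized_measure {R : realType} d (T : measurableType d)
    (m : {measure set T -> \bar R}) (m1 : m setT = 1%E) : set T -> \bar R := m.

Section normalized_measure.
Context {R : realType} d (T : measurableType d).
Variables (m : {measure set T -> \bar R}) (m1 : m setT = 1%E).

Let nm0 : normalized_measure m1 set0 = 0%E. Proof. exact: measure0. Qed.

Let nm_ge0 A : (0 <= normalized_measure m1 A)%E. Proof. exact: measure_ge0. Qed.

Let nm_semi_sigma_additive : semi_sigma_additive (normalized_measure m1).
Proof. exact: measure_semi_sigma_additive. Qed.

HB.instance Definition _ := isMeasure.Build _ _ _ (normalized_measure m1)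
  nm0 nm_ge0 nm_semi_sigma_additive.

HB.instance Definition _ :=
  Measure_isProbability.Build _ _ _ (normalized_measure m1) m1.

Lemma probability_of_measure : exists P : probability T R, forall A, P A = m A.
Proof. by exists (normalized_measure m1). Qed.

End normalized_measure.

(** By symmetry a <= b, and then a + b <= 2 b. *)
Lemma powRD_le (R : realType) (p a b : R) : 0 <= p -> 0 <= a -> 0 <= b ->
  (a + b) `^ p <= 2 `^ p * (a `^ p + b `^ p).
Proof.
move=> p0 a0 b0.
have h (x y : R) : 0 <= x -> x <= y -> (x + y) `^ p <= 2 `^ p * (x `^ p + y `^ p).
  move=> x0 xy; have y0 := le_trans x0 xy.
  apply: (@le_trans _ _ ((2 * y) `^ p)).
    by apply: ge0_ler_powR => //; rewrite ?nnegrE ?addr_ge0 ?mulr_ge0// mulrDl mul1r lerD2r.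
  by rewrite powRM// ler_wpM2l ?powR_ge0// lerDr powR_ge0.
have [ab|/ltW ab] := leP a b; first exact: h.
by rewrite addrC [X in _ * X]addrC h.
Qed.

Section laws.
Context {R : realType}.

Lemma measurable_set_ltr d (T : measurableType d) (f g : T -> R) :
  measurable_fun setT f -> measurable_fun setT g -> measurable [set t | f t < g t].
Proof.
move=> mf mg; have := measurable_fun_ltr mf mg measurableT (Y := [set true]).
by rewrite setTI; apply.
Qed.

Lemma measurable_set_ler d (T : measurableType d) (f g : T -> R) :
  measurable_fun setT f -> measurable_fun setT g -> measurable [set t | f t <= g t].
Proof.
move=> mf mg; have := measurable_fun_ler mf mg measurableT (Y := [set true]).
by rewrite setTI; apply.
Qed.

(** Both laws are plain set functions: probabilities, elements of [Pp] and series of measures are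
    compared without being repackaged. *)
Definition has_law d d' (T : measurableType d) (S : measurableType d')
    (P : set T -> \bar R) (f : T -> S) (Q : set S -> \bar R) :=
  forall A, measurable A -> P (f @^-1` A) = Q A.

Lemma exists_law d d' (T : measurableType d) (S : measurableType d')
    (P : probability T R) (f : T -> S) : measurable_fun setT f ->
  exists Q : probability S R, has_law P f Q.
Proof.
move=> mf; pose mF := isMeasurableFun.Build _ _ _ _ f mf.
pose F : {mfun T >-> S} := HB.pack f mF.
by exists (distribution P F).
Qed.

Lemma integral_law d d' (T : measurableType d) (S : measurableType d')
    (P : {measure set T -> \bar R}) (f : T -> S) (Q : {measure set S -> \bar R})
    (g : S -> \bar R) :
  measurable_fun setT f -> has_law P f Q ->
  measurable_fun setT g -> (forall x, 0 <= g x)%E ->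
  (\int[Q]_x g x = \int[P]_t g (f t))%E.
Proof.
move=> mf PQ mg g0.
pose mF := isMeasurableFun.Build _ _ _ _ f mf.
pose F : {mfun T >-> S} := HB.pack f mF.
transitivity (\int[pushforward P F]_x g x)%E.
  by apply: eq_measure_integral => A mA _; rewrite /pushforward/= -PQ.
by rewrite ge0_integral_pushforward.
Qed.

Lemma has_law_comp d d' d'' (T : measurableType d) (S : measurableType d')
    (U : measurableType d'') (P : set T -> \bar R) (f : T -> S)
    (Q : set S -> \bar R) (g : S -> U) (L : set U -> \bar R) :
  measurable_fun setT g -> has_law P f Q -> has_law Q g L -> has_law P (g \o f) L.
Proof.
move=> mg PQ QL A mA; rewrite -QL// -PQ//; rewrite -[X in measurable X]setTI; exact: mg.
Qed.

End laws.

Section couplings.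
Context {R : realType} {d : nat} {p : R}.
Hypothesis p1 : 1 < p.
Implicit Types mu nu lam : @Pp R d p.

Let p0 : 0 < p. Proof. exact: lt_trans p1. Qed.
Let p_ge0 : 0 <= p. Proof. exact: ltW. Qed.

Lemma measurable_powR_EFin dT (T : measurableType dT) (f : T -> R) :
  measurable_fun setT f -> measurable_fun setT (fun t => (f t `^ p)%:E).
Proof. by move=> mf; apply/measurable_EFinP; apply: (measurableT_comp (measurable_powR p)). Qed.

Lemma moment_law dT (T : measurableType dT) (P : {measure set T -> \bar R})
    (X : T -> Rd R d) (Q : {measure set (Rd R d) -> \bar R}) :
  measurable_fun setT X -> has_law P X Q ->
  (\int[Q]_x (enorm x `^ p)%:E = \int[P]_t (enorm (X t) `^ p)%:E)%E.
Proof.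
move=> mX PX; rewrite (integral_law mX PX)//.
  exact: (measurable_powR_EFin measurable_enorm).
by move=> x; rewrite lee_fin powR_ge0.
Qed.

Lemma ge0_integralD_powR dT (T : measurableType dT) (P : {measure set T -> \bar R})
    (f g : T -> R) (k : R) : 0 <= k -> measurable_fun setT f -> measurable_fun setT g ->
  (\int[P]_t (k * (f t `^ p + g t `^ p))%:E =
   k%:E * (\int[P]_t (f t `^ p)%:E + \int[P]_t (g t `^ p)%:E))%E.
Proof.
move=> k0 mf mg; have mfp := measurable_powR_EFin mf; have mgp := measurable_powR_EFin mg.
under eq_integral do rewrite EFinM EFinD.
rewrite ge0_integralZl//=; last 2 first.
- exact: emeasurable_funD.
- by move=> x _; rewrite adde_ge0// lee_fin powR_ge0.
by rewrite ge0_integralD// => x _; rewrite lee_fin powR_ge0.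
Qed.

Lemma integral_powR_le dT (T : measurableType dT) (P : {measure set T -> \bar R})
    (h f g : T -> R) : measurable_fun setT h -> measurable_fun setT f ->
    measurable_fun setT g ->
  (forall t, 0 <= h t) -> (forall t, 0 <= f t) -> (forall t, 0 <= g t) ->
  (forall t, h t <= f t + g t) ->
  (\int[P]_t (h t `^ p)%:E <=
   (2 `^ p)%:E * (\int[P]_t (f t `^ p)%:E + \int[P]_t (g t `^ p)%:E))%E.
Proof.
move=> mh mf mg h0 f0 g0 hfg; rewrite -ge0_integralD_powR ?powR_ge0//.
apply: ge0_le_integral => //.
- by move=> t _; rewrite lee_fin powR_ge0.
- exact: measurable_powR_EFin.
- apply/measurable_EFinP; apply: measurable_funM => //.
  by apply: measurable_funD; exact/measurable_EFinP/measurable_powR_EFin.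
- move=> t _; rewrite lee_fin; apply: le_trans (powRD_le _ _ _) => //.
  by apply: ge0_ler_powR => //; rewrite ?nnegrE ?addr_ge0.
Qed.

(** The coupling is the joint law of (X, Y). Its p-th moment is finite because [enorm2] is at most
    the sum of the two norms. *)
Lemma coupling_of_rvs dT (T : measurableType dT) (P : probability T R)
    (X Y : T -> Rd R d) mu nu :
  measurable_fun setT X -> measurable_fun setT Y ->
  has_law P X mu -> has_law P Y nu ->
  exists2 pi, coupling mu nu pi &
    (transport_cost p pi = \int[P]_t (edist (X t) (Y t) `^ p)%:E)%E.
Proof.
move=> mX mY PX PY.
have mXY : measurable_fun setT (fun t => (X t, Y t)) by exact: measurable_fun_pair.
have [pi piE] := exists_law P mXY.
exists pi; last first.
  rewrite /transport_cost (integral_law mXY piE)//.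
    by apply: measurable_powR_EFin; exact: measurable_edist12.
  by move=> x; rewrite lee_fin powR_ge0.
split => [|A mA|A mA].
- rewrite (integral_law mXY piE); last 2 first.
  + by apply: measurable_powR_EFin; exact: measurable_enorm2.
  + by move=> x; rewrite lee_fin powR_ge0.
  have mnX := measurableT_comp measurable_enorm mX.
  have mnY := measurableT_comp measurable_enorm mY.
  apply: le_lt_trans (integral_powR_le _ _ mnX mnY _ _ _ _) _.
  + by apply: (measurableT_comp measurable_enorm2).
  + by move=> t; exact: enorm2_ge0.
  + by move=> t; exact: enorm_ge0.
  + by move=> t; exact: enorm_ge0.
  + by move=> t; exact: enorm2_le.
  rewrite -(moment_law mX PX) -(moment_law mY PY).
  by rewrite lte_mul_pinfty ?lee_fin ?powR_ge0// lte_add_pinfty// Pp_moment.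
- rewrite /pushforward -piE ?PX//.
  by rewrite -[X in measurable X]setTI; exact: measurable_fst.
- rewrite /pushforward -piE ?PY//.
  by rewrite -[X in measurable X]setTI; exact: measurable_snd.
Qed.

Lemma coupling_fst mu nu pi : coupling mu nu pi -> has_law pi fst mu.
Proof. by move=> [_ h _]. Qed.

Lemma coupling_snd mu nu pi : coupling mu nu pi -> has_law pi snd nu.
Proof. by move=> [_ _ h]. Qed.

Lemma transport_cost_ge0 pi : (0 <= transport_cost (d := d) p pi)%E.
Proof. by apply: integral_ge0 => x _; rewrite lee_fin powR_ge0. Qed.

Lemma transport_cost_fin mu nu pi : coupling mu nu pi ->
  transport_cost p pi \is a fin_num.
Proof.
move=> cpi; rewrite ge0_fin_numE ?transport_cost_ge0//.
have m1 : measurable_fun setT (fun z : Rd R d * Rd R d => enorm z.1).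
  exact: (measurableT_comp measurable_enorm).
have m2 : measurable_fun setT (fun z : Rd R d * Rd R d => enorm z.2).
  exact: (measurableT_comp measurable_enorm).
apply: le_lt_trans (integral_powR_le _ measurable_edist12 m1 m2 _ _ _ _) _.
- by move=> z; exact: edist_ge0.
- by move=> z; exact: enorm_ge0.
- by move=> z; exact: enorm_ge0.
- by move=> z; exact: edist_le_enorm.
rewrite -(moment_law measurable_fst (coupling_fst cpi)).
rewrite -(moment_law measurable_snd (coupling_snd cpi)).
by rewrite lte_mul_pinfty ?lee_fin ?powR_ge0// lte_add_pinfty// Pp_moment.
Qed.

Lemma coupling_nonempty mu nu : coupling mu nu !=set0.
Proof.
have [|||| pi cpi _] := @coupling_of_rvs _ _ (mu \x nu)%E fst snd mu nu.
- exact: measurable_fst.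
- exact: measurable_snd.
- move=> A mA; have -> : fst @^-1` A = A `*` [set: Rd R d].
    by apply/seteqP; split => [[x y]//|[x y] []//].
  rewrite [LHS](product_measure1E mu nu mA measurableT).
  by rewrite -[RHS]mule1; congr (_ * _)%E; exact: probability_setT.
- move=> A mA; have -> : snd @^-1` A = [set: Rd R d] `*` A.
    by apply/seteqP; split => [[x y]//|[x y] []//].
  rewrite [LHS](product_measure1E mu nu measurableT mA).
  by rewrite -[RHS]mul1e; congr (_ * _)%E; exact: probability_setT.
by exists pi.
Qed.

(** [fine] would send an infinite infimum to 0. This never happens: a coupling exists, and every
    coupling has finite cost. *)
Lemma wassersteinE mu nu : (wasserstein mu nu)%:E =
  ereal_inf [set (transport_cost p pi `^ p^-1)%E | pi in coupling mu nu].
Proof.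
rewrite /wasserstein fineK// fin_numE; apply/andP; split.
  rewrite -ltNye; apply: (@lt_le_trans _ _ 0%E) => //.
  by apply: le_ereal_inf_tmp => _ [pi _ <-]; exact: poweR_ge0.
have [pi cpi] := coupling_nonempty mu nu.
rewrite -ltey; apply: (@le_lt_trans _ _ (transport_cost p pi `^ p^-1)%E).
  by apply: ereal_inf_lbound; exists pi.
by apply: poweR_lty; rewrite ltey_eq (transport_cost_fin cpi).
Qed.

Lemma wasserstein_ge0 mu nu : 0 <= wasserstein mu nu.
Proof.
rewrite -lee_fin wassersteinE.
by apply: le_ereal_inf_tmp => _ [pi _ <-]; exact: poweR_ge0.
Qed.

Lemma wasserstein_le_coupling mu nu pi : coupling mu nu pi ->
  ((wasserstein mu nu)%:E <= transport_cost p pi `^ p^-1)%E.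
Proof. by move=> cpi; rewrite wassersteinE; apply: ereal_inf_lbound; exists pi. Qed.

Lemma wasserstein_le_rvs dT (T : measurableType dT) (P : probability T R)
    (X Y : T -> Rd R d) mu nu :
  measurable_fun setT X -> measurable_fun setT Y ->
  has_law P X mu -> has_law P Y nu ->
  ((wasserstein mu nu)%:E <= (\int[P]_t (edist (X t) (Y t) `^ p)%:E) `^ p^-1)%E.
Proof.
move=> mX mY PX PY; have [pi cpi <-] := coupling_of_rvs mX mY PX PY.
exact: wasserstein_le_coupling.
Qed.

Lemma wasserstein_lt_coupling mu nu (c : R) : wasserstein mu nu < c ->
  exists2 pi, coupling mu nu pi & (transport_cost p pi `^ p^-1 < c%:E)%E.
Proof.
rewrite -lte_fin wassersteinE => /ereal_inf_lt[_ [pi cpi <-] h].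
by exists pi.
Qed.

Lemma wassersteinxx mu : wasserstein mu mu = 0.
Proof.
apply/le_anti; rewrite wasserstein_ge0 andbT -lee_fin.
apply: le_trans (@wasserstein_le_rvs _ _ mu id id mu mu _ _ _ _) _ => //.
under eq_integral do rewrite edistxx powR0 ?gt_eqF//.
by rewrite integral0 poweR0r// gt_eqF// invr_gt0.
Qed.

Lemma wassersteinC_le mu nu : wasserstein mu nu <= wasserstein nu mu.
Proof.
rewrite -lee_fin [leRHS]wassersteinE; apply: le_ereal_inf_tmp => _ [pi cpi <-].
apply: le_trans (wasserstein_le_rvs measurable_snd measurable_fst
  (coupling_snd cpi) (coupling_fst cpi)) _.
by under eq_integral do rewrite edistC.
Qed.

Lemma wassersteinC mu nu : wasserstein mu nu = wasserstein nu mu.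
Proof. by apply/le_anti; rewrite !wassersteinC_le. Qed.

End couplings.

(** * Gluing and the triangle inequality *)

Section gluing.
Context {R : realType} d1 d2 d3 (T1 : measurableType d1) (T2 : measurableType d2)
  (S : measurableType d3).
Variables (P1 : probability T1 R) (P2 : probability T2 R) (nu : probability S R)
  (Y1 : T1 -> S) (Y2 : T2 -> S) (Q : nat -> set S).
Hypotheses (mY1 : measurable_fun setT Y1) (mY2 : measurable_fun setT Y2).
Hypotheses (lawY1 : has_law P1 Y1 nu) (lawY2 : has_law P2 Y2 nu).
Hypotheses (mQ : forall i, measurable (Q i)) (tQ : trivIset setT Q)
  (QT : \bigcup_i Q i = setT).

Let mY1Q i : measurable (Y1 @^-1` Q i).
Proof. by rewrite -[X in measurable X]setTI; exact: mY1. Qed.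

Let mY2Q i : measurable (Y2 @^-1` Q i).
Proof. by rewrite -[X in measurable X]setTI; exact: mY2. Qed.

Let D i := Y1 @^-1` Q i `*` Y2 @^-1` Q i.

Let mD i : measurable (D i).
Proof. exact: measurableX. Qed.

Let c_ge0 i : 0 <= (fine (nu (Q i)))^-1.
Proof. by rewrite invr_ge0 fine_ge0. Qed.

Let c i : {nonneg R} := NngNum (c_ge0 i).

Let gam i : {measure set (T1 * T2) -> \bar R} :=
  mscale (c i) (mrestr (P1 \x P2)%E (mD i)).

Let gamma : {measure set (T1 * T2) -> \bar R} := mseries gam 0.

Let gamE i A B : measurable A -> measurable B ->
  gam i (A `*` B) = ((c i)%:num%:E *
    (P1 (A `&` Y1 @^-1` Q i) * P2 (B `&` Y2 @^-1` Q i)))%E.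
Proof.
move=> mA mB; rewrite /gam/= /mscale/= /mrestr/=; congr (_ * _)%E.
rewrite -setXI [LHS]product_measure1E//; exact: measurableI.
Qed.

(** Null cells cause no loss: there [x] itself vanishes, in agreement with the convention that the
    inverse of 0 is 0. *)
Let scaleE i x : (0 <= x <= nu (Q i))%E ->
  ((c i)%:num%:E * (x * nu (Q i)) = x)%E.
Proof.
move=> /andP[x0 xnu]; rewrite /c/=.
have nufin : nu (Q i) \is a fin_num by exact: fin_num_measure.
have xfin : x \is a fin_num.
  by rewrite ge0_fin_numE// (le_lt_trans xnu)// ltey_eq nufin.
rewrite -(fineK nufin) -(fineK xfin) -!EFinM; congr (_%:E).
have [n0|n0] := eqVneq (fine (nu (Q i))) 0.
  have : x = 0%E by apply/le_anti; rewrite x0 andbT (le_trans xnu)// -(fineK nufin) n0.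
  by move->; rewrite /= mul0r mulr0.
by rewrite mulrCA mulVf// mulr1.
Qed.

Let bigcup_preim d (T : measurableType d) (Y : T -> S) (P : probability T R) A :
  measurable A -> (forall i, measurable (Y @^-1` Q i)) ->
  (\sum_(i <oo) P (A `&` Y @^-1` Q i) = P A)%E.
Proof.
move=> mA mYQ; have AE : A = \bigcup_i (A `&` Y @^-1` Q i).
  by rewrite -setI_bigcupr -preimage_bigcup QT preimage_setT setIT.
rewrite [in RHS]AE measure_bigcup//=.
- by apply: eq_eseriesl => i; rewrite in_setT.
- by move=> i _; exact: measurableI.
- move=> i j _ _ [t [[_ ti] [_ tj]]].
  by apply: (tQ I I); exists (Y t).
Qed.

(* The gluing measure sums the normalized products of the restrictions of [P1] and [P2] to each
   cell; it matches the two laws only up to the size of the cells, but needs no disintegration. *)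
Lemma exists_gluing : exists gam : probability (T1 * T2)%type R,
  [/\ has_law gam fst P1, has_law gam snd P2 &
   forall A, measurable A -> (forall w i, Q i (Y1 w.1) -> Q i (Y2 w.2) -> ~ A w) ->
     gam A = 0%E].
Proof.
have h1 : has_law gamma fst P1.
  move=> A mA; have -> : fst @^-1` A = A `*` [set: T2].
    by apply/seteqP; split => [[x y]//|[x y] []//].
  rewrite /gamma/= /mseries -(bigcup_preim P1 mA mY1Q).
  apply: eq_eseriesr => i _; rewrite gamE// setTI (lawY2 (mQ i)) scaleE//.
  rewrite measure_ge0/= -(lawY1 (mQ i)) le_measure ?inE//.
  exact: measurableI.
have h2 : has_law gamma snd P2.
  move=> A mA; have -> : snd @^-1` A = [set: T1] `*` A.
    by apply/seteqP; split => [[x y]//|[x y] []//].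
  rewrite /gamma/= /mseries -(bigcup_preim P2 mA mY2Q).
  apply: eq_eseriesr => i _; rewrite gamE// setTI (lawY1 (mQ i)).
  rewrite [X in (_ * X)%E]muleC scaleE//.
  rewrite measure_ge0/= -(lawY2 (mQ i)) le_measure ?inE//.
  exact: measurableI.
have g1 : gamma setT = 1%E.
  by rewrite -(preimage_setT (@fst T1 T2)) h1// probability_setT.
have [G GE] := probability_of_measure g1.
exists G; split => [A mA|A mA|A mA hA]; rewrite GE; [exact: h1|exact: h2|].
rewrite /gamma/= /mseries eseries0// => i _ _.
rewrite /gam/= /mscale/= /mrestr.
rewrite (_ : A `&` D i = set0) ?measure0 ?mule0//.
by apply/seteqP; split => // w [Aw [/= w1 w2]]; exact: hA w i w1 w2 Aw.
Qed.

End gluing.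

Section small_cells.
Context {R : realType} {d : nat}.

Lemma rat_rV_dense (x : 'rV[R]_d) (e : R) : 0 < e ->
  exists q : 'rV[rat]_d, edist (map_mx ratr q) x < e.
Proof.
move=> e0; have e1 : 0 < e / d.+1%:R by rewrite divr_gt0.
have hq i : exists r : rat, `|ratr r - x ord0 i| < e / d.+1%:R.
  have /rat_in_itvoo[r] : x ord0 i < x ord0 i + e / d.+1%:R by rewrite ltrDl.
  rewrite in_itv/= => /andP[h1 h2]; exists r.
  by rewrite gtr0_norm ?subr_gt0// ltrBlDl.
have [g gE] := choice hq; exists (\row_i g i).
apply: le_lt_trans (edist_le_sum _ _) _.
apply: (@le_lt_trans _ _ (\sum_(i < d) (e / d.+1%:R))).
  by apply: ler_sum => i _; rewrite !mxE ltW.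
rewrite sumr_const card_ord -[X in X < _]mulr_natr mulrAC ltr_pdivrMr// ltr_pM2l//.
by rewrite ltr_nat.
Qed.

(** Balls of radius e / 2 around the rational points cover the space; removing from each the
    preceding ones makes them disjoint. *)
Lemma exists_cells (e : R) : 0 < e -> exists Q : nat -> set (Rd R d),
  [/\ forall i, measurable (Q i), trivIset setT Q, \bigcup_i Q i = setT &
      forall i x y, Q i x -> Q i y -> edist x y <= e].
Proof.
move=> e0; have e2 : 0 < e / 2 by rewrite divr_gt0.
pose B (n : nat) : set (Rd R d) :=
  if @unpickle 'rV[rat]_d n is Some q then
    thicken (e / 2) [set map_mx ratr q] else set0.
have mB n : measurable (B n).
  by rewrite /B; case: unpickle => [q|//]; exact: measurable_thicken.
exists (seqDU B); split => [i||| i x y].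
- by apply: measurableD => //; exact: bigsetU_measurable.
- exact: trivIset_seqDU.
- rewrite -seqDU_bigcup_eq; apply/seteqP; split => // x _.
  have [q qx] := rat_rV_dense x e2.
  exists (pickle q) => //; rewrite /B pickleK; exists (map_mx ratr q) => //=.
  by rewrite edistC.
- move=> [+ _] [+ _]; rewrite /B; case: unpickle => [q|//].
  move=> [_ -> /= xq] [_ -> /= yq]; rewrite (splitr e).
  apply: le_trans (edist_triangle (map_mx ratr q) _ _) _.
  by apply: lerD; rewrite ltW// edistC.
Qed.

End small_cells.

Section wasserstein_triangle.
Context {R : realType} {d : nat} {p : R}.
Hypothesis p1 : 1 < p.
Implicit Types mu nu lam : @Pp R d p.

Let p0 : 0 < p. Proof. exact: lt_trans p1. Qed.

Local Open Scope ereal_scope.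

(** Turns transport costs into L^p norms, to which Minkowski's inequality applies. *)
Lemma Lnorm_powRE dT (T : measurableType dT) (P : {measure set T -> \bar R}) (f : T -> R) :
  (forall t, 0 <= f t)%R ->
  Lnorm P p%:E (EFin \o f) = (\int[P]_t (f t `^ p)%:E) `^ p^-1.
Proof.
move=> f0; rewrite unlock; congr (_ `^ _); apply: eq_integral => t _ /=.
by rewrite ger0_norm// poweR_EFin.
Qed.

Lemma Lnorm_law dT dS (T : measurableType dT) (S : measurableType dS)
    (P : {measure set T -> \bar R}) (Q : {measure set S -> \bar R})
    (X : T -> S) (f : S -> R) :
  measurable_fun setT X -> has_law P X Q -> measurable_fun setT f ->
  (forall t, 0 <= f t)%R ->
  Lnorm P p%:E (EFin \o (f \o X)) = Lnorm Q p%:E (EFin \o f).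
Proof.
move=> mX PX mf f0; rewrite !Lnorm_powRE//; last by move=> t /=.
congr (_ `^ _); rewrite (integral_law mX PX)//.
- exact: measurable_powR_EFin.
- by move=> x; rewrite lee_fin powR_ge0.
Qed.

Lemma Lnorm_cst_probability dT (T : measurableType dT) (P : probability T R) (e : R) :
  (0 <= e)%R -> Lnorm P p%:E (EFin \o (fun _ => e)) = e%:E.
Proof.
move=> e0; rewrite Lnorm_powRE// integral_cst//= probability_setT mule1.
by rewrite poweR_EFin -powRrM mulfV ?gt_eqF// powRr1.
Qed.

Lemma le_Lnorm dT (T : measurableType dT) (P : {measure set T -> \bar R}) (f g : T -> R) :
  measurable_fun setT f -> measurable_fun setT g ->
  (forall t, 0 <= f t)%R -> (forall t, 0 <= g t)%R ->
  {ae P, forall t, f t <= g t}%R ->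
  Lnorm P p%:E (EFin \o f) <= Lnorm P p%:E (EFin \o g).
Proof.
move=> mf mg f0 g0 fg; rewrite !Lnorm_powRE//.
apply: gt0_ler_poweR.
- by rewrite invr_ge0 ltW.
- by rewrite in_itv/= leey andbT integral_ge0// => t _; rewrite lee_fin powR_ge0.
- by rewrite in_itv/= leey andbT integral_ge0// => t _; rewrite lee_fin powR_ge0.
apply: ae_ge0_le_integral => //.
- by move=> t _; rewrite lee_fin powR_ge0.
- exact: measurable_powR_EFin.
- by move=> t _; rewrite lee_fin powR_ge0.
- exact: measurable_powR_EFin.
apply: filterS fg => t fgt _; rewrite lee_fin ge0_ler_powR ?nnegrE// ltW//.
Qed.

(** Two couplings, optimal up to e / 3, are glued over cells of diameter e / 3. Almost surely the
    two copies of the middle point share a cell, so Minkowski's inequality bounds the cost by the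
    two given ones plus e / 3 for the jump inside the cell. *)
Lemma wasserstein_triangle mu nu lam :
  (wasserstein mu lam <= wasserstein mu nu + wasserstein nu lam)%R.
Proof.
apply/ler_addgt0Pr => e e0.
have e3 : (0 < e / 3)%R by rewrite divr_gt0.
have [pi1 c1 lt1] : exists2 pi, coupling mu nu pi &
    transport_cost p pi `^ p^-1 < (wasserstein mu nu + e / 3)%:E.
  by apply: wasserstein_lt_coupling => //; rewrite ltrDl.
have [pi2 c2 lt2] : exists2 pi, coupling nu lam pi &
    transport_cost p pi `^ p^-1 < (wasserstein nu lam + e / 3)%:E.
  by apply: wasserstein_lt_coupling => //; rewrite ltrDl.
have [Q [mQ tQ QT dQ]] := @exists_cells R d _ e3.
have [G [G1 G2 G0]] := exists_gluing measurable_snd measurable_fst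
  (coupling_snd c1) (coupling_fst c2) mQ tQ QT.
pose X (w : (Rd R d * Rd R d) * (Rd R d * Rd R d)) := w.1.1.
pose Z (w : (Rd R d * Rd R d) * (Rd R d * Rd R d)) := w.2.2.
have mX : measurable_fun setT X by apply: (measurableT_comp measurable_fst).
have mZ : measurable_fun setT Z by apply: (measurableT_comp measurable_snd).
have := wasserstein_le_rvs p1 mX mZ
  (has_law_comp measurable_fst G1 (coupling_fst c1))
  (has_law_comp measurable_snd G2 (coupling_snd c2)).
rewrite -Lnorm_powRE; last by move=> w; exact: edist_ge0.
pose f1 (z : Rd R d * Rd R d) := edist z.1 z.2.
have f10 z : (0 <= f1 z)%R by exact: edist_ge0.
have mf1 : measurable_fun setT f1 := measurable_edist12.
have mf1f : measurable_fun setT (f1 \o (@fst (Rd R d * Rd R d) (Rd R d * Rd R d))).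
  exact: (measurableT_comp mf1 measurable_fst).
have mf1s : measurable_fun setT (f1 \o (@snd (Rd R d * Rd R d) (Rd R d * Rd R d))).
  exact: (measurableT_comp mf1 measurable_snd).
have ae1 : {ae G, forall w, edist (X w) (Z w) <=
    (f1 \o fst \+ (cst (e / 3)%R \+ f1 \o snd)) w}%R.
  pose A := [set w | (f1 (w.1) + (e / 3) + f1 (w.2) < edist (X w) (Z w))%R].
  have mA : measurable A.
    apply: measurable_set_ltr; last exact: measurable_edist.
    by apply: measurable_funD mf1s; exact: measurable_funD mf1f (measurable_cst _).
  exists A; split => //.
    apply: G0 => // w i /= wi1 wi2; apply/negP; rewrite -leNgt.
    apply: le_trans (edist_triangle w.1.2 _ _) _; rewrite -addrA lerD2l.
    apply: le_trans (edist_triangle w.2.1 _ _) _; rewrite lerD2r.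
    exact: (dQ i).
  by move=> w /= /negP; rewrite -ltNge addrA.
move=> /le_trans/(_ (le_Lnorm _ _ _ _ ae1)) WL.
rewrite -lee_fin; apply: le_trans (WL _ _ _ _) _.
- exact: measurable_edist.
- by apply: measurable_funD => //; apply: measurable_funD.
- by move=> w; exact: edist_ge0.
- by move=> w; rewrite !addr_ge0//= ltW.
apply: le_trans (minkowski_EFin G _ _ (ltW p1)) _ => //.
  exact: measurable_funD.
apply: le_trans (leeD2l _ (minkowski_EFin G _ _ (ltW p1))) _ => //.
rewrite (Lnorm_law measurable_fst G1 mf1 f10) (Lnorm_law measurable_snd G2 mf1 f10).
rewrite (Lnorm_cst_probability _ (ltW e3)) !(Lnorm_powRE _ f10).
have -> : (wasserstein mu nu + wasserstein nu lam + e =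
  (wasserstein mu nu + e / 3) + (e / 3 + (wasserstein nu lam + e / 3)))%R by field.
by rewrite !EFinD; apply: leeD; [exact: ltW|apply: leeD => //; exact: ltW].
Qed.

End wasserstein_triangle.

(** * Coding by real numbers *)

Section digits.
Context {R : realType} (k : nat).
Implicit Types (b : nat -> bool) (c : R).

(* Expansions in base [k + 1] with digits in {0, k}: binary expansions for [k = 1], points of
   the Cantor set for [k = 2]. *)
Definition digit_series b : R^nat :=
  series (fun n => (b n)%:R * (k%:R / k.+1%:R ^+ n.+1)).

Definition digit_value b : R := limn (digit_series b).

Lemma digit_series_bound b n : 0 <= digit_series b n <= 1.
Proof.
(* The right-hand side is the partial sum in which all digits are [k]. *)
have h m : digit_series b m <= 1 - (k.+1%:R ^+ m)^-1.
  elim: m => [|m IH]; first by rewrite /digit_series seriesEnat/= big_geq// expr0 invr1 subrr.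
  rewrite /digit_series seriesSr; apply: (le_trans (lerD IH (lexx _))).
  apply: (@le_trans _ _ (1 - (k.+1%:R ^+ m)^-1 + k%:R / k.+1%:R ^+ m.+1)).
    rewrite lerD2l; apply: ler_piMl; last by case: (b m).
    by rewrite divr_ge0// exprn_ge0.
  apply: eq_ler; rewrite exprS; field.
  by rewrite expf_neq0//= nat1r pnatr_eq0.
apply/andP; split; last by rewrite (le_trans (h n))// gerBl invr_ge0 exprn_ge0.
by rewrite /digit_series seriesEnat/= sumr_ge0.
Qed.

Lemma is_cvg_digit_series b : cvgn (digit_series b).
Proof.
apply: nondecreasing_is_cvgn.
  apply/nondecreasing_seqP => n; rewrite /digit_series seriesSr lerDl.
  by rewrite mulr_ge0// divr_ge0// exprn_ge0.
by exists 1 => _ [n _ <-]; have /andP[] := digit_series_bound b n.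
Qed.

Lemma digit_value_ge0 b : 0 <= digit_value b.
Proof.
apply: limr_ge; first exact: is_cvg_digit_series.
by apply: nearW => n; have /andP[] := digit_series_bound b n.
Qed.

Lemma digit_value_le1 b : digit_value b <= 1.
Proof.
apply: limr_le; first exact: is_cvg_digit_series.
by apply: nearW => n; have /andP[] := digit_series_bound b n.
Qed.

Lemma digit_valueS b :
  digit_value b = ((b 0%N)%:R * k%:R + digit_value (fun n => b n.+1)) / k.+1%:R.
Proof.
apply/cvg_lim => //; rewrite -(cvg_shiftS (digit_series b)).
have -> : [sequence digit_series b n.+1]_n =
   fun n => ((b 0%N)%:R * k%:R + digit_series (fun n => b n.+1) n) / k.+1%:R.
  apply/funext => n /=; rewrite /digit_series !seriesEnat/= big_nat_recl//=.
  rewrite mulrDl expr1 mulrA mulr_suml; congr (_ + _).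
  apply: eq_bigr => i _; rewrite -!mulrA; congr (_ * (_ * _)).
  by rewrite -invfM exprS mulrC.
apply: cvgMr_tmp; apply: cvgD; first exact: cvg_cst.
exact: is_cvg_digit_series.
Qed.

Lemma digit_value_close n b b' : (forall i, (i < n)%N -> b i = b' i) ->
  `|digit_value b - digit_value b'| <= (k.+1%:R ^+ n)^-1.
Proof.
elim: n b b' => [b b' _|n IH b b' bb'].
  rewrite expr0 invr1 ler_norml; apply/andP; split.
    by rewrite lerBrDl (le_trans _ (digit_value_ge0 b))// subr_le0 digit_value_le1.
  by rewrite lerBlDr (le_trans (digit_value_le1 b))// lerDl digit_value_ge0.
rewrite digit_valueS [X in _ - X]digit_valueS bb'// -mulrBl opprD addrACA subrr add0r.
rewrite normrM normfV normr_nat exprSr invfM ler_wpM2r ?invr_ge0//.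
by apply: IH => i ni; apply: bb'.
Qed.

End digits.

Section digit_value_measurable.
Context {R : realType} (k : nat) d (T : measurableType d).

Lemma measurable_digit_value (b : T -> nat -> bool) :
  (forall n, measurable_fun setT (fun t => b t n)) ->
  measurable_fun setT (fun t => digit_value k (b t) : R).
Proof.
move=> mb; apply: (@measurable_fun_cvg _ _ _ _ (fun n t => digit_series k (b t) n)) => //.
  move=> n; rewrite /digit_series; under eq_fun do rewrite seriesEnat/=.
  apply: measurable_sum => i; apply: measurable_funM => //.
  rewrite (_ : (fun t => _) = \1_[set t | b t i]); last first.
    apply/funext => t; rewrite indicE; congr (nat_of_bool _)%:R.
    by apply/idP/idP; rewrite inE.
  apply: measurable_indic; have := mb i measurableT [set true] I.
  by rewrite setTI.
by move=> t _; exact: is_cvg_digit_series.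
Qed.

End digit_value_measurable.

Lemma exprV_small (R : realType) (k : nat) (e : R) : (1 < k)%N -> 0 < e ->
  exists n, (k%:R ^+ n)^-1 < e.
Proof.
move=> k1 e0; exists (Num.trunc e^-1).+1.
rewrite invf_plt ?posrE ?exprn_gt0 ?ltr0n ?(ltn_trans _ k1)//.
apply: lt_trans (truncnS_gt _) _.
by rewrite -natrX ltr_nat ltn_expl.
Qed.

(** * Extraction of binary and ternary digits; the Cantor set *)

Section digit_maps.
Context {R : realType}.
Implicit Types (x y c : R).

Definition upper_half y := 1 / 2 <= y.

(** Removes the leading binary digit of y in [0, 1]: doubling modulo 1, except that 1 stays
    fixed. *)
Definition tent2 y := if upper_half y then 2 * y - 1 else 2 * y.

(** Removes the leading ternary digit, 0 or 2, of a point of the Cantor set. The threshold 1 / 2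
    lies in the removed middle third, so the digit is locally constant there. *)
Definition tent3 c := if upper_half c then 3 * c - 2 else 3 * c.

Definition digit2 y n := upper_half (iter n tent2 y).

Definition digit3 c n := upper_half (iter n tent3 c).

Let tent2_itv y : 0 <= y <= 1 -> 0 <= tent2 y <= 1.
Proof.
by move=> /andP[y0 y1]; rewrite /tent2 /upper_half; case: ifPn => [|/negP/negP]; rewrite -?ltNge => h; lra.
Qed.

Let digit2S y n : digit2 y n.+1 = digit2 (tent2 y) n.
Proof. by rewrite /digit2 iterSr. Qed.

Let digit3S c n : digit3 c n.+1 = digit3 (tent3 c) n.
Proof. by rewrite /digit3 iterSr. Qed.

(** Removing one digit doubles the error, and the error never exceeds 1; after n digits the original
    error is therefore at most 2^-n. *)
Lemma digit_value_digit2 y : 0 <= y <= 1 -> digit_value 1 (digit2 y) = y.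
Proof.
have h n : forall y, 0 <= y <= 1 -> `|digit_value 1 (digit2 y) - y| <= (2 ^+ n)^-1.
  elim: n => [|n IH] z z01.
    rewrite expr0 invr1 ler_norml; move/andP: z01 => [z0 z1].
    have := @digit_value_ge0 R 1 (digit2 z).
    have := @digit_value_le1 R 1 (digit2 z).
    by move=> ? ?; apply/andP; split; lra.
  rewrite digit_valueS//; have := IH _ (tent2_itv z01).
  have -> : (fun n => digit2 z n.+1) = digit2 (tent2 z).
    by apply/funext => i; rewrite digit2S.
  set v := digit_value 1 _; rewrite exprSr invfM.
  have -> : ((digit2 z 0)%:R * 1 + v) / 2 - z = (v - tent2 z) / 2.
    rewrite /tent2 /digit2/=; case: (upper_half z) => /=; lra.
  by rewrite normrM normfV normr_nat => ?; rewrite ler_wpM2r.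
move=> y01; apply/eqP; rewrite -subr_eq0 -normr_le0.
apply/ler_addgt0Pr => e e0; rewrite add0r.
have [n ne] := exprV_small (isT : (1 < 2)%N) e0.
exact: le_trans (h n _ y01) (ltW ne).
Qed.

(** The ternary Cantor set, as the points whose orbit under digit removal stays in the two outer
    thirds; in this form its measurability is immediate. *)
Definition cantor_like : set R :=
  [set c | forall n, let c' := iter n tent3 c in 0 <= c' <= 1 / 3 \/ 2 / 3 <= c' <= 1].

Let cantor_like_tent3 c : cantor_like c -> cantor_like (tent3 c).
Proof. by move=> h n; have := h n.+1; rewrite iterSr. Qed.

(** Two points of the Cantor set closer than 1 / 3 lie in the same outer third, hence share the
    leading digit, and [tent3] then triples their distance. *)
Lemma digit3_close n c c' : cantor_like c -> cantor_like c' ->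
  `|c - c'| < (3 ^+ n)^-1 -> forall i, (i < n)%N -> digit3 c i = digit3 c' i.
Proof.
elim: n c c' => [//|n IH] c c' hc hc' cc'.
have n1 : (3 ^+ n)^-1 <= 1 :> R by rewrite invf_le1 ?exprn_gt0// exprn_ege1// ler1n.
rewrite exprSr invfM in cc'.
have c13 : `|c - c'| < 1 / 3 by apply: (lt_le_trans cc'); lra.
have e0 : upper_half c = upper_half c'.
  have := hc 0%N; have := hc' 0%N; move: c13 => /=; rewrite /upper_half ltr_norml => /andP[? ?].
  by move=> [] /andP[? ?] [] /andP[? ?]; apply/idP/idP => ?; lra.
move=> [_|i]; first by rewrite /digit3/= e0.
rewrite ltnS => ni; rewrite !digit3S.
apply: IH ni; [exact: cantor_like_tent3..|].
have -> : tent3 c - tent3 c' = 3 * (c - c').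
  by rewrite /tent3 e0; case: ifP => _; ring.
by rewrite normrM ger0_norm// mulrC -ltr_pdivlMr.
Qed.

Let digit_value2_itv b :
  let v : R := digit_value 2 b in
  (~~ b 0%N /\ 0 <= v <= 1 / 3) \/ (b 0%N /\ 2 / 3 <= v <= 1).
Proof.
rewrite /= digit_valueS//.
have := @digit_value_ge0 R 2 (fun n => b n.+1).
have := @digit_value_le1 R 2 (fun n => b n.+1).
set v := digit_value 2 _ => ? ?; case: (b 0%N) => /=; [right|left]; split=> //; apply/andP; split; lra.
Qed.

Let tent3_digit_value b : tent3 (digit_value 2 b : R) = digit_value 2 (fun n => b n.+1).
Proof.
have := digit_value2_itv b => /=; rewrite /tent3 /upper_half digit_valueS.
set w := digit_value 2 _.
by move=> [] [+ /andP[]]; case: (b 0%N) => //= _ ? ?; case: ifPn => [|/negP/negP];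
  rewrite -?ltNge => h; lra.
Qed.

Lemma iter_tent3_digit_value b n :
  iter n tent3 (digit_value 2 b : R) = digit_value 2 (fun m => b (m + n)%N).
Proof.
elim: n => [|n IH]; first by congr digit_value; apply/funext => m; rewrite addn0.
rewrite iterS IH tent3_digit_value; congr digit_value.
by apply/funext => m; rewrite addnS addSn.
Qed.

Lemma digit3_digit_value b n : digit3 (digit_value 2 b : R) n = b n.
Proof.
rewrite /digit3 iter_tent3_digit_value /upper_half.
have := digit_value2_itv (fun m => b (m + n)%N) => /=; rewrite add0n.
set v := digit_value _ _.
move=> [] [bn /andP[? ?]]; last by rewrite bn; apply/idP; lra.
by rewrite (negbTE bn); apply/negbTE; rewrite -ltNge; lra.
Qed.

Lemma cantor_like_digit_value b : cantor_like (digit_value 2 b).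
Proof.
move=> n /=; rewrite iter_tent3_digit_value.
by case: (digit_value2_itv (fun m => b (m + n)%N)) => [] [_ ?]; [left|right].
Qed.

Lemma measurable_upper_half : measurable_fun setT upper_half.
Proof. exact: measurable_fun_ler. Qed.

Lemma measurable_tent2 : measurable_fun setT tent2.
Proof.
apply: measurable_fun_ifT => //; first exact: measurable_upper_half.
by apply: measurable_funB => //; exact: measurable_funM.
Qed.

Lemma measurable_tent3 : measurable_fun setT tent3.
Proof.
apply: measurable_fun_ifT => //; first exact: measurable_upper_half.
by apply: measurable_funB => //; exact: measurable_funM.
Qed.

Lemma measurable_iter (f : R -> R) n : measurable_fun setT f ->
  measurable_fun setT (iter n f).
Proof.
move=> mf; elim: n => [|n IH]; first exact: measurable_id.
exact: measurableT_comp mf IH.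
Qed.

Lemma measurable_digit2 n : measurable_fun setT (fun y => digit2 y n).
Proof. exact: measurableT_comp measurable_upper_half (measurable_iter n measurable_tent2). Qed.

Lemma measurable_digit3 n : measurable_fun setT (fun y => digit3 y n).
Proof. exact: measurableT_comp measurable_upper_half (measurable_iter n measurable_tent3). Qed.

Lemma measurable_cantor_like : measurable cantor_like.
Proof.
rewrite (_ : cantor_like = \bigcap_n (iter n tent3 @^-1` (`[0, 1 / 3] `|` `[2 / 3, 1]))).
  apply: bigcapT_measurable => n; rewrite -[X in measurable X]setTI.
  apply: (measurable_iter n measurable_tent3) => //.
  exact: measurableU.
apply/seteqP; split => [c hc n _|c hc n] /=; first by rewrite !in_itv/=; exact: hc.
by have := hc n I; rewrite /= !in_itv/=.
Qed.

Lemma cantor_like_itv c : cantor_like c -> 0 <= c <= 1.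
Proof. by move=> /(_ 0%N) /= [] /andP[? ?]; apply/andP; split; lra. Qed.

End digit_maps.

(** * The Levy-Prokhorov metric *)

Arguments levy_prokhorov : simpl never.
Arguments wasserstein : simpl never.

Section levy_prokhorov.
Context {R : realType} {d : nat}.
Implicit Types (mu nu lam : probability (Rd R d) R) (e f : R).

Definition lp_close mu nu e := 0 < e /\ forall A : set (Rd R d), measurable A ->
  (mu A <= nu (thicken e A) + e%:E)%E /\ (nu A <= mu (thicken e A) + e%:E)%E.

Lemma lp_close_trans mu nu lam e f :
  lp_close mu nu e -> lp_close nu lam f -> lp_close mu lam (e + f).
Proof.
move=> [e0 he] [f0 hf]; split; first exact: addr_gt0.
move=> A mA; split.
- apply: (le_trans (he _ mA).1).
  rewrite [X in (_ <= _ + X%:E)%E]addrC EFinD addeA leeD2r//.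
  apply: (le_trans (hf _ (measurable_thicken _ _)).1).
  rewrite leeD2r// le_measure ?inE//; try exact: measurable_thicken.
  by rewrite addrC; exact: thicken_comp.
- apply: (le_trans (hf _ mA).2).
  rewrite EFinD addeA leeD2r//.
  apply: (le_trans (he _ (measurable_thicken _ _)).2).
  rewrite leeD2r// le_measure ?inE//; try exact: measurable_thicken.
  exact: thicken_comp.
Qed.

Lemma lp_close_sym mu nu e : lp_close mu nu e -> lp_close nu mu e.
Proof. by move=> [e0 h]; split => // A mA; have [] := h A mA. Qed.

Lemma lp_closeW mu nu e f : e <= f -> lp_close mu nu e -> lp_close mu nu f.
Proof.
move=> ef [e0 h]; split; first exact: lt_le_trans ef.
move=> A mA; have [h1 h2] := h A mA; split.
  apply: (le_trans h1); apply: leeD; last by rewrite lee_fin.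
  rewrite le_measure ?inE//; try exact: measurable_thicken.
  exact: thicken_subset.
apply: (le_trans h2); apply: leeD; last by rewrite lee_fin.
rewrite le_measure ?inE//; try exact: measurable_thicken.
exact: thicken_subset.
Qed.

Lemma lp_close1 mu nu : lp_close mu nu 1.
Proof.
split=> // A mA; split; rewrite (le_trans (probability_le1 _ mA))// leeDr//.
Qed.

Let lp_lbound mu nu : lbound [set e | lp_close mu nu e] 0.
Proof. by move=> e [/ltW]. Qed.

Lemma levy_prokhorov_ge0 mu nu : 0 <= levy_prokhorov mu nu.
Proof.
by apply: lb_le_inf; [exists 1; exact: lp_close1|exact: lp_lbound].
Qed.

Lemma dist0_levy_prokhorov mu nu : `|0 - levy_prokhorov mu nu| = levy_prokhorov mu nu.
Proof. by rewrite sub0r normrN ger0_norm// levy_prokhorov_ge0. Qed.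

Lemma levy_prokhorov_le mu nu e : lp_close mu nu e -> levy_prokhorov mu nu <= e.
Proof. by move=> h; apply: ge_inf => //; exists 0; exact: lp_lbound. Qed.

Lemma levy_prokhorov_le1 mu nu : levy_prokhorov mu nu <= 1.
Proof. exact/levy_prokhorov_le/lp_close1. Qed.

Lemma levy_prokhorov_lt mu nu e : levy_prokhorov mu nu < e -> lp_close mu nu e.
Proof.
move=> /inf_lt[]; first by exists 1; exact: lp_close1.
by move=> f hf /ltW fe; exact: lp_closeW hf.
Qed.

Lemma levy_prokhorovC mu nu : levy_prokhorov mu nu = levy_prokhorov nu mu.
Proof.
have h mu' nu' : levy_prokhorov mu' nu' <= levy_prokhorov nu' mu'.
  apply/ler_addgt0Pr => e e0; apply: levy_prokhorov_le; apply: lp_close_sym.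
  by apply: levy_prokhorov_lt; rewrite ltrDl.
by apply/le_anti; rewrite !h.
Qed.

Lemma levy_prokhorov_triangle mu nu lam :
  levy_prokhorov mu lam <= levy_prokhorov mu nu + levy_prokhorov nu lam.
Proof.
apply/ler_addgt0Pr => e e0; have e2 : 0 < e / 2 by rewrite divr_gt0.
have -> : levy_prokhorov mu nu + levy_prokhorov nu lam + e =
  (levy_prokhorov mu nu + e / 2) + (levy_prokhorov nu lam + e / 2) by field.
by apply/levy_prokhorov_le/(@lp_close_trans _ nu); apply: levy_prokhorov_lt;
  rewrite ltrDl.
Qed.

(** For closed F, letting n grow in mu(F) <= nu(F^(1/n)) + 1/n gives mu(F) <= nu(F), as the
    thickenings decrease to F. Closed sets are stable under intersection and generate the Borel
    sets. *)
Lemma levy_prokhorov_eq0 mu nu : levy_prokhorov mu nu = 0 ->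
  forall A, measurable A -> mu A = nu A.
Proof.
have closed_le mu' nu' F : levy_prokhorov mu' nu' = 0 -> closed F -> (mu' F <= nu' F)%E.
  move=> lp0 cF; have hc n : lp_close mu' nu' n.+1%:R^-1.
    by apply: levy_prokhorov_lt; rewrite lp0 invr_gt0.
  have cvg1 : nu' (thicken n.+1%:R^-1 F) @[n --> \oo] -->
      nu' (\bigcap_n (thicken n.+1%:R^-1 F)).
    apply: (nonincreasing_cvg_mu (F := fun n => thicken n.+1%:R^-1 F : set (Rd R d))).
    - by rewrite ltey_eq fin_num_measure//; exact: measurable_thicken.
    - by move=> n; exact: measurable_thicken.
    - by apply: bigcapT_measurable => n; exact: measurable_thicken.
    - move=> m n mn; apply/subsetPset; apply: thicken_subset.
      by rewrite lef_pV2 ?posrE// ler_nat.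
  have cvgF : (nu' (thicken n.+1%:R^-1 F) + n.+1%:R^-1%:E)%E @[n --> \oo] -->
      (nu' F + 0)%E.
    rewrite (closed_thicken cF) in cvg1; apply: cvgeD cvg1 _ => //.
      exact: fin_num_adde_defl.
    by apply/fine_cvgP; split; [exact: nearW|exact: cvg_harmonic].
  rewrite -[leRHS]adde0; apply: cvge_ge cvgF; apply: nearW => n.
  exact: ((hc n).2 F (closed_measurable_Rd cF)).1.
move=> lp0 A mA.
have eqC F : closed F -> mu F = nu F.
  by move=> cF; apply/le_anti; rewrite !closed_le// levy_prokhorovC.
apply: (@measure_unique _ R (Rd R d) (@closed 'rV[R]_d) (fun=> setT)) => //.
- apply/seteqP; split.
    apply: smallest_sub; first exact: smallest_sigma_algebra.
    move=> U oU; rewrite -(setCK U); apply: sigma_algebraC.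
    by apply: sub_sigma_algebra; rewrite closedC.
  apply: smallest_sub; first exact: smallest_sigma_algebra.
  move=> F cF; rewrite -(setCK F); apply: sigma_algebraC.
  by apply: sub_sigma_algebra; rewrite openC.
- exact: closedI.
- by rewrite bigcup_const.
- by move=> n; apply: le_lt_trans (probability_le1 mu measurableT) _; rewrite ltry.
Qed.

(** If X lies in A, then Y lies in the e-thickening of A or the distance of X and Y is at least e;
    the latter event has probability at most e. *)
Lemma levy_prokhorov_le_rvs dT (T : measurableType dT) (P : probability T R)
    (X Y : T -> Rd R d) mu nu e :
  measurable_fun setT X -> measurable_fun setT Y ->
  has_law P X mu -> has_law P Y nu -> 0 < e ->
  (P [set t | e <= edist (X t) (Y t)]%R <= e%:E)%E -> levy_prokhorov mu nu <= e.
Proof.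
have half (X' Y' : T -> Rd R d) mu' nu' : measurable_fun setT X' -> measurable_fun setT Y' ->
  has_law P X' mu' -> has_law P Y' nu' ->
  (P [set t | e <= edist (X' t) (Y' t)]%R <= e%:E)%E ->
  forall A : set (Rd R d), measurable A -> (mu' A <= nu' (thicken e A) + e%:E)%E.
  move=> mX mY lX lY Pe A mA.
  have mT := measurable_thicken e A.
  have m1 : measurable (Y' @^-1` thicken e A).
    by rewrite -[X in measurable X]setTI; exact: mY.
  have m2 : measurable [set t | e <= edist (X' t) (Y' t)].
    by apply: measurable_set_ler => //; exact: measurable_edist.
  rewrite -lX// -lY//; apply: (@le_trans _ _
      (P (Y' @^-1` thicken e A `|` [set t | e <= edist (X' t) (Y' t)]%R)%classic)).
    rewrite le_measure ?inE//; last 2 first.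
    - exact: measurableU.
    - move=> t At; have [h|h] := leP e (edist (X' t) (Y' t)); first by right.
      by left; exists (X' t) => //=; rewrite edistC.
    by rewrite -[X in measurable X]setTI; exact: mX.
  apply: le_trans (measureU2 _ m1 m2) _.
  by rewrite leeD2l.
move=> mX mY lX lY e0 Pe; apply: levy_prokhorov_le; split => // A mA; split.
  exact: half Pe _ mA.
apply: (half Y X) => //.
by under eq_set do rewrite edistC.
Qed.

(** Markov's inequality: under a coupling of cost at most e^(p+1) the event of a displacement of at
    least e has probability at most e. The p-th root of e^(p+1) is [eta]. *)
Lemma levy_prokhorov_wasserstein (p : R) : 1 < p -> forall e, 0 < e ->
  exists2 eta : R, 0 < eta &
    forall mu nu : @Pp R d p, wasserstein mu nu < eta -> levy_prokhorov mu nu <= e.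
Proof.
move=> p1 e e0; have p0 := lt_trans ltr01 p1.
exists ((e * e `^ p) `^ p^-1); first by rewrite powR_gt0// mulr_gt0// powR_gt0.
move=> mu nu /(wasserstein_lt_coupling p1)[pi cpi hpi].
apply: (levy_prokhorov_le_rvs measurable_fst measurable_snd
  (coupling_fst cpi) (coupling_snd cpi)) => //.
have costf := transport_cost_fin p1 cpi.
have costlt : (transport_cost p pi <= (e * e `^ p)%:E)%E.
  move: hpi; rewrite -(fineK costf) poweR_EFin lte_fin lee_fin => hpi.
  have := @ge0_ler_powR R p (ltW p0) _ _ _ _ (ltW hpi).
  have c0 : 0 <= e * e `^ p by rewrite mulr_ge0 ?powR_ge0// ltW.
  have f0 : 0 <= fine (transport_cost p pi) by rewrite fine_ge0// transport_cost_ge0.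
  by rewrite !nnegrE !powR_ge0 -!powRrM mulVf ?gt_eqF// !powRr1//; exact.
have ep0 : 0 < e `^ p by rewrite powR_gt0.
rewrite -(@lee_pmul2l _ (e `^ p)%:E)// ?lte_fin// -EFinM (mulrC _ e).
apply: le_trans costlt.
have mS : measurable [set t : Rd R d * Rd R d | e <= edist t.1 t.2].
  by apply: measurable_set_ler => //; exact: measurable_edist12.
have -> : ((e `^ p)%:E * pi [set t | e <= edist t.1 t.2]%R =
   \int[pi]_(x in [set t | e <= edist t.1 t.2]%R) (e `^ p)%:E)%E.
  by rewrite integral_cst.
have mc := measurable_powR_EFin (p := p) (@measurable_edist12 R d).
apply: (@le_trans _ _ (\int[pi]_(x in [set t | (e <= edist t.1 t.2)%R])
    (edist x.1 x.2 `^ p)%:E)%E); last first.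
  apply: ge0_subset_integral => //.
  by move=> x _; rewrite lee_fin powR_ge0.
apply: ge0_le_integral => //.
- by move=> x _; rewrite lee_fin powR_ge0.
- exact: measurable_funS mc.
- move=> x /= ex; rewrite lee_fin ge0_ler_powR ?nnegrE ?edist_ge0 ?(ltW p0)//.
  exact: ltW.
Qed.

End levy_prokhorov.

Lemma cvgn_cauchy (R : realType) (u : R^nat) : cvgn u <->
  forall e, 0 < e -> exists K, forall k l, (K <= k)%N -> (K <= l)%N -> `|u k - u l| < e.
Proof.
split=> [/cvgrPdist_lt uc e e0|h].
  have /uc[K _ hK] : 0 < e / 2 by rewrite divr_gt0.
  exists K => k l Kk Kl; rewrite -(subrKA (limn u)) (splitr e).
  apply: le_lt_trans (ler_normD _ _) _.
  by apply: ltrD; [rewrite distrC|]; exact: hK.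
apply: R_complete; apply: cauchy_exP => e e0; have [K hK] := h _ e0.
by exists (u K), K => // k /= Kk; exact: hK.
Qed.

(** * Compressing the real line into ]0, 1[ *)

Section squash.
Context {R : realType}.
Implicit Types x y : R.

(* [powR _ (-1)] is the inverse on the nonnegative reals, and is known to be measurable. *)
Definition squash x := (1 + x * (1 + `|x|) `^ (-1)) / 2.

Definition unsquash y := let s := 2 * y - 1 in s * (1 - `|s|) `^ (-1).

Lemma squashE x : 2 * squash x - 1 = x / (1 + `|x|).
Proof. by rewrite /squash powR_inv1 ?addr_ge0//; lra. Qed.

Lemma squash_norm_lt1 x : `|x / (1 + `|x|)| < 1.
Proof.
have h : 0 < 1 + `|x| by rewrite ltr_pwDl.
by rewrite normrM normfV (gtr0_norm h) ltr_pdivrMr// mul1r ltrDr.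
Qed.

Lemma squash_itv x : 0 < squash x < 1.
Proof.
have := squash_norm_lt1 x; rewrite -squashE ltr_norml => /andP[? ?].
by apply/andP; split; lra.
Qed.

Lemma squashK x : unsquash (squash x) = x.
Proof.
have h : 0 < 1 + `|x| by rewrite ltr_pwDl.
rewrite /unsquash squashE powR_inv1 ?subr_ge0; last exact/ltW/squash_norm_lt1.
rewrite normrM normfV (gtr0_norm h).
have -> : 1 - `|x| / (1 + `|x|) = (1 + `|x|)^-1 by field; rewrite gt_eqF.
by rewrite invrK divfK// gt_eqF.
Qed.

Lemma measurable_squash : measurable_fun setT squash.
Proof.
apply: measurable_funM => //; apply: measurable_funD => //.
apply: measurable_funM => //; apply: (measurableT_comp (measurable_powR (-1))).
exact: measurable_funD.
Qed.

Lemma measurable_unsquash : measurable_fun setT unsquash.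
Proof.
have m : measurable_fun setT (fun y : R => 2 * y - 1).
  by apply: measurable_funB => //; exact: measurable_funM.
apply: measurable_funM => //; apply: (measurableT_comp (measurable_powR (-1))).
by apply: measurable_funB => //; exact: measurableT_comp.
Qed.

(** A bound on the decoded value keeps |2 y - 1| at most M / (1 + M). This form passes to limits and
    keeps them away from the ends 0 and 1, where [unsquash] fails to be continuous. *)
Lemma unsquash_bound y M : 0 <= M -> 0 < y < 1 -> `|unsquash y| <= M ->
  `|2 * y - 1| * (1 + M) <= M.
Proof.
move=> M0 /andP[y0 y1]; rewrite /unsquash/=; set s := 2 * y - 1.
have s1 : 0 < 1 - `|s|.
  by rewrite subr_gt0 ltr_norml; apply/andP; split; rewrite /s; lra.
rewrite powR_inv1; last exact: ltW.
rewrite normrM normfV (gtr0_norm s1) ler_pdivrMr// => h; lra.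
Qed.

Lemma cvg_unsquash (u : R^nat) y : `|2 * y - 1| < 1 -> u @ \oo --> y ->
  (forall k, 0 <= u k <= 1) -> unsquash (u k) @[k --> \oo] --> unsquash y.
Proof.
move=> y1 uy u01.
have sE z : 0 <= 1 - `|2 * z - 1| -> unsquash z = (2 * z - 1) / (1 - `|2 * z - 1|).
  by move=> h; rewrite /unsquash/= powR_inv1.
rewrite sE ?subr_ge0 1?(ltW y1)//.
have -> : (fun k => unsquash (u k)) = fun k => (2 * u k - 1) / (1 - `|2 * u k - 1|).
  apply/funext => k; apply: sE; rewrite subr_ge0 ler_norml.
  by have /andP[? ?] := u01 k; apply/andP; split; lra.
have c1 : (2 * u k - 1) @[k --> \oo] --> 2 * y - 1.
  by apply: cvgB; [apply: cvgMl_tmp|exact: cvg_cst].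
apply: cvgM => //; apply: cvgV; first by rewrite subr_eq0 gt_eqF.
apply: cvgB; first exact: cvg_cst.
exact: cvg_norm.
Qed.

End squash.

(** * Coding vectors by points of the Cantor set *)

Section coding.
Context {R : realType} {N : nat}.
Implicit Types x : 'rV[R]_N.

(** [unpickle] splits a position into the index of a binary digit and that of a coordinate;
    positions encoding no such pair hold the digit 0. *)
Definition code_digits x (n : nat) : bool :=
  if @unpickle (nat * 'I_N)%type n is Some z then digit2 (squash (x ord0 z.2)) z.1
  else false.

(* The binary digits of the squashed coordinates are interleaved and read in base 3, where the
   value determines the digits continuously. *)
Definition code (x : Rd R N) : R := digit_value 2 (code_digits x).

Definition decode_coord (c : R) (i : 'I_N) : R :=
  digit_value 1 (fun j => digit3 c (@pickle (nat * 'I_N)%type (j, i))).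

Definition decode (c : R) : Rd R N := \row_i unsquash (decode_coord c i).

(** A set containing all codes, in place of the exact range of [code]: it is measurable, and its
    conditions are those needed for the convergence of decoded values. *)
Definition codeset : set R :=
  cantor_like `&` [set c | forall i, 0 < decode_coord c i < 1].

Lemma decode_coord_code x i : decode_coord (code x) i = squash (x ord0 i).
Proof.
rewrite /decode_coord -[RHS]digit_value_digit2; last first.
  by have /andP[/ltW-> /ltW->] := squash_itv (x ord0 i).
congr digit_value; apply/funext => j.
by rewrite /code digit3_digit_value /code_digits pickleK.
Qed.

Lemma codeK x : decode (code x) = x.
Proof. by apply/rowP => i; rewrite mxE decode_coord_code squashK. Qed.

Lemma codeset_code x : codeset (code x).
Proof.
split; first exact: cantor_like_digit_value.
by move=> i; rewrite decode_coord_code squash_itv.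
Qed.

Lemma measurable_code : measurable_fun setT code.
Proof.
apply: measurable_digit_value => n; rewrite /code_digits.
case: unpickle => [z|]; last exact: measurable_cst.
apply: (measurableT_comp (measurable_digit2 z.1)).
apply: (measurableT_comp measurable_squash); exact: measurable_coord.
Qed.

Lemma measurable_decode_coord i : measurable_fun setT (fun c => decode_coord c i).
Proof. by apply: measurable_digit_value => n; exact: measurable_digit3. Qed.

Lemma measurable_decode : measurable_fun setT decode.
Proof.
apply: measurable_to_Rd => // i.
under eq_fun do rewrite /decode mxE.
by apply: (measurableT_comp measurable_unsquash); exact: measurable_decode_coord.
Qed.

Lemma measurable_codeset : measurable codeset.
Proof.
apply: measurableI; first exact: measurable_cantor_like.
rewrite (_ : [set c | _] = \bigcap_(i in [set: 'I_N]) ((decode_coord ^~ i) @^-1` `]0, 1[)).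
  apply: fin_bigcap_measurable; first exact: finite_finset.
  move=> i _; rewrite -[X in measurable X]setTI.
  exact: measurable_decode_coord.
apply/seteqP; split => [c h i _|c h i] /=; first by rewrite in_itv/= h.
by have := h i I; rewrite /= in_itv.
Qed.

Lemma codeset_itv c : codeset c -> 0 <= c <= 1.
Proof. by move=> [/cantor_like_itv]. Qed.

(** Converging codes in the Cantor set eventually agree on any given number of digits, so the
    compressed coordinates converge. Their limit could be 0 or 1, that is, infinity; boundedness of
    the decoded vectors along infinitely many k excludes this. *)
Lemma cvg_decode (c : R^nat) (M : R) : (forall k, codeset (c k)) -> cvgn c ->
  (forall K, exists2 k, (K <= k)%N & enorm (decode (c k)) <= M) ->
  exists x : Rd R N, forall i : 'I_N,
    (decode (c k) : 'rV[R]_N) ord0 i @[k --> \oo] --> (x : 'rV[R]_N) ord0 i.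
Proof.
move=> cC cc cM.
have M0 : 0 <= M by have [k _] := cM 0%N; exact/le_trans/enorm_ge0.
have cv i : cvgn (fun k => decode_coord (c k) i).
  apply/cvgn_cauchy => e e0.
  have [J Je] := @exprV_small R 2 e isT e0.
  (* All ternary positions that store the first [J] binary digits of coordinate [i] lie below
     [n]. *)
  pose n := (\max_(j < J) @pickle (nat * 'I_N)%type (nat_of_ord j, i)).+1.
  have /cvgn_cauchy/(_ (3 ^+ n)^-1) := cc.
  rewrite invr_gt0 exprn_gt0// => /(_ isT)[K hK]; exists K => k l Kk Kl.
  apply: le_lt_trans Je.
  apply: digit_value_close => j jJ.
  apply: (digit3_close (n := n)) => //; [exact: (cC k).1|exact: (cC l).1|exact: hK|].
  rewrite /n ltnS; exact: (leq_bigmax (Ordinal jJ)).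
have v01 k i : 0 <= decode_coord (c k) i <= 1.
  by have /andP[/ltW-> /ltW->] := (cC k).2 i.
exists (\row_i unsquash (limn (fun k => decode_coord (c k) i))) => i.
rewrite mxE; under eq_fun do rewrite mxE.
apply: cvg_unsquash; [|exact: cv|by move=> k; exact: v01].
set w := limn _.
suff : `|2 * w - 1| * (1 + M) <= M by move=> h; nra.
rewrite leNgt; apply/negP => h.
have : `|2 * decode_coord (c k) i - 1| * (1 + M) @[k --> \oo] --> `|2 * w - 1| * (1 + M).
  apply: cvgMr_tmp; apply: cvg_norm; apply: cvgB; last exact: cvg_cst.
  by apply: cvgMl_tmp; exact: cv.
move=> /(cvgr_gt _)/(_ _ h)[K _ hK].
have [k Kk ck] := cM K; have := hK k Kk => /=; apply/negP; rewrite -leNgt.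
apply: unsquash_bound => //; first exact: (cC k).2.
by apply: le_trans ck; have := coord_le_enorm (decode (c k)) i; rewrite mxE.
Qed.

End coding.

(** * Quantile functions and the Skorokhod representation *)

Section diagonal.
Context {R : realType}.

(** By Tychonoff's theorem the sequence has a cluster point [g] in the cube [0, 1]^nat; the n-th
    selected index makes the first n coordinates 1 / (n + 1)-close to [g]. *)
Lemma diagonal_subsequence (a : nat -> nat -> R) :
  (forall k n, 0 <= a k n <= 1) ->
  exists2 f : nat -> nat, {homo f : m n / (m < n)%N} &
    forall n, cvgn (fun k => a (f k) n).
Proof.
move=> a01; pose pT := prod_topology (fun _ : nat => R).
pose K := [set g : pT | forall n, `[0, 1]%classic (g n)].
have cK : compact K.
  by apply: (@tychonoff nat (fun=> R) (fun=> `[0, 1]%classic)) => n; exact: segment_compact.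
pose a' : nat -> pT := a.
have FK : (a' @ \oo) K by exists 0%N => // k _ n; rewrite /= in_itv/=.
have [g [_ gcl]] := cK _ _ FK.
have sel (z : nat * nat) : exists k,
    (z.1 <= k)%N /\ forall n, (n < z.2)%N -> `|a k n - g n| < z.2.+1%:R^-1.
  have e0 : 0 < z.2.+1%:R^-1 :> R by rewrite invr_gt0.
  have nB m : nbhs g [set h : pT | forall n, (n < m)%N -> `|h n - g n| < z.2.+1%:R^-1].
    elim: m => [|m IH]; first exact: filterS filterT.
    have hm0 : nbhs g (@proj nat (fun=> R) m @^-1` ball (g m) z.2.+1%:R^-1).
      by apply: proj_continuous; exact: nbhsx_ballx.
    apply: filterS2 IH hm0 => h hm h' n; rewrite ltnS leq_eqVlt => /orP[/eqP->|]; last exact: hm.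
    by rewrite distrC.
  have nA : (a' @ \oo) [set a' k | k in [set k | (z.1 <= k)%N]].
    by exists z.1 => // k zk /=; exists k.
  have [_ [[k zk <-] kB]] := gcl _ _ nA (nB z.2).
  by exists k; split => // n nz; exact: kB.
have [s sP] := choice sel.
(* Each selection starts beyond the preceding index, which makes [f] strictly increasing. *)
pose f := fix f n := if n is m.+1 then s ((f m).+1, n) else s (0%N, 0%N).
have fS n : (f n < f n.+1)%N by have [] := sP ((f n).+1, n.+1).
exists f; first exact: homo_ltn ltn_trans fS.
move=> n; apply/cvg_ex; exists (g n); apply/cvgrPdist_lt => e e0.
have [M hM] : exists M, forall m, (M <= m)%N -> m.+1%:R^-1 < e.
  exists (Num.trunc e^-1) => m nm; rewrite invf_plt ?posrE//.
  by apply: lt_le_trans (truncnS_gt _) _; rewrite ler_nat ltnS.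
exists (maxn M n).+1 => // k /=; rewrite gtn_max => /andP[Mk nk].
rewrite distrC; case: k Mk nk => // k Mk nk.
by apply: lt_trans (hM k.+1 (ltnW Mk)); apply: (sP ((f k).+1, k.+1)).2.
Qed.

End diagonal.

Section quantile.
Context {R : realType}.
Implicit Types w x y : R.

Definition quantile (nu : set R -> \bar R) (w : R) : R :=
  inf [set x | (w%:E <= nu `]-oo, x]%classic)%E].

Variable nu : probability R R.
Hypothesis nu01 : nu `[0, 1]%classic = 1%E.

Let F x : R := fine (nu `]-oo, x]%classic).

Let FE x : nu `]-oo, x]%classic = (F x)%:E.
Proof. by rewrite fineK// fin_num_measure. Qed.

Let F_ge0 x : 0 <= F x. Proof. by rewrite fine_ge0. Qed.

Let F_le1 x : F x <= 1.
Proof. by rewrite -lee_fin -FE probability_le1. Qed.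

Let F_nd x y : x <= y -> F x <= F y.
Proof.
move=> xy; rewrite -lee_fin -!FE le_measure ?inE//.
by apply: subset_itvl; rewrite bnd_simp.
Qed.

Let F_lt0 x : x < 0 -> F x = 0.
Proof.
move=> x0; apply/le_anti; rewrite F_ge0 andbT.
have dis : `]-oo, x]%classic `&` `[0, 1]%classic = set0.
  apply/seteqP; split => // y []; rewrite /= !in_itv/= => yx /andP[y0 _].
  by move: (le_lt_trans yx x0); rewrite ltNge y0.
have nuU : nu (`]-oo, x] `|` `[0, 1])%classic = (F x + 1)%:E.
  by rewrite EFinD -FE -nu01; apply: measureU.
have : (nu (`]-oo, x] `|` `[0%R, 1%R])%classic <= 1)%E.
  by apply: probability_le1; exact: measurableU.
by rewrite nuU lee_fin; lra.
Qed.

Let F1 x : 1 <= x -> F x = 1.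
Proof.
move=> x1; apply/le_anti; rewrite F_le1/= -lee_fin -FE -nu01 le_measure ?inE//.
by move=> y; rewrite /= !in_itv/= => /andP[_ y1]; exact: le_trans x1.
Qed.

Let F_rc w x : (forall e, 0 < e -> w <= F (x + e)) -> w <= F x.
Proof.
move=> h; have cvgF : nu `]-oo, x + n.+1%:R^-1]%classic @[n --> \oo] --> nu (\bigcap_n `]-oo, x + n.+1%:R^-1]%classic).
  apply: (nonincreasing_cvg_mu (F := fun n => `]-oo, x + n.+1%:R^-1]%classic)) => //.
  - by rewrite ltey_eq fin_num_measure.
  - exact: bigcapT_measurable.
  - move=> m n mn; apply/subsetPset; apply: subset_itvl; rewrite bnd_simp lerD2l.
    by rewrite lef_pV2 ?posrE// ler_nat.
have capE : \bigcap_n `]-oo, x + n.+1%:R^-1]%classic = `]-oo, x]%classic.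
  apply/seteqP; split => [y xy|y yx n _]; rewrite /= in_itv/=; last first.
    by rewrite /= in_itv/= in yx; apply: le_trans yx _; rewrite lerDl.
  apply/ler_addgt0Pr => e e0.
  have [n ne] : exists n, n.+1%:R^-1 < e.
    exists (Num.trunc e^-1); rewrite invf_plt ?posrE//; exact: truncnS_gt.
  have := xy n I; rewrite /= in_itv/= => /le_trans; apply.
  by rewrite lerD2l; exact: ltW.
rewrite capE in cvgF; rewrite -lee_fin -FE; apply: cvge_ge cvgF.
by apply: nearW => n; rewrite FE lee_fin; apply: h.
Qed.

Let setE w : [set x | (w%:E <= nu `]-oo, x]%classic)%E] = [set x | w <= F x].
Proof. by apply/seteqP; split => x /=; rewrite FE lee_fin. Qed.

(** For w <= 0 the set is the whole line, for w > 1 it is empty; in both cases [inf] takes its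
    default value 0. *)
Let quantile_out w : ~ 0 < w <= 1 -> quantile nu w = 0.
Proof.
move=> w01; rewrite /quantile setE; have [w0|w0] := leP w 0.
  apply: inf_out => -[_ [z /(_ (z - 1))]] /=.
  by move=> /(_ (le_trans w0 (F_ge0 _))); rewrite lerBrDl gerDr ler10.
have [w1|w1] := leP w 1; first by exfalso; apply: w01; rewrite w0 w1.
rewrite (_ : [set x | _] = set0) ?inf0//; apply/seteqP; split => // x /=.
by move=> /le_trans/(_ (F_le1 _)); rewrite leNgt w1.
Qed.

(** The Galois connection between quantile and distribution function; right continuity of [F] makes
    the infimum attained. *)
Lemma quantile_leE w x : 0 < w <= 1 ->
  (quantile nu w <= x) = (w%:E <= nu `]-oo, x]%classic)%E.
Proof.
move=> /andP[w0 w1]; rewrite FE lee_fin /quantile setE; apply/idP/idP => h.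
  apply: F_rc => e e0; have : inf [set x | w <= F x] < x + e.
    by apply: le_lt_trans h _; rewrite ltrDl.
  move=> /inf_lt[|y /= wy yx]; first by exists 1; rewrite /= F1.
  exact: le_trans wy (F_nd (ltW yx)).
apply: ge_inf => //; exists 0 => y /= wy; rewrite leNgt; apply/negP => y0.
by move: wy; rewrite F_lt0// leNgt w0.
Qed.

Lemma quantile_ge0 w : 0 <= quantile nu w.
Proof.
have [w01|w01] := pselect (0 < w <= 1); last by rewrite quantile_out.
rewrite leNgt; apply/negP => q0.
have := lexx (quantile nu w); rewrite {1}quantile_leE// FE lee_fin F_lt0// leNgt.
by case/andP: w01 => ->.
Qed.

Lemma quantile_le1 w : quantile nu w <= 1.
Proof.
have [w01|w01] := pselect (0 < w <= 1); last by rewrite quantile_out.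
by rewrite quantile_leE// FE lee_fin F1//; case/andP: w01.
Qed.

Lemma quantile_nd w x : 0 < w -> w <= x -> x <= 1 -> quantile nu w <= quantile nu x.
Proof.
move=> w0 wx x1; rewrite quantile_leE ?w0 ?(le_trans wx)//.
have : quantile nu x <= quantile nu x by [].
rewrite quantile_leE ?x1 ?(lt_le_trans w0)//; apply: le_trans.
by rewrite lee_fin.
Qed.

Lemma measurable_quantile : measurable_fun setT (quantile nu).
Proof.
apply: (measurability _ (RGenOInfty.measurableE R)) => _ [_ [x ->] <-].
rewrite setTI; have [x0|x0] := ltP x 0.
  rewrite (_ : _ @^-1` _ = setT)//; apply/seteqP; split => // w _ /=.
  by rewrite in_itv/= andbT (lt_le_trans x0)// quantile_ge0.
(* Beyond 1 the quantile has its default value 0, which does not exceed x; hence the right end 1. *)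
rewrite (_ : _ @^-1` _ = `]F x, 1]%classic)//.
apply/seteqP; split => w /=; rewrite !in_itv/= andbT.
  have [/[dup] w01 /andP[w0 ->]|w01] := pselect (0 < w <= 1).
    by rewrite ltNge quantile_leE// FE lee_fin -ltNge => ->.
  by rewrite quantile_out// ltNge x0.
move=> /andP[Fw w1]; rewrite ltNge quantile_leE ?FE ?lee_fin -?ltNge//.
by rewrite (le_lt_trans (F_ge0 x)).
Qed.

Lemma measurable_quantileU :
  measurable_fun [set: measurableTypeR R] (quantile nu : measurableTypeR R -> R).
Proof. exact: measurable_quantile. Qed.

Let U := uniform_prob (@ltr01 R).

Lemma uniform_prob01E (A : set R) : measurable A ->
  U A = lebesgue_measure (A `&` `[0, 1])%classic.
Proof.
move=> mA; rewrite /U /uniform_prob integral_uniform_pdf.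
rewrite (eq_integral (cst 1%E)).
  by rewrite integral_cst ?mul1e//; exact: measurableI.
move=> x; rewrite inE => -[_]; rewrite /= in_itv/= => x01.
by rewrite /uniform_pdf x01 subr0 invr1.
Qed.

(** Inside [0, 1] and up to the single point 0, the preimage of ]a, b] is ]F a, F b]; such intervals
    determine a measure. *)
Lemma quantile_law : has_law U (quantile nu : measurableTypeR R -> R) nu.
Proof.
move=> A mA.
pose mF := isMeasurableFun.Build _ _ _ _ _ measurable_quantileU.
pose q : {mfun measurableTypeR R >-> R} := HB.pack (quantile nu : measurableTypeR R -> R) mF.
rewrite -[LHS]/(distribution U q A).
apply: (@measure_unique _ R R (@ocitv R) (fun n => `](- n%:R), n%:R]%classic)) => //.
- exact: ocitvI.
- by move=> i; exact: is_ocitv.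
- apply/seteqP; split => // x _; exists (Num.trunc `|x|).+1 => //=.
  have := truncnS_gt `|x|; rewrite in_itv/= ltr_norml => /andP[-> /ltW ->//].
- move=> _ [[a b] _ <-] /=.
  have [ba|ab] := leP b a; first by rewrite set_itv_ge ?measure0 ?bnd_simp -?leNgt.
  have nuE : nu `]a, b]%classic = (F b - F a)%:E.
    have dis : `]-oo, a]%classic `&` `]a, b]%classic = set0.
      apply/seteqP; split => // y []; rewrite /= !in_itv/=.
      by move=> ya /andP[+ _]; rewrite ltNge ya.
    have : nu (`]-oo, a] `|` `]a, b])%classic =
        (nu `]-oo, a]%classic + nu `]a, b]%classic)%E by apply: measureU.
    rewrite -itv_bndbnd_setU ?bnd_simp ?(ltW ab)// !FE.
    have fab : nu `]a, b]%classic \is a fin_num by rewrite fin_num_measure.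
    by rewrite -(fineK fab) -EFinD => -[->]; rewrite addrC addKr.
  have mq : measurable (quantile nu @^-1` `]a, b]%classic : set (measurableTypeR R)).
    by rewrite -[X in measurable X]setTI; apply: measurable_quantileU.
  have sub1 : `]F a, F b]%classic `<=` quantile nu @^-1` `]a, b]%classic `&` `[0, 1]%classic.
    move=> w /=; rewrite !in_itv/= => /andP[aw wb].
    have w0 : 0 < w by exact: le_lt_trans aw.
    have w1 : w <= 1 by exact: le_trans (F_le1 b).
    by rewrite ltNge !quantile_leE ?w0// !FE !lee_fin -ltNge aw wb (ltW w0) w1.
  have sub2 : quantile nu @^-1` `]a, b]%classic `&` `[0, 1]%classic `<=`
      `]F a, F b]%classic `|` [set 0].
    move=> w [] /=; rewrite !in_itv/= => + /andP[w0 w1].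
    have [->|wn0] := eqVneq w 0; first by move=> _; right.
    have {}w0 : 0 < w by rewrite lt_def wn0.
    by rewrite ltNge !quantile_leE ?w0// !FE !lee_fin -ltNge; left.
  have mI : measurable (quantile nu @^-1` `]a, b]%classic `&` `[0, 1]%classic).
    exact: measurableI.
  have UE : distribution U q `]a, b]%classic = lebesgue_measure `]F a, F b]%classic.
    rewrite [LHS](uniform_prob01E mq); apply/le_anti/andP; split.
      apply: le_trans (le_measure lebesgue_measure _ _ sub2) _; rewrite ?inE//.
        exact: measurableU.
      apply: le_trans (measureU2 lebesgue_measure _ _) _ => //.
      by rewrite [X in (_ + X)%E]lebesgue_measure_set1 adde0.
    by apply: le_measure => //; rewrite ?inE.
  rewrite nuE [LHS]UE lebesgue_measure_itv/= lte_fin.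
  by have := F_nd (ltW ab); rewrite le_eqVlt => /orP[/eqP->|->];
    rewrite ?ltxx ?subrr// EFinB.
- by move=> n; rewrite ltey_eq fin_num_measure.
Qed.

End quantile.

Section liminf.
Local Open Scope ereal_scope.
Context {R : realType} d (T : measurableType d).

Lemma measurable_fun_limn_einf (f : (T -> \bar R)^nat) :
  (forall n, measurable_fun setT (f n)) ->
  measurable_fun setT (fun x => limn_einf (f ^~ x)).
Proof.
move=> mf; rewrite /limn_einf; apply: measurableT_comp => //.
by apply: measurable_fun_limn_esup => n; exact: measurableT_comp.
Qed.

Lemma limn_einf_ge0 (u : (\bar R)^nat) : (forall n, 0 <= u n) -> 0 <= limn_einf u.
Proof.
move=> u0; rewrite limn_einf_lim; apply: lime_ge; first exact: is_cvg_einfs.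
by apply: nearW => n; apply: le_ereal_inf_tmp => _ [k _ <-].
Qed.

Lemma limn_einf_le (u : (\bar R)^nat) (C : \bar R) :
  (forall K, exists2 k, (K <= k)%N & u k <= C) -> limn_einf u <= C.
Proof.
move=> uC; rewrite limn_einf_lim; apply: lime_le; first exact: is_cvg_einfs.
apply: nearW => n; have [k nk uk] := uC n.
by apply: le_trans uk; apply: ereal_inf_lbound; exists k.
Qed.

Lemma lt_limn_einf (u : (\bar R)^nat) (C : \bar R) : limn_einf u < C ->
  forall K, exists2 k, (K <= k)%N & u k < C.
Proof.
move=> uC K; have : einfs u K < C.
  apply: le_lt_trans uC; rewrite limn_einf_lim.
  rewrite (cvg_lim _ (ereal_nondecreasing_cvgn (@nondecreasing_einfs _ u)))//.
  by apply: ereal_sup_ubound; exists K.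
by move=> /ereal_inf_lt[_ [k Kk <-] uk]; exists k.
Qed.

End liminf.

(** Helly's argument. Where [q] does not converge, the limits at rationals to the left and to the
    right of w leave a gap. By monotonicity the gaps of distinct points are disjoint, and each
    contains a rational, which injects the exceptional set into the rationals. *)
Lemma monotone_cvg_countable {R : realType} (q : nat -> R -> R) :
  (forall k w x, 0 < w -> w <= x -> x <= 1 -> q k w <= q k x) ->
  (forall k w, 0 <= q k w <= 1) ->
  (forall r : rat, 0 < (ratr r : R) < 1 -> cvgn (q ^~ (ratr r))) ->
  countable [set w | 0 < w < 1 /\ ~ cvgn (q ^~ w)].
Proof.
move=> qnd q01 qc; pose L (r : rat) := limn (q ^~ (ratr r : R)).
pose lo w := [set L r | r in [set r : rat | 0 < (ratr r : R) < w]].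
pose hi w := [set L r | r in [set r : rat | w < (ratr r : R) < 1]].
have L01 r : 0 < (ratr r : R) < 1 -> 0 <= L r <= 1.
  move=> r01; apply/andP; split.
    by apply: limr_ge; [exact: qc|apply: nearW => k; case/andP: (q01 k (ratr r))].
  by apply: limr_le; [exact: qc|apply: nearW => k; case/andP: (q01 k (ratr r))].
have lo_sup w : 0 < w < 1 -> has_sup (lo w).
  move=> /andP[w0 w1]; split.
    have /rat_in_itvoo[r] := w0; rewrite in_itv/= => r0w.
    by exists (L r), r.
  exists 1 => _ [r /= /andP[r0 rw] <-].
  by have /andP[] := L01 r (introT andP (conj r0 (lt_trans rw w1))).
have hi_inf w : 0 < w < 1 -> has_inf (hi w).
  move=> /andP[w0 w1]; split.
    have /rat_in_itvoo[r] := w1; rewrite in_itv/= => r0w.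
    by exists (L r), r.
  exists 0 => _ [r /= /andP[r0 rw] <-].
  by have /andP[] := L01 r (introT andP (conj (lt_trans w0 r0) rw)).
have gap w : 0 < w < 1 -> ~ cvgn (q ^~ w) -> sup (lo w) < inf (hi w).
  move=> w01 nc; rewrite ltNge; apply/negP => hl; apply: nc.
  apply/cvg_ex; exists (sup (lo w)); apply/cvgrPdist_lt => e e0.
  have e2 : 0 < e / 2 by rewrite divr_gt0.
  have [_ [r /= /andP[r0 rw] <-] hr] := sup_adherent e2 (lo_sup _ w01).
  have [_ [s /= /andP[ws s1] <-] hs] := inf_adherent e2 (hi_inf _ w01).
  have /andP[w0 w1] := w01.
  have rc : q k (ratr r) @[k --> \oo] --> L r by apply: qc; rewrite r0 (lt_trans rw).
  have sc : q k (ratr s) @[k --> \oo] --> L s by apply: qc; rewrite (lt_trans w0).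
  move/cvgrPdist_lt : rc => /(_ _ e2) [K1 _ hK1].
  move/cvgrPdist_lt : sc => /(_ _ e2) [K2 _ hK2].
  exists (maxn K1 K2) => // k /=; rewrite geq_max => /andP[Kk1 Kk2].
  have := hK1 k Kk1 => /=; have := hK2 k Kk2 => /=; rewrite !ltr_norml => /andP[? ?] /andP[? ?].
  have qrw : q k (ratr r) <= q k w by apply: qnd => //; exact: ltW.
  have qws : q k w <= q k (ratr s) by apply: qnd => //; exact: ltW.
  by apply/andP; split; lra.
have hg w : exists r : rat, 0 < w < 1 -> ~ cvgn (q ^~ w) ->
    sup (lo w) < ratr r < inf (hi w).
  have [w01|] := pselect (0 < w < 1); last by exists 0.
  have [nc|] := pselect (~ cvgn (q ^~ w)); last by exists 0.
  by have /rat_in_itvoo[r] := gap _ w01 nc; rewrite in_itv/= => ?; exists r.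
have [g gP] := choice hg.
apply/countable_injP; exists (fun w => pickle (g w)) => w w' /set_mem[w01 nw] /set_mem[w'01 nw'].
have h x y : 0 < x < 1 -> ~ cvgn (q ^~ x) -> 0 < y < 1 -> ~ cvgn (q ^~ y) ->
    x < y -> g x <> g y.
  move=> x01 nx y01 ny xy gxy; have /andP[_ h1] := gP _ x01 nx; have /andP[h2 _] := gP _ y01 ny.
  have /rat_in_itvoo[r] := xy; rewrite in_itv/= => /andP[xr ry].
  have h3 : inf (hi x) <= L r.
    apply: ge_inf; first exact: (hi_inf _ x01).2.
    by exists r => //=; rewrite xr (lt_trans ry)//; case/andP: y01.
  have h4 : L r <= sup (lo y).
    apply: ub_le_sup; first exact: (lo_sup _ y01).2.
    by exists r => //=; rewrite ry andbT (lt_trans _ xr)//; case/andP: x01.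
  by move: h1 h2; rewrite gxy; lra.
move=> /(pcan_inj pickleK) gw; apply/eqP; rewrite eq_le !leNgt.
by apply/andP; split; apply/negP => ww; [apply: (h w' w)|apply: (h w w')].
Qed.

(** * Almost surely converging random variables with given laws *)

Section skorokhod.
Context {R : realType} {N : nat}.
Local Notation U := (uniform_prob (@ltr01 R)).

Definition code_quantile (P : set (Rd R N) -> \bar R) : R -> R :=
  quantile (fun A => P (code @^-1` A)).

Lemma code_law (P : probability (Rd R N) R) : exists Q : probability R R,
  [/\ has_law P code Q, Q `[0, 1]%classic = 1%E, Q (@codeset R N) = 1%E &
   code_quantile P = quantile Q].
Proof.
have [Q PQ] := exists_law P (@measurable_code R N).
have Qc : Q (@codeset R N) = 1%E.
  rewrite -PQ; last exact: measurable_codeset.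
  rewrite (_ : _ @^-1` _ = setT) ?probability_setT//.
  by apply/seteqP; split => // x _; exact: codeset_code.
exists Q; split => //.
- apply/le_anti; rewrite probability_le1//= -Qc le_measure ?inE//.
    exact: measurable_codeset.
  by move=> c cc; rewrite /= in_itv/= (codeset_itv cc).
- apply/funext => w; congr inf; apply/seteqP; split => x /=; rewrite PQ//.
Qed.

Lemma code_quantile_itv (P : probability (Rd R N) R) w : 0 <= code_quantile P w <= 1.
Proof.
have [Q [_ Q01 _ ->]] := code_law P.
by rewrite quantile_ge0// quantile_le1.
Qed.

Lemma ae_uniform_itvoo : {ae U, forall w : measurableTypeR R, 0 < (w : R) < 1}.
Proof.
exists (~` `]0, 1[%classic); split.
- exact: measurableC.
- rewrite uniform_prob01E; last exact: measurableC.
  rewrite (_ : _ `&` _ = [set 0; 1]).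
    by apply: countable_lebesgue_measure0; exact: finite_set_countable.
  apply/seteqP; split => [x []|x /=]; rewrite /= !in_itv/=.
    move=> /negP; rewrite negb_and -!leNgt.
    by move=> /orP[h|h] /andP[? ?]; [left|right]; apply/le_anti/andP.
  by move=> [] ->; rewrite ?ltxx ?lexx ?ler01 ?andbF.
- by move=> w /=; rewrite in_itv/=.
Qed.

(** [X k] decodes the quantile function of the codes of [P k], on the unit interval with uniform
    law. The quantiles converge off a countable set, and decoding preserves this wherever the
    vectors stay bounded along infinitely many k. *)
Theorem skorokhod_representation (P : nat -> probability (Rd R N) R) (p C : R) :
  0 < p ->
  (forall k, (\int[P k]_x (enorm x `^ p)%:E <= C%:E)%E) ->
  (forall r : rat, 0 < (ratr r : R) < 1 ->
     cvgn (fun k => code_quantile (P k) (ratr r))) ->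
  exists X : nat -> measurableTypeR R -> Rd R N, exists Y : measurableTypeR R -> Rd R N,
    [/\ forall k, measurable_fun setT (X k), measurable_fun setT Y,
        forall k, has_law U (X k) (P k) &
        {ae U, forall w, edist (X k w) (Y w) @[k --> \oo] --> 0}].
Proof.
move=> p0 PC Pc.
have FU : Filter (nbhs (almost_everywhere U)) := ae_filter_ringOfSetsType U.
have [Q QP] := choice (fun k => code_law (P k)).
pose q k := quantile (Q k); pose X k (w : measurableTypeR R) := @decode R N (q k w).
have mX k : measurable_fun setT (X k).
  apply: (measurableT_comp measurable_decode).
  by have [_ ? _ _] := QP k; exact: measurable_quantileU.
have lX k : has_law U (X k) (P k).
  have [h1 h2 _ _] := QP k.
  have hq := quantile_law h2.
  move=> A mA; rewrite -[LHS]/(U (q k @^-1` (decode @^-1` A))).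
  have mdA : measurable (decode @^-1` A).
    by rewrite -[X in measurable X]setTI; exact: measurable_decode.
  rewrite hq// -h1//; congr (P k _).
  by apply/seteqP; split => x /=; rewrite codeK.
have ae1 : {ae U, forall w, 0 < (w : R) < 1 -> cvgn (q ^~ w)}.
  have cZ : countable [set w | 0 < w < 1 /\ ~ cvgn (q ^~ w)].
    apply: monotone_cvg_countable => [k w x|k w|r r01].
    - by have [_ h2 _ _] := QP k; exact: quantile_nd.
    - by have [_ h2 _ _] := QP k; rewrite quantile_ge0// quantile_le1.
    - rewrite (_ : q ^~ (ratr r) = fun k => code_quantile (P k) (ratr r)); first exact: Pc.
      by apply/funext => k; have [_ _ _ ->] := QP k.
  pose Z : set (measurableTypeR R) := [set w : R | 0 < w < 1 /\ ~ cvgn (q ^~ w)].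
  have nZ : U.-negligible Z.
    have mZ : measurable Z.
      by apply: countable_measurable cZ => t; exact: measurable_set1.
    exists Z; split => //; rewrite uniform_prob01E//.
    apply: countable_lebesgue_measure0; apply: sub_countable cZ.
    by apply: subset_card_le => w [].
  by apply: negligibleS nZ => w /= /not_implyP.
have ae2 : {ae U, forall w, forall k, (@codeset R N) (q k w)}.
  apply/ae_foralln => k; have [_ h2 h3 _] := QP k.
  exists (~` (q k @^-1` (@codeset R N))); split => //.
  - apply: measurableC; rewrite -[X in measurable X]setTI.
    by apply: measurable_quantileU => //; exact: measurable_codeset.
  - have mC := measurableC (@measurable_codeset R N).
    apply: etrans (quantile_law h2 mC) _.
    by rewrite probability_setC ?h3 ?subee//; exact: measurable_codeset.
have mn k : measurable_fun setT (fun w => (enorm (X k w) `^ p)%:E).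
  apply/measurable_EFinP; apply: (measurableT_comp (measurable_powR p)).
  exact: (measurableT_comp measurable_enorm).
(* Fatou's lemma: the lower limit of the p-th powers of the norms has finite integral, hence is
   finite almost everywhere. This replaces tightness. *)
have ae3 : {ae U, forall w, exists M, forall K, exists2 k, (K <= k)%N & enorm (X k w) <= M}.
  have int : U.-integrable setT (fun w => limn_einf (fun k => (enorm (X k w) `^ p)%:E)).
    have mL := measurable_fun_limn_einf mn.
    apply/integrableP; split => //.
    have L0 w : (0 <= limn_einf (fun k => (enorm (X k w) `^ p)%:E))%E.
      by apply: limn_einf_ge0 => k; rewrite lee_fin powR_ge0.
    under eq_integral do rewrite gee0_abs//.
    apply: le_lt_trans (fatou U measurableT mn _) _.
      by move=> k w _; rewrite lee_fin powR_ge0.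
    apply: (@le_lt_trans _ _ C%:E); last by rewrite ltry.
    apply: limn_einf_le => K; exists K => //.
    rewrite -(integral_law (mX K) (lX K) (g := fun x : Rd R N => (enorm x `^ p)%:E))//.
    - exact: PC.
    - by apply: measurable_powR_EFin; exact: measurable_enorm.
    - by move=> x; rewrite lee_fin powR_ge0.
  have := integrable_ae measurableT int; apply: filterS => w /(_ I).
  set L := limn_einf _ => Lfin.
  have LC : (L < (fine L + 1)%:E)%E by rewrite -[X in (X < _)%E](fineK Lfin) lte_fin ltrDl.
  exists ((fine L + 1) `^ p^-1) => K; have [k Kk] := lt_limn_einf LC K.
  rewrite lte_fin => /ltW hk; exists k => //.
  have L1 : 0 <= fine L + 1 by exact: le_trans (powR_ge0 _ _) hk.
  have := @ge0_ler_powR R p^-1 _ _ _ _ _ hk.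
  rewrite invr_ge0 (ltW p0) !nnegrE powR_ge0 L1 -powRrM mulfV ?gt_eqF// powRr1 ?enorm_ge0//.
  exact.
have : {ae U, forall w, forall i : 'I_N, cvgn (fun k => (X k w : 'rV[R]_N) ord0 i)}.
  have ae1' : {ae U, forall w, cvgn (q ^~ (w : R))}.
    by apply: filterS2 ae_uniform_itvoo ae1 => w w01; exact.
  apply: filterS3 ae1' ae2 ae3 => w cw Cw [M hM] i.
  have [x hx] := cvg_decode Cw cw hM.
  by apply/cvg_ex; exists ((x : 'rV[R]_N) ord0 i); exact: hx.
move=> [B [mB B0 hB]].
have mD : measurable (~` B) by exact: measurableC.
have cD w : (~` B) w -> forall i : 'I_N, cvgn (fun k => (X k w : 'rV[R]_N) ord0 i).
  by move=> Bw; apply: contrapT => nc; apply: Bw; exact: hB.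
pose l (i : 'I_N) (w : measurableTypeR R) := limn (fun k => (X k w : 'rV[R]_N) ord0 i).
(* The coordinatewise limit, set to 0 on the measurable null set [B] to remain measurable. *)
pose Y (w : measurableTypeR R) : Rd R N := \row_i ((l i \_ (~` B)) w).
exists X, Y; split => //.
- apply: measurable_to_Rd => // i; under eq_fun do rewrite /Y mxE.
  apply/(measurable_restrictT _ mD).
  apply: (@measurable_fun_cvg _ _ _ _ (fun k w => (X k w : 'rV[R]_N) ord0 i)) => //.
    by move=> k; apply: measurable_funTS; exact: measurable_to_Rd_comp.
  by move=> w /cD/(_ i).
- exists B; split => // w nc; apply: contrapT => Bw; apply: nc => /=.
  have coordc i : `|(X k w : 'rV[R]_N) ord0 i - (Y w : 'rV[R]_N) ord0 i| @[k --> \oo] --> (0 : R).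
    rewrite mxE patchE mem_set//.
    rewrite -(normr0 R) -(subrr (l i w)); apply: cvg_norm; apply: cvgB; last exact: cvg_cst.
    exact: cD.
  have sumc : (\sum_(i < N) `|(X k w : 'rV[R]_N) ord0 i - (Y w : 'rV[R]_N) ord0 i|) @[k --> \oo] --> (0 : R).
    elim: (index_enum _) => [|i s IH].
      by under eq_fun do rewrite big_nil; exact: cvg_cst.
    by under eq_fun do rewrite big_cons; have h := cvgD (coordc i) IH;
      rewrite addr0 in h; exact: h.
  apply: (squeeze_cvgr _ (cvg_cst 0) sumc).
  by apply: nearW => k; rewrite edist_ge0 edist_le_sum.
Qed.

End skorokhod.

(** * Weak compactness and lower semicontinuity *)

Lemma edist_dist_le {R : realType} {d : nat} (x y x' y' : 'rV[R]_d) :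
  `|edist x y - edist x' y'| <= edist x x' + edist y y'.
Proof.
have h1 := edist_triangle x' x y; have h2 := edist_triangle y' x' y.
have h3 := edist_triangle x x' y'; have h4 := edist_triangle y x y'.
rewrite (edistC y' y) in h2; rewrite (edistC x' x) in h3.
by rewrite ler_norml; apply/andP; split; lra.
Qed.

Lemma cvg_powR {R : realType} (p : R) (u : R^nat) (x : R) : 0 < p ->
  (forall k, 0 <= u k) -> 0 <= x -> u @ \oo --> x -> u k `^ p @[k --> \oo] --> x `^ p.
Proof.
move=> p0 u0; rewrite le_eqVlt => /orP[/eqP<-|x0] ux.
  rewrite powR0 ?gt_eqF//; apply/cvgrPdist_lt => e e0.
  have e1 : 0 < e `^ p^-1 by rewrite powR_gt0.
  move/cvgrPdist_lt : ux => /(_ _ e1)[K _ hK]; exists K => // k /hK /=.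
  rewrite !sub0r 2!normrN !ger0_norm ?powR_ge0// => uke.
  have := @gt0_ltr_powR R p p0 _ _ _ _ uke.
  rewrite !nnegrE u0 powR_ge0 -powRrM mulVf ?gt_eqF// powRr1 ?(ltW e0)//; exact.
have cx : {for x, continuous (fun y => y `^ p)}.
  apply/differentiable_continuous/derivable1_diffP.
  by apply: derivable_powR; rewrite in_itv/= x0.
exact: cvg_comp ux cx.
Qed.

Lemma fatou_bound {R : realType} dT (T : measurableType dT)
    (mu : {measure set T -> \bar R}) (D : set T) (f : nat -> T -> \bar R)
    (g : T -> \bar R) (C : \bar R) :
  measurable D ->
  (forall k, measurable_fun D (f k)) -> measurable_fun D g ->
  (forall k t, D t -> (0 <= f k t)%E) -> (forall t, D t -> (0 <= g t)%E) ->
  {ae mu, forall t, D t -> f k t @[k --> \oo] --> g t} ->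
  (forall K, exists2 k, (K <= k)%N & (\int[mu]_(t in D) f k t <= C)%E) ->
  (\int[mu]_(t in D) g t <= C)%E.
Proof.
move=> mD mf mg f0 g0 fg fC.
apply: (@le_trans _ _ (\int[mu]_(t in D) limn_einf (f ^~ t))%E); last first.
  apply: le_trans (fatou mu mD mf f0) _; exact: limn_einf_le.
have mL : measurable_fun D (fun t => limn_einf (f ^~ t)).
  rewrite /limn_einf; apply: measurableT_comp => //.
  by apply: measurable_fun_limn_esup => n; exact: measurableT_comp.
apply: ae_ge0_le_integral => //.
- by move=> t Dt; apply: limn_einf_ge0 => k; exact: f0.
- have FM : Filter (nbhs (almost_everywhere mu)) := ae_filter_ringOfSetsType mu.
  apply: filterS fg => t fgt Dt.
  by rewrite (cvg_limn_einf_sup (fgt Dt)).1.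
Qed.

Section weak_limits.
Context {R : realType} {d : nat} {p : R}.
Hypothesis p1 : 1 < p.
Local Notation U := (uniform_prob (@ltr01 R)).

Let p0 : 0 < p. Proof. exact: lt_trans p1. Qed.

Let FU : Filter (nbhs (almost_everywhere U)) := ae_filter_ringOfSetsType U.

(** Almost sure convergence implies convergence in probability, by dominated convergence for the
    indicators of the events of a distance at least e. *)
Lemma ae_cvg_levy_prokhorov (X : nat -> measurableTypeR R -> Rd R d)
    (Y : measurableTypeR R -> Rd R d) (mu : nat -> probability (Rd R d) R)
    (nu : probability (Rd R d) R) :
  (forall k, measurable_fun setT (X k)) -> measurable_fun setT Y ->
  (forall k, has_law U (X k) (mu k)) -> has_law U Y nu ->
  {ae U, forall w, edist (X k w) (Y w) @[k --> \oo] --> 0} ->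
  levy_prokhorov (mu k) nu @[k --> \oo] --> 0.
Proof.
move=> mX mY lX lY XY; apply/cvgrPdist_le => e e0.
pose A k : set (measurableTypeR R) := [set w | e <= edist (X k w) (Y w)].
have mA k : measurable (A k).
  by apply: measurable_set_ler => //; exact: measurable_edist.
have mI k : measurable_fun setT (fun w => (\1_(A k) w)%:E : \bar R).
  by apply/measurable_EFinP; exact: measurable_indic.
have : (\int[U]_w (\1_(A k) w)%:E)%E @[k --> \oo] --> (\int[U]_w (cst 0%E w : \bar R))%E.
  have dom : {ae U, forall w k, setT w -> (`|(\1_(A k) w)%:E : \bar R| <= cst 1%E w)%E}.
    apply: aeW => w k _; rewrite lee_fin indicE ger0_norm//.
    by case: (w \in A k).
  have c0 : {ae U, forall w, setT w -> (\1_(A k) w)%:E @[k --> \oo] --> cst (0%E : \bar R) w}.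
    apply: filterS XY => w /cvgrPdist_lt/(_ _ e0)[K _ hK] _.
    apply: cvg_near_cst; exists K => // k /hK /=.
    rewrite sub0r normrN ger0_norm ?edist_ge0// => he.
    by rewrite indicE memNset// /A/= leNgt he.
  have i1 : U.-integrable setT (cst (1%E : \bar R)).
    exact: finite_measure_integrable_cst.
  by have [_ _] := dominated_convergence measurableT mI (measurable_cst _) c0 i1 dom.
rewrite integral0 => /fine_cvgP[_ /cvgrPdist_le/(_ _ e0)[K _ hK]].
exists K => // k /hK /=; rewrite dist0_levy_prokhorov sub0r normrN integral_indic// setIT.
rewrite ger0_norm ?fine_ge0// => Ue.
apply: (levy_prokhorov_le_rvs (mX k) mY (lX k) lY e0).
rewrite -lee_fin fineK in Ue; first exact: Ue.
by rewrite fin_num_measure.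
Qed.

Lemma moment_limit (X : nat -> measurableTypeR R -> Rd R d)
    (Y : measurableTypeR R -> Rd R d) (mu : nat -> probability (Rd R d) R) (C : R) :
  (forall k, measurable_fun setT (X k)) -> measurable_fun setT Y ->
  (forall k, has_law U (X k) (mu k)) ->
  (forall k, (\int[mu k]_x (enorm x `^ p)%:E <= C%:E)%E) ->
  {ae U, forall w, edist (X k w) (Y w) @[k --> \oo] --> 0} ->
  (\int[U]_w (enorm (Y w) `^ p)%:E <= C%:E)%E.
Proof.
move=> mX mY lX XC XY.
apply: (fatou_bound (f := fun k w => (enorm (X k w) `^ p)%:E)) => //.
- by move=> k; apply: measurable_powR_EFin; exact: measurableT_comp measurable_enorm (mX k).
- by apply: measurable_powR_EFin; exact: measurableT_comp measurable_enorm mY.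
- by move=> k w _; rewrite lee_fin powR_ge0.
- by move=> w _; rewrite lee_fin powR_ge0.
- apply: filterS XY => w hw _; apply/fine_cvgP; split; first exact: nearW.
  apply: cvg_powR => //; [by move=> k; exact: enorm_ge0|exact: enorm_ge0|].
  apply/cvgrPdist_le => e e0; move/cvgrPdist_le : hw => /(_ _ e0); apply: filterS => k.
  rewrite sub0r normrN ger0_norm ?edist_ge0//; apply: le_trans.
  rewrite ler_distlC lerBlDr edistC enorm_le_edist/= edistC; exact: enorm_le_edist.
- by move=> K; exists K => //; rewrite -(moment_law (mX K) (lX K)); exact: XC.
Qed.

Lemma code_quantile_compactness (sigma : nat -> @Pp R d p) (C : R) :
  (forall k, (\int[sigma k]_x (enorm x `^ p)%:E <= C%:E)%E) ->
  (forall r : rat, 0 < (ratr r : R) < 1 ->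
     cvgn (fun k => code_quantile (sigma k) (ratr r))) ->
  exists nu : @Pp R d p, levy_prokhorov (sigma k) nu @[k --> \oo] --> 0.
Proof.
move=> sC sc.
have [X [Y [mX mY lX XY]]] := skorokhod_representation p0 sC sc.
have [nu lY] := exists_law U mY.
have mnu : (\int[nu]_x (enorm x `^ p)%:E < +oo)%E.
  rewrite (moment_law mY lY); apply: le_lt_trans (moment_limit mX mY lX sC XY) _.
  by rewrite ltry.
exists (MkPp mnu); exact: (ae_cvg_levy_prokhorov mX mY lX lY XY).
Qed.

Lemma subseq_ge (f : nat -> nat) : {homo f : m n / (m < n)%N} -> forall n, (n <= f n)%N.
Proof. by move=> hf; elim=> // n IH; apply: leq_ltn_trans IH (hf _ _ _). Qed.

Lemma cvg_subseq (T : topologicalType) (u : nat -> T) (l : T) (f : nat -> nat) :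
  {homo f : m n / (m < n)%N} -> u @ \oo --> l -> (u \o f) @ \oo --> l.
Proof.
move=> hf ul A /ul [K _ hK]; exists K => // k /= Kk.
by apply: hK; exact: leq_trans Kk (subseq_ge hf k).
Qed.

Lemma code_quantile_subsequence {N : nat} (I : countType) (P : nat -> I -> probability (Rd R N) R) :
  exists2 f : nat -> nat, {homo f : m n / (m < n)%N} &
    forall i r, cvgn (fun k => code_quantile (P (f k) i) (ratr r)).
Proof.
pose a k n := if @unpickle (I * rat)%type n is Some z
  then code_quantile (P k z.1) (ratr z.2) else 0.
have [|f hf fc] := @diagonal_subsequence R a.
  by move=> k n; rewrite /a; case: unpickle => [z|]; [exact: code_quantile_itv|rewrite lexx ler01].
exists f => // i r; have := fc (pickle (i, r)).
rewrite (_ : (fun k => a (f k) _) = fun k => code_quantile (P (f k) i) (ratr r))//.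
by apply/funext => k; rewrite /a pickleK.
Qed.

Lemma levy_prokhorov_lim_unique (mu : nat -> probability (Rd R d) R)
    (nu nu' : probability (Rd R d) R) :
  levy_prokhorov (mu k) nu @[k --> \oo] --> 0 ->
  levy_prokhorov (mu k) nu' @[k --> \oo] --> 0 ->
  forall A, measurable A -> nu A = nu' A.
Proof.
move=> /cvgrPdist_lt h /cvgrPdist_lt h'; apply: levy_prokhorov_eq0; apply/le_anti.
rewrite levy_prokhorov_ge0 andbT; apply/ler_addgt0Pr => e e0; rewrite add0r.
have e2 : 0 < e / 2 by rewrite divr_gt0.
have [[K _ hK] [K' _ hK']] := (h _ e2, h' _ e2).
have := hK _ (leq_maxl K K'); have := hK' _ (leq_maxr K K') => /=.
rewrite !dist0_levy_prokhorov => b b'.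
apply: le_trans (levy_prokhorov_triangle _ (mu (maxn K K')) _) _.
by rewrite (splitr e) levy_prokhorovC lerD// ltW.
Qed.

(** Almost optimal couplings, viewed as laws on R^(d + d), have bounded moments; along a subsequence
    they are represented by almost surely converging pairs. The limit pair has the right marginals,
    and Fatou's lemma bounds its cost. *)
Lemma wasserstein_lsc (mu nu : nat -> @Pp R d p) (mu0 nu0 : @Pp R d p)
    (w : R^nat) (w0 C : R) :
  (forall k, (\int[mu k]_x (enorm x `^ p)%:E <= C%:E)%E) ->
  (forall k, (\int[nu k]_x (enorm x `^ p)%:E <= C%:E)%E) ->
  levy_prokhorov (mu k) mu0 @[k --> \oo] --> 0 ->
  levy_prokhorov (nu k) nu0 @[k --> \oo] --> 0 ->
  (forall k, wasserstein (mu k) (nu k) <= w k) -> w @ \oo --> w0 ->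
  wasserstein mu0 nu0 <= w0.
Proof.
move=> muC nuC muc nuc Ww wc.
have cpl k : exists pi, coupling (mu k) (nu k) pi /\
    (transport_cost p pi `^ p^-1 < (w k + k.+1%:R^-1)%:E)%E.
  have [|pi cpi lpi] := @wasserstein_lt_coupling R d p p1 (mu k) (nu k) (w k + k.+1%:R^-1).
    by apply: le_lt_trans (Ww k) _; rewrite ltrDl.
  by exists pi.
have [pi piP] := choice cpl.
pose j (z : Rd R d * Rd R d) : Rd R (d + d) := row_mx z.1 z.2.
have mj : measurable_fun setT j := measurable_row_mx.
have [P PP] := choice (fun k => exists_law (pi k) mj).
have PC k : (\int[P k]_x (enorm x `^ p)%:E <= (2 `^ p * (C + C))%:E)%E.
  rewrite (moment_law mj (PP k)).
  have m1 : measurable_fun setT (fun z : Rd R d * Rd R d => enorm z.1).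
    exact: (measurableT_comp measurable_enorm).
  have m2 : measurable_fun setT (fun z : Rd R d * Rd R d => enorm z.2).
    exact: (measurableT_comp measurable_enorm).
  have mj' : measurable_fun setT (fun z : Rd R d * Rd R d => enorm (j z)).
    exact: (measurableT_comp measurable_enorm mj).
  apply: le_trans (integral_powR_le p1 _ mj' m1 m2 _ _ _ _) _.
  - by move=> z; exact: enorm_ge0.
  - by move=> z; exact: enorm_ge0.
  - by move=> z; exact: enorm_ge0.
  - by move=> z; exact: enorm_row_mx_le.
  rewrite -(moment_law measurable_fst (coupling_fst (piP k).1)).
  rewrite -(moment_law measurable_snd (coupling_snd (piP k).1)).
  rewrite EFinM EFinD; apply: lee_wpmul2l; first by rewrite lee_fin powR_ge0.
  by apply: leeD; [exact: muC|exact: nuC].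
have [f hf fc] := @code_quantile_subsequence (d + d) unit (fun k _ => P k).
have [Z [Z0 [mZ mZ0 lZ ZZ0]]] := skorokhod_representation p0 (fun k => PC (f k))
  (fun r _ => fc tt r).
pose X k w := lsubmx (Z k w : 'rV[R]_(d + d)) : Rd R d.
pose Y k w := rsubmx (Z k w : 'rV[R]_(d + d)) : Rd R d.
pose X0 w := lsubmx (Z0 w : 'rV[R]_(d + d)) : Rd R d.
pose Y0 w := rsubmx (Z0 w : 'rV[R]_(d + d)) : Rd R d.
have mX k : measurable_fun setT (X k) := measurableT_comp measurable_lsubmx (mZ k).
have mY k : measurable_fun setT (Y k) := measurableT_comp measurable_rsubmx (mZ k).
have mX0 : measurable_fun setT X0 := measurableT_comp measurable_lsubmx mZ0.
have mY0 : measurable_fun setT Y0 := measurableT_comp measurable_rsubmx mZ0.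
have lX k : has_law U (X k) (mu (f k)).
  apply: (has_law_comp measurable_lsubmx (lZ k)) => A mA.
  rewrite -PP; last by rewrite -[X in measurable X]setTI; exact: measurable_lsubmx.
  rewrite -(coupling_fst (piP (f k)).1)//; congr (pi (f k) _).
  by apply/seteqP; split => z /=; rewrite row_mxKl.
have lY k : has_law U (Y k) (nu (f k)).
  apply: (has_law_comp measurable_rsubmx (lZ k)) => A mA.
  rewrite -PP; last by rewrite -[X in measurable X]setTI; exact: measurable_rsubmx.
  rewrite -(coupling_snd (piP (f k)).1)//; congr (pi (f k) _).
  by apply/seteqP; split => z /=; rewrite row_mxKr.
have XX0 : {ae U, forall t, edist (X k t) (X0 t) @[k --> \oo] --> 0}.
  apply: filterS ZZ0 => t; apply: squeeze_cvgr (cvg_cst 0); apply: nearW => k.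
  by rewrite edist_ge0 edist_lsubmx.
have YY0 : {ae U, forall t, edist (Y k t) (Y0 t) @[k --> \oo] --> 0}.
  apply: filterS ZZ0 => t; apply: squeeze_cvgr (cvg_cst 0); apply: nearW => k.
  by rewrite edist_ge0 edist_rsubmx.
(* The law of the limit is a Lévy-Prokhorov limit of the same subsequence as [mu0], and such limits
   are unique. *)
have lX0 : has_law U X0 mu0.
  have [Q lQ] := exists_law U mX0; move=> A mA; rewrite lQ//.
  apply: (levy_prokhorov_lim_unique (ae_cvg_levy_prokhorov mX mX0 lX lQ XX0)) => //.
  exact: (cvg_subseq hf muc).
have lY0 : has_law U Y0 nu0.
  have [Q lQ] := exists_law U mY0; move=> A mA; rewrite lQ//.
  apply: (levy_prokhorov_lim_unique (ae_cvg_levy_prokhorov mY mY0 lY lQ YY0)) => //.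
  exact: (cvg_subseq hf nuc).
have w00 : 0 <= w0.
  apply: (cvgr_to_ge wc); apply: nearW => k.
  exact: le_trans (wasserstein_ge0 p1 _ _) (Ww k).
apply/ler_addgt0Pr => e e0.
have we0 : 0 <= w0 + e by rewrite addr_ge0// ltW.
rewrite -lee_fin; apply: le_trans (wasserstein_le_rvs p1 mX0 mY0 lX0 lY0) _.
have -> : (w0 + e)%:E = (((w0 + e) `^ p)%:E `^ p^-1)%E.
  by rewrite poweR_EFin -powRrM mulfV ?gt_eqF// powRr1.
apply: gt0_ler_poweR.
- by rewrite invr_ge0 ltW.
- by rewrite in_itv/= leey andbT integral_ge0// => t _; rewrite lee_fin powR_ge0.
- by rewrite in_itv/= leey andbT lee_fin powR_ge0.
apply: (fatou_bound (f := fun k t => (edist (X k t) (Y k t) `^ p)%:E)) => //.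
- by move=> k; apply: measurable_powR_EFin; exact: measurable_edist.
- by apply: measurable_powR_EFin; exact: measurable_edist.
- by move=> k t _; rewrite lee_fin powR_ge0.
- by move=> t _; rewrite lee_fin powR_ge0.
- apply: filterS2 XX0 YY0 => t hX hY _; apply/fine_cvgP; split; first exact: nearW.
  apply: cvg_powR => //; [by move=> k; exact: edist_ge0|exact: edist_ge0|].
  have hXY : edist (X k t) (X0 t) + edist (Y k t) (Y0 t) @[k --> \oo] --> (0 + 0 : R).
    exact: cvgD.
  rewrite addr0 in hXY.
  apply/cvgrPdist_le => c c0; move/cvgrPdist_le : hXY => /(_ _ c0); apply: filterS => k.
  rewrite sub0r normrN ger0_norm ?addr_ge0 ?edist_ge0// distrC; apply: le_trans.
  exact: edist_dist_le.
- move=> K; have wh : w k + k.+1%:R^-1 @[k --> \oo] --> w0 + 0.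
    by apply: cvgD; [exact: wc|exact: cvg_harmonic].
  rewrite addr0 in wh.
  move/cvgrPdist_le : wh => /(_ _ e0)[K' _ hK'].
  exists (maxn K K'); first exact: leq_maxl.
  set k := maxn K K'; have := hK' (f k) (leq_trans (leq_maxr K K') (subseq_ge hf k)).
  rewrite /= ler_distlC => /andP[_ wke].
  have mlr : measurable_fun setT (fun x : Rd R (d + d) =>
     (edist (lsubmx (x : 'rV[R]_(d + d))) (rsubmx (x : 'rV[R]_(d + d))) `^ p)%:E).
    apply: measurable_powR_EFin; apply: measurable_edist.
      exact: measurable_lsubmx.
    exact: measurable_rsubmx.
  have lr0 (x : Rd R (d + d)) :
      (0 <= (edist (lsubmx (x : 'rV[R]_(d + d))) (rsubmx (x : 'rV[R]_(d + d))) `^ p)%:E)%E.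
    by rewrite lee_fin powR_ge0.
  have := integral_law (mZ k) (lZ k) mlr lr0; rewrite (integral_law mj (PP (f k)) mlr lr0).
  move=> <-.
  under eq_integral do rewrite /j row_mxKl row_mxKr.
  rewrite -/(transport_cost p (pi (f k))).
  have cf := transport_cost_fin p1 (piP (f k)).1.
  have := (piP (f k)).2; rewrite -(fineK cf) poweR_EFin lte_fin lee_fin => lt1.
  have le1 : fine (transport_cost p (pi (f k))) `^ p^-1 <= w0 + e.
    exact: le_trans (ltW lt1) wke.
  have := @ge0_ler_powR R p (ltW p0) _ _ _ _ le1.
  have c0 : 0 <= fine (transport_cost p (pi (f k))) by rewrite fine_ge0// transport_cost_ge0.
  by rewrite !nnegrE powR_ge0 we0 -!powRrM mulVf ?gt_eqF// powRr1//; exact.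
Qed.
End weak_limits.

(** * Absolute continuity and metric derivatives *)

Definition integral_measure {R : realType} d (T : measurableType d)
    (mu : {measure set T -> \bar R}) (f : T -> R)
    (mf : measurable_fun setT f) (f0 : forall t, 0 <= f t) : set T -> \bar R :=
  fun A => (\int[mu]_(t in A) (f t)%:E)%E.

Section integral_measure.
Context {R : realType} d (T : measurableType d) (mu : {measure set T -> \bar R}).
Variables (f : T -> R) (mf : measurable_fun setT f) (f0 : forall t, 0 <= f t).

Let im0 : integral_measure mu mf f0 set0 = 0%E.
Proof. by rewrite /integral_measure integral_set0. Qed.

Let im_ge0 A : (0 <= integral_measure mu mf f0 A)%E.
Proof. by apply: integral_ge0 => t _; rewrite lee_fin. Qed.

Let im_semi_sigma_additive : semi_sigma_additive (integral_measure mu mf f0).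
Proof.
move=> F mF tF mUF; rewrite /integral_measure; apply: cvg_toP.
  apply: ereal_nondecreasing_is_cvgn => m n mn.
  apply: lee_sum_nneg_natr => // k _ _.
  by apply: integral_ge0 => t _; rewrite lee_fin.
rewrite ge0_integral_bigcup//=.
- by apply: measurable_funTS; apply/measurable_EFinP.
- by move=> t _; rewrite lee_fin.
Qed.

HB.instance Definition _ := isMeasure.Build _ _ _ (integral_measure mu mf f0)
  im0 im_ge0 im_semi_sigma_additive.

End integral_measure.

Section stieltjes.
Context {R : realType}.
Local Notation leb := (@lebesgue_measure R).

Lemma exists_stieltjes (H : R -> R) : nondecreasing H -> right_continuous H ->
  exists nu : {measure set (measurableTypeR R) -> \bar R},
    forall a b, a <= b -> nu `]a, b]%classic = (H b - H a)%:E.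
Proof.
move=> nd rc; pose F : cumulative R R := HB.pack H (isCumulative.Build R _ R H nd rc).
exists (lebesgue_stieltjes_measure F) => a b ab.
rewrite /= /lebesgue_stieltjes_measure /measure_extension measurable_mu_extE/=; last exact: is_ocitv.
exact: wlength_itv_bnd.
Qed.

Lemma measure_ocitv_unique (nu nu' : {measure set (measurableTypeR R) -> \bar R}) :
  (forall a b, a <= b -> nu `]a, b]%classic = nu' `]a, b]%classic) ->
  (forall a b, a <= b -> (nu `]a, b]%classic < +oo)%E) ->
  forall A, measurable A -> nu A = nu' A.
Proof.
move=> nunu' nufin A mA.
have nuE a b : nu `]a, b]%classic = nu' `]a, b]%classic.
  have [|/ltW ba] := leP a b; first exact: nunu'.
  by rewrite set_itv_ge ?measure0// bnd_simp -leNgt.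
apply: (@measure_unique _ R (measurableTypeR R) (@ocitv R) (fun n => `](- n%:R), n%:R]%classic)) => //.
- exact: ocitvI.
- by move=> i; exact: is_ocitv.
- apply/seteqP; split => // x _; exists (Num.trunc `|x|).+1 => //=.
  have := truncnS_gt `|x|; rewrite in_itv/= ltr_norml => /andP[-> /ltW ->//].
- by move=> _ [[a b] _ <-] /=; exact: nuE.
- by move=> n; apply: nufin; rewrite ge0_cp// ?opp_le0 ?ler0n.
Qed.

Lemma stieltjes_density (nu : {measure set (measurableTypeR R) -> \bar R}) :
  (nu setT < +oo)%E ->
  (forall A, measurable A -> leb A = 0%E -> nu A = 0%E) ->
  exists f : R -> R, [/\ forall x, 0 <= f x, leb.-integrable setT (EFin \o f) &
    forall A, measurable A -> nu A = (\int[leb]_(x in A) (f x)%:E)%E].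
Proof.
move=> nufin ac.
pose nu' : {finite_measure set (measurableTypeR R) -> \bar R} := mfrestr measurableT nufin.
have nu'E A : nu' A = nu A by rewrite /nu'/= /mfrestr /mrestr setIT.
have dom : nu' `<< leb.
  by apply/null_content_dominatesP => A mA A0; rewrite nu'E; exact: ac.
have [f [f0 ffin fint nuf]] := radon_nikodym_sigma_finite dom.
exists (fine \o f); split.
- by move=> x /=; rewrite fine_ge0.
- by rewrite (_ : EFin \o _ = f)//; apply/funext => x /=; rewrite fineK.
- by move=> A mA; rewrite -nu'E nuf//; apply: eq_integral => x _ /=; rewrite fineK.
Qed.

(** Lebesgue's differentiation theorem; [H] differs by a constant from the integral of [f] over
    ]-oo, x]. *)
Lemma ae_derivative (H f : R -> R) :
  leb.-integrable setT (EFin \o f) ->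
  (forall a b, a <= b -> ((H b - H a)%:E = \int[leb]_(x in `]a, b]) (f x)%:E)%E) ->
  {ae leb, forall x, (H (x + h) - H x) / h @[h --> 0^'] --> f x}.
Proof.
move=> fint Hf; pose F x := (\int[leb]_(t in [set` `]-oo, x]]) (f t))%R.
have fi y : leb.-integrable `]-oo, y] (EFin \o f) by apply: integrableS fint.
have lf : locally_integrable setT f.
  by apply: open_integrable_locally => //; exact: openT.
have HF a b : a <= b -> H b - H a = F b - F a.
  move=> ab; have -> : H b - H a = (\int[leb]_(x in `]a, b]) f x)%R.
    by rewrite /Rintegral -Hf.
  by rewrite /F Rintegral_itvB.
have HF' a b : H b - H a = F b - F a.
  have [|/ltW ba] := leP a b; first exact: HF.
  by rewrite -[LHS]opprB HF// opprB.
have FL : Filter (nbhs (almost_everywhere leb)) := ae_filter_ringOfSetsType leb.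
have := FTC1Ny fi lf; apply: filterS => x [dF F'].
have dF' : h^-1 *: ((F \o shift x) (h *: 1) - F x) @[h --> 0^'] --> f x.
  by rewrite -F' derive1E; exact: dF.
rewrite (_ : (fun h => _) = fun h => h^-1 *: ((F \o shift x) (h *: 1) - F x))//.
by apply/funext => h /=; rewrite HF' mulrC (addrC x h) [h *: 1]mulr1.
Qed.

End stieltjes.

(** * Densities of absolutely continuous functions *)

Section absolutely_continuous.
Context {R : realType}.
Local Notation leb := (@lebesgue_measure R).
Implicit Types f M phi H : R -> R.

Lemma right_continuous_dominated (phi MM : R -> R) (k : R) : 0 <= k ->
  (forall a b, a <= b -> `|phi b - phi a| <= k * (MM b - MM a)) ->
  right_continuous MM -> right_continuous phi.
Proof.
move=> k0 phiMM rc x; apply/cvgrPdist_le => e e0.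
have e1 : 0 < e / (k + 1) by rewrite divr_gt0// ltr_pwDr.
move/cvgrPdist_le : (rc x) => /(_ _ e1) h; near=> y.
have xy : x <= y by apply: ltW; near: y; exact: nbhs_right_gt.
rewrite distrC; apply: le_trans (phiMM _ _ xy) _.
have : `|MM x - MM y| <= e / (k + 1) by near: y.
rewrite distrC ler_norml ler_pdivlMr ?ltr_pwDr// => /andP[_ h2].
have [m0|m0] := leP 0 (MM y - MM x); nra.
Unshelve. all: by end_near. Qed.

Lemma right_continuous_integral (M MM : R -> R) :
  leb.-integrable setT (EFin \o M) ->
  (forall a b, a <= b -> (MM b - MM a)%:E = (\int[leb]_(x in `]a, b]) (M x)%:E)%E) ->
  right_continuous MM.
Proof.
move=> Mi MME x.
have Mi1 : leb.-integrable `[x, x + 1] (EFin \o M) by apply: integrableS Mi.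
have xx1 : x < x + 1 by rewrite ltrDl.
have h : (\int[leb]_(t in `[x, y]) M t)%R @[y --> x^'+] --> (\int[leb]_(t in `[x, x]) M t)%R.
  have := parameterized_integral_continuous (ltW xx1) Mi1.
  by move=> /(continuous_within_itvP _ xx1)[_ h _]; exact: h.
rewrite set_itv1 Rintegral_set1 in h.
have h' : MM x + (\int[leb]_(t in `[x, y]) M t)%R @[y --> x^'+] --> MM x + 0.
  by apply: cvgD; [exact: cvg_cst|exact: h].
rewrite addr0 in h'; apply: cvg_trans h'; apply: near_eq_cvg; near=> y.
have xy : x <= y by apply: ltW; near: y; exact: nbhs_right_gt.
rewrite /= -[RHS](addrNK (MM x)) addrC; congr (_ + _).
rewrite /Rintegral -[RHS]/(fine (MM y - MM x)%:E) MME//.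
rewrite integral_itv_obnd_cbnd//; apply: measurable_funTS.
by have /integrableP[] := Mi.
Unshelve. all: by end_near. Qed.

Lemma exists_primitive (M : R -> R) : leb.-integrable setT (EFin \o M) ->
  exists MM : R -> R, forall a b, a <= b ->
    (MM b - MM a)%:E = (\int[leb]_(x in `]a, b]) (M x)%:E)%E.
Proof.
move=> Mi; exists (fun x => \int[leb]_(t in [set` `]-oo, x]]) (M t))%R => a b ab.
rewrite Rintegral_itvB//; last by apply: integrableS Mi.
by rewrite /Rintegral fineK//; apply: integrable_fin_num => //; apply: integrableS Mi.
Qed.

(** With MM a primitive of M, both H = MM + phi and K = MM - phi are nondecreasing, and their
    Stieltjes measures add up to 2 M dx. So dH has a density rho by Radon-Nikodym, and phi = H - MM
    has the density rho - M. *)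
Lemma ac_density (phi M : R -> R) :
  (forall x, 0 <= M x) -> leb.-integrable setT (EFin \o M) ->
  (forall a b, a <= b -> (`|phi b - phi a|%:E <= \int[leb]_(x in `]a, b]) (M x)%:E)%E) ->
  exists psi : R -> R, leb.-integrable setT (EFin \o psi) /\
    forall a b, a <= b -> (phi b - phi a)%:E = (\int[leb]_(x in `]a, b]) (psi x)%:E)%E.
Proof.
move=> M0 Mi phiM; have [MM MME] := exists_primitive Mi.
have mM : measurable_fun setT M by have /integrableP[/measurable_EFinP] := Mi.
have phiMM a b : a <= b -> `|phi b - phi a| <= MM b - MM a.
  by move=> ab; rewrite -lee_fin MME// phiM.
have rcM := right_continuous_integral Mi MME.
pose H x := MM x + phi x; pose K x := MM x - phi x.
have HM a b : a <= b -> `|H b - H a| <= 2 * (MM b - MM a).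
  move=> ab; have := phiMM _ _ ab; rewrite /H !ler_norml => /andP[? ?].
  by apply/andP; split; lra.
have KM a b : a <= b -> `|K b - K a| <= 2 * (MM b - MM a).
  move=> ab; have := phiMM _ _ ab; rewrite /K !ler_norml => /andP[? ?].
  by apply/andP; split; lra.
have Hnd : nondecreasing H.
  by move=> a b ab; have := phiMM _ _ ab; rewrite /H !ler_norml => /andP[? ?]; lra.
have Knd : nondecreasing K.
  by move=> a b ab; have := phiMM _ _ ab; rewrite /K !ler_norml => /andP[? ?]; lra.
have Hrc : right_continuous H by apply: right_continuous_dominated HM rcM.
have Krc : right_continuous K by apply: right_continuous_dominated KM rcM.
have [nuH nuHE] := exists_stieltjes Hnd Hrc.
have [nuK nuKE] := exists_stieltjes Knd Krc.
have m2M : measurable_fun setT (fun x => 2 * M x) by exact: measurable_funM.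
have M20 x : 0 <= 2 * M x by rewrite mulr_ge0.
pose nu := integral_measure leb m2M M20.
have nuE A : measurable A -> (nuH A + nuK A)%E = nu A.
  move=> mA; rewrite -(measure_addE nuH nuK).
  apply: (measure_ocitv_unique (nu' := nu)) => // a b ab.
    rewrite [LHS]measure_addE nuHE// nuKE// -EFinD.
    rewrite [RHS](_ : _ = (2%:E * \int[leb]_(x in `]a, b]) (M x)%:E)%E).
      by rewrite -MME// -EFinM; congr EFin; rewrite /H /K; ring.
    rewrite /nu/= /integral_measure; under eq_integral do rewrite EFinM.
    rewrite ge0_integralZl//=; first by apply: measurable_funTS; exact/measurable_EFinP.
    by move=> x _; rewrite lee_fin.
  by rewrite [X in (X < _)%E]measure_addE nuHE// nuKE// -EFinD ltry.
have [rho [rho0 irho nurho]] : exists f : R -> R, [/\ forall x, 0 <= f x,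
    leb.-integrable setT (EFin \o f) &
    forall A, measurable A -> nuH A = (\int[leb]_(x in A) (f x)%:E)%E].
  apply: stieltjes_density.
  - apply: (@le_lt_trans _ _ (nu setT)); first by rewrite -nuE// leeDl.
    have /integrableP[_] := Mi; rewrite /nu/= /integral_measure => h.
    under eq_integral do rewrite EFinM.
    rewrite ge0_integralZl//=; last 2 first.
    + exact/measurable_EFinP.
    + by move=> x _; rewrite lee_fin.
    rewrite lte_mul_pinfty//; apply: le_lt_trans h; apply: ge0_le_integral => //.
    + by move=> x _; rewrite lee_fin.
    + exact/measurable_EFinP.
    + by apply/measurable_EFinP; exact: measurableT_comp.
    + by move=> x _; rewrite lee_fin ler_norm.
  - move=> A mA A0; apply/eqP; rewrite -measure_le0.
    apply: (@le_trans _ _ (nu A)); first by rewrite -nuE// leeDl.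
    rewrite /nu/= /integral_measure null_set_integral//.
    by apply: measurable_funTS; apply/measurable_EFinP.
exists (fun x => rho x - M x); split.
  rewrite (_ : EFin \o _ = (EFin \o rho) \- (EFin \o M))%E; last by apply/funext.
  exact: integrableB.
move=> a b ab; under eq_integral do rewrite EFinB.
rewrite integralB//=; [|by apply: integrableS irho|by apply: integrableS Mi].
rewrite -nurho// nuHE// -MME// -EFinB; congr EFin; rewrite /H; ring.
Qed.

End absolutely_continuous.

(** To be applied to the distance of two times measured along a path. It need not separate times, as
    a path may return to the same measure. *)
Record pseudo_metric (R : realType) (d : R -> R -> R) := PseudoMetric {
  pm_ge0 : forall s t, 0 <= d s t ;
  pm_refl : forall t, d t t = 0 ;
  pm_sym : forall s t, d s t = d t s ;
  pm_triangle : forall s t u, d s u <= d s t + d t u }.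

Section local_metric_derivative.
Context {R : realType}.
Local Notation leb := (@lebesgue_measure R).
Variables (d : R -> R -> R) (M : R -> R) (T : R).
Hypothesis pmd : pseudo_metric d.
Hypotheses (T0 : 0 < T) (M0 : forall x, 0 <= M x)
  (Mi : leb.-integrable setT (EFin \o M)).
Hypothesis dM : forall s t, 0 <= s -> s <= t -> t <= T ->
  ((d s t)%:E <= \int[leb]_(x in `]s, t]) (M x)%:E)%E.

Let mM : measurable_fun setT M.
Proof. by have /integrableP[/measurable_EFinP] := Mi. Qed.

(** Freezing the path outside [0, T] gives estimates valid on the whole line. *)
Let clamp t := Num.max 0 (Num.min t T).

Let clamp_itv t : 0 <= clamp t <= T.
Proof. by rewrite /clamp le_max lexx/= ge_max (ltW T0) ge_min lexx orbT. Qed.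

Let clamp_id t : 0 <= t <= T -> clamp t = t.
Proof. by move=> /andP[t0 tT]; rewrite /clamp (min_idPl tT) (max_idPr t0). Qed.

Let clamp_le s t : s <= t -> clamp s <= clamp t.
Proof.
by move=> st; rewrite /clamp le_max2// le_min2.
Qed.

Let d_clamp s t : s <= t ->
  ((d (clamp s) (clamp t))%:E <= \int[leb]_(x in `]s, t]) (M x)%:E)%E.
Proof.
move=> st; have /andP[cs0 _] := clamp_itv s; have /andP[_ ctT] := clamp_itv t.
apply: le_trans (dM cs0 (clamp_le st) ctT) _.
apply: ge0_subset_integral => //.
- by apply: measurable_funTS; exact/measurable_EFinP.
- by move=> x _; rewrite lee_fin.
- move=> x /=; rewrite !in_itv/= /clamp => /andP[].
  rewrite gt_max gt_min le_max le_min.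
  move=> /andP[x0 /orP[sx|Tx]] /orP[xn|/andP[xt xT]].
  + by move: (lt_le_trans x0 xn); rewrite ltxx.
  + by rewrite sx xt.
  + by move: (lt_le_trans x0 xn); rewrite ltxx.
  + by move: (lt_le_trans Tx xT); rewrite ltxx.
Qed.

Let q (n : nat) : R := if @unpickle rat n is Some r then clamp (ratr r) else 0.

Let phi n t := d (clamp t) (q n).

Let phi_dist n s t : `|phi n t - phi n s| <= d (clamp s) (clamp t).
Proof.
rewrite /phi ler_distl; apply/andP; split.
  by rewrite lerBlDr addrC pm_triangle.
by rewrite addrC (pm_sym pmd (clamp s)) pm_triangle.
Qed.

(** Almost everywhere the difference quotient is squeezed: from below by the quotients of the
    [phi n], whose limits have absolute value |psi n t|, from above by the averages of G, which tend
    to G t, the supremum of these values. *)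
Lemma local_metric_derivative : exists G : R -> R,
  [/\ measurable_fun setT G, forall x, 0 <= G x, leb.-integrable setT (EFin \o G),
      forall s t, 0 <= s -> s <= t -> t <= T ->
        ((d s t)%:E <= \int[leb]_(x in `]s, t]) (G x)%:E)%E &
      {ae leb, forall t, 0 < t < T -> d (t + h) t / `|h| @[h --> 0^'] --> G t}].
Proof.
have FL : Filter (nbhs (almost_everywhere leb)) := ae_filter_ringOfSetsType leb.
have [MM MME] := exists_primitive Mi.
have rcM := right_continuous_integral Mi MME.
have psi_ex n : exists psi : R -> R, leb.-integrable setT (EFin \o psi) /\
    forall a b, a <= b -> (phi n b - phi n a)%:E = (\int[leb]_(x in `]a, b]) (psi x)%:E)%E.
  apply: (ac_density M0 Mi) => a b ab.
  by apply: le_trans (d_clamp ab); rewrite lee_fin phi_dist.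
have [psi psiP] := choice psi_ex.
have mpsi n : measurable_fun setT (psi n).
  by have /integrableP[/measurable_EFinP] := (psiP n).1.
have mnpsi n : measurable_fun setT (fun x => `|psi n x|).
  by exact: measurableT_comp.
(* Capping by [M] makes the supremum finite at every point. *)
pose G t := sups (fun n => Num.min `|psi n t| (M t)) 0.
have Gub t : has_ubound (range (fun n => Num.min `|psi n t| (M t))).
  by exists (M t) => _ [n _ <-]; rewrite ge_min lexx orbT.
have Gge n t : Num.min `|psi n t| (M t) <= G t.
  apply: ub_le_sup; last by exists n.
  by exists (M t) => _ [k _ <-]; rewrite ge_min lexx orbT.
have GM t : G t <= M t.
  apply: ge_sup; first by exists (Num.min `|psi 0%N t| (M t)), 0%N.
  by move=> _ [k _ <-]; rewrite ge_min lexx orbT.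
have G0 t : 0 <= G t by apply: le_trans (Gge 0%N t); rewrite le_min normr_ge0 M0.
have mG : measurable_fun setT G.
  apply: measurable_fun_sups => // n; exact: measurable_minr.
have Gi : leb.-integrable setT (EFin \o G).
  apply: le_integrable Mi => //; first exact/measurable_EFinP.
  by move=> x _; rewrite lee_fin !ger0_norm.
have aeM : {ae leb, forall x, (MM (x + h) - MM x) / h @[h --> 0^'] --> M x}.
  exact: ae_derivative Mi MME.
have aephi : {ae leb, forall x, forall n,
    (phi n (x + h) - phi n x) / h @[h --> 0^'] --> psi n x}.
  by apply/ae_foralln => n; apply: ae_derivative; [exact: (psiP n).1|exact: (psiP n).2].
have phiMM n a b : `|phi n b - phi n a| <= `|MM b - MM a|.
  have h a' b' : a' <= b' -> `|phi n b' - phi n a'| <= `|MM b' - MM a'|.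
    move=> ab; apply: le_trans (phi_dist n a' b') _; apply: le_trans (ler_norm _).
    by rewrite -lee_fin MME// d_clamp.
  have [|/ltW] := leP a b; first exact: h.
  by move=> /h; rewrite distrC [X in _ <= X]distrC.
have psiM : {ae leb, forall x, forall n, `|psi n x| <= M x}.
  apply: filterS2 aeM aephi => x hM hphi n.
  rewrite -(ger0_norm (M0 x)).
  apply: (ler_cvg_to (cvg_norm (hphi n)) (cvg_norm hM)).
  by apply: nearW => h; rewrite !normrM ler_wpM2r.
have Gpsi : {ae leb, forall x, forall n, `|psi n x| <= G x}.
  apply: filterS psiM => x h n; apply: le_trans (Gge n x).
  by rewrite le_min lexx h.
have dG s t : 0 <= s -> s <= t -> t <= T ->
    ((d s t)%:E <= \int[leb]_(x in `]s, t]) (G x)%:E)%E.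
  move=> s0; rewrite le_eqVlt => /orP[/eqP-> _|st tT].
    by rewrite (pm_refl pmd) integral_ge0// => x _; rewrite lee_fin.
  apply/lee_addgt0Pr => e e0; have e2 : 0 < e / 2 by rewrite divr_gt0.
  have /cvgrPdist_le/(_ _ e2) nearMM := rcM s.
  (* A rational r just to the right of s serves as reference point: the distance to it is at most e
     / 2 at s, and at least d s t - e / 2 at t, so its increment recovers d s t up to e. *)
  have [y [sy yt hy]] : exists y, [/\ s < y, y < t & `|MM s - MM y| <= e / 2].
    near (s^'+) => y; exists y; split; near: y => //.
    - exact: nbhs_right_gt.
    - exact: nbhs_right_lt.
  have /rat_in_itvoo[r] := sy; rewrite in_itv/= => /andP[sr ry].
  have sT : 0 <= s <= T by rewrite s0 (le_trans (ltW st)).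
  have tT' : 0 <= t <= T by rewrite tT (le_trans s0 (ltW st)).
  have rT : 0 <= (ratr r : R) <= T.
    by rewrite (le_trans s0 (ltW sr)) (le_trans (ltW ry))// (le_trans (ltW yt)).
  have yT : y <= T by rewrite (le_trans (ltW yt)).
  pose n := pickle r; have qn : q n = ratr r by rewrite /q pickleK clamp_id.
  have ps : phi n s <= e / 2.
    rewrite /phi qn clamp_id//; apply: le_trans hy.
    rewrite distrC; apply: le_trans (ler_norm _).
    apply: (@le_trans _ _ (MM (ratr r) - MM s)).
      rewrite -lee_fin MME ?(ltW sr)//; apply: dM => //; first exact: ltW.
      by case/andP: rT.
    rewrite lerD2r -subr_ge0 -lee_fin MME ?(ltW ry)//.
    by apply: integral_ge0 => x _; rewrite lee_fin.
  have dst : d s t <= (phi n t - phi n s) + e.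
    have := pm_triangle pmd s (ratr r) t; rewrite (pm_sym pmd (ratr r) t).
    by move: ps; rewrite /phi qn !clamp_id//; lra.
  apply: (@le_trans _ _ ((phi n t - phi n s) + e)%:E); first by rewrite lee_fin.
  rewrite EFinD leeD2r// (psiP n).2 ?(ltW st)//.
  have mst : measurable (`]s, t]%classic : set (measurableTypeR R)) by [].
  apply: (@le_trans _ _ (\int[leb]_(x in `]s, t]) (`|psi n x|)%:E)%E).
    apply: le_integral => //.
    - by apply: integrableS (psiP n).1.
    - apply: (@integrableS _ _ _ leb setT) => //.
      by have := integrable_norm (psiP n).1.
    - by move=> x _; rewrite lee_fin ler_norm.
  apply: ae_ge0_le_integral => //.
  - apply: measurable_funTS; apply/measurable_EFinP.
    exact: mnpsi.
  - by move=> x _; rewrite lee_fin.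
  - by apply: measurable_funTS; exact/measurable_EFinP.
  - by apply: filterS Gpsi => x h _; rewrite lee_fin.
exists G; split => //.
have [GG GGE] := exists_primitive Gi.
have aeGG : {ae leb, forall x, (GG (x + h) - GG x) / h @[h --> 0^'] --> G x}.
  exact: ae_derivative Gi GGE.
have dGG s t : 0 <= s <= T -> 0 <= t <= T -> d s t <= `|GG s - GG t|.
  have h a b : 0 <= a <= T -> 0 <= b <= T -> a <= b -> d a b <= `|GG a - GG b|.
    move=> /andP[a0 _] /andP[_ bT] ab.
    by rewrite distrC (le_trans _ (ler_norm _))// -lee_fin GGE// dG.
  move=> sT tT; have [|/ltW] := leP s t; first exact: h.
  by rewrite (pm_sym pmd) distrC; exact: h.
apply: filterS3 aeGG aephi psiM => t hG hphi hM /andP[t0 tT].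
have Tt : 0 < T - t by rewrite subr_gt0.
have near_itv : \forall h \near (0:R)^', 0 <= t + h <= T.
  near=> h.
  have h1 : `|h| < t by near: h; exact: dnbhs0_lt.
  have h2 : `|h| < T - t by near: h; exact: dnbhs0_lt.
  by move: h1 h2; rewrite !ltr_norml => /andP[? ?] /andP[? ?]; apply/andP; split; lra.
apply/cvgrPdist_le => e e0.
have e2 : 0 < e / 2 by rewrite divr_gt0.
(* One index almost attains the supremum; it is fixed before h tends to 0. *)
have [n Gn] : exists n, G t - e / 2 < `|psi n t|.
  apply: contrapT => /forallNP nG.
  have : G t <= G t - e / 2.
    apply: ge_sup; first by exists (Num.min `|psi 0%N t| (M t)), 0%N.
    move=> _ [n _ <-]; apply: (@le_trans _ _ `|psi n t|); first by rewrite ge_min lexx.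
    by rewrite leNgt; exact/negP.
  by rewrite lerBrDl gerDr leNgt e2.
have hMn : `|psi n t| <= G t by apply: le_trans (Gge n t); rewrite le_min lexx hM.
have cG : `|(GG (t + h) - GG t) / h| @[h --> 0^'] --> `|G t| by exact: cvg_norm.
have cpsi : `|(phi n (t + h) - phi n t) / h| @[h --> 0^'] --> `|psi n t|.
  by apply: cvg_norm; exact: hphi.
have /cvgrPdist_le/(_ _ e0) near1 := cG.
have /cvgrPdist_le/(_ _ e2) near2 := cpsi.
near=> h.
have th : 0 <= t + h <= T by near: h.
have up : d (t + h) t / `|h| <= `|(GG (t + h) - GG t) / h|.
  by rewrite normrM normfV ler_wpM2r ?invr_ge0// dGG// (ltW t0) ltW.
have lo : `|(phi n (t + h) - phi n t) / h| <= d (t + h) t / `|h|.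
  rewrite normrM normfV ler_wpM2r ?invr_ge0//.
  apply: le_trans (phi_dist _ _ _) _.
  by rewrite !clamp_id ?(ltW t0) ?(ltW tT)// (pm_sym pmd).
have n1 : `| `|G t| - `|(GG (t + h) - GG t) / h| | <= e by near: h.
have n2 : `| `|psi n t| - `|(phi n (t + h) - phi n t) / h| | <= e / 2 by near: h.
rewrite (ger0_norm (G0 t)) in n1.
move: n1 n2; rewrite ![in X in X -> _]ler_distl => /andP[? ?].
rewrite ler_distl => /andP[? ?]; rewrite ler_distl; apply/andP; split; lra.
Unshelve. all: by end_near. Qed.

End local_metric_derivative.

(** The densities found on [0, n + 1] agree almost everywhere on common intervals, being limits of
    the same difference quotients. Their lower limit is a measurable way of patching them
    together. *)
Lemma global_metric_derivative (R : realType) (d : R -> R -> R) :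
  pseudo_metric d ->
  (forall n : nat, exists M : R -> R, [/\ forall x, 0 <= M x,
     (@lebesgue_measure R).-integrable setT (EFin \o M) &
     forall s t, 0 <= s -> s <= t -> t <= n.+1%:R ->
       ((d s t)%:E <= \int[lebesgue_measure]_(x in `]s, t]) (M x)%:E)%E]) ->
  exists g : R -> R,
  [/\ measurable_fun setT g, forall x, 0 <= g x,
      forall s t, 0 <= s -> s <= t ->
        ((d s t)%:E <= \int[lebesgue_measure]_(x in `]s, t]) (g x)%:E)%E &
      {ae lebesgue_measure, forall t, 0 < t -> d (t + h) t / `|h| @[h --> 0^'] --> g t}].
Proof.
move=> pmd Mex; set leb := @lebesgue_measure R.
have FL : Filter (nbhs (almost_everywhere leb)) := ae_filter_ringOfSetsType leb.
have Gex n : exists G : R -> R,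
  [/\ measurable_fun setT G, forall x, 0 <= G x,
      forall s t, 0 <= s -> s <= t -> t <= n.+1%:R ->
        ((d s t)%:E <= \int[leb]_(x in `]s, t]) (G x)%:E)%E &
      {ae leb, forall t, 0 < t < n.+1%:R -> d (t + h) t / `|h| @[h --> 0^'] --> G t}].
  have [M [M0 Mi dM]] := Mex n.
  have [G [mG G0 _ dG aeG]] := local_metric_derivative pmd (ltr0Sn _ n) M0 Mi dM.
  by exists G.
have [G Gp] := choice Gex.
have mG n : measurable_fun setT (G n) by have [] := Gp n.
have G0 n x : 0 <= G n x by have [] := Gp n.
have aeG : {ae leb, forall t, forall n, 0 < t < n.+1%:R ->
    d (t + h) t / `|h| @[h --> 0^'] --> G n t}.
  by apply/ae_foralln => n; have [] := Gp n.
pose g t := fine (limn_einf (fun n => (G n t)%:E)).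
have gG : {ae leb, forall t, forall n, 0 < t < n.+1%:R -> g t = G n t}.
  apply: filterS aeG => t Gt n /andP[t0 tn].
  suff cG : (G k t)%:E @[k --> \oo] --> (G n t)%:E.
    by rewrite /g (cvg_limn_einf_sup cG).1.
  apply: cvg_near_cst; near=> k; congr EFin.
  have nk : (n <= k)%N by near: k; exact: nbhs_infty_ge.
  have tk : 0 < t < k.+1%:R by rewrite t0 (lt_le_trans tn)// ler_nat.
  apply: (cvg_unique _ (Gt k tk) (Gt n _)); first exact: norm_hausdorff.
  by rewrite t0.
have mg : measurable_fun setT g.
  apply: (measurableT_comp (fine_measurable _)) => //.
  apply: measurable_fun_limn_einf => n; exact/measurable_EFinP.
exists g; split => //.
- move=> x; apply: fine_ge0; apply: limn_einf_ge0 => n; rewrite lee_fin; exact: G0.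
- move=> s t s0 st; have [n tn] : exists n : nat, t < n.+1%:R.
    exists (Num.truncn t); apply: truncnS_gt.
  have [_ _ dG _] := Gp n.
  apply: le_trans (dG _ _ s0 st (ltW tn)) _.
  rewrite le_eqVlt; apply/orP; left; apply/eqP; apply: ae_eq_integral => //.
  + by apply: measurable_funTS; apply/measurable_EFinP; first [exact: mG|exact: mg].
  + by apply: measurable_funTS; apply/measurable_EFinP; first [exact: mG|exact: mg].
  + apply: filterS gG => x /(_ n) h; rewrite /= in_itv/= => /andP[sx xt].
    by congr EFin; rewrite h// (le_lt_trans s0 sx) (le_lt_trans xt).
- apply: filterS2 aeG gG => t Gt gt t0; have tn := truncnS_gt t.
  by rewrite (gt (Num.truncn t)) ?t0//; apply: Gt; rewrite t0.
Unshelve. all: by end_near. Qed.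

Import HBNNSimple.

(* The integral of a nonnegative function is a supremum over simple functions below it, and
   cutting these off on [N] does not change their integrals; so [f] need not be measurable. *)
Lemma ae_integral_eq_nonmeasurable (R : realType) (D N : set R) (f g : R -> \bar R) :
  measurable N -> (@lebesgue_measure R) N = 0%E ->
  (forall x, D x -> ~ N x -> f x = g x) ->
  (\int[lebesgue_measure]_(x in D) f x = \int[lebesgue_measure]_(x in D) g x)%E.
Proof.
move=> mN N0 fg; set leb := @lebesgue_measure R.
have sE (h : {nnsfun (measurableTypeR R) >-> R}) : (\int[leb]_x (h x)%:E)%E = sintegral leb h.
  by rewrite integral_nnsfun// patch_setT.
have nn (u v : R -> \bar R) : (forall x, 0 <= u x)%E -> (forall x, 0 <= v x)%E ->
    (forall x, ~ N x -> u x <= v x)%E -> (\int[leb]_x u x <= \int[leb]_x v x)%E.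
  move=> u0 v0 uv; rewrite ge0_integralTE// [X in (_ <= X)%E]ge0_integralTE//.
  apply/ge_ereal_sup => _ [h hu <-]; have mNc : measurable (~` N) by exact: measurableC.
  apply: ereal_sup_ubound; exists (proj_nnsfun h mNc).
    move=> x; rewrite /= mindicE; have [|/negP] := boolP (x \in ~` N).
      by rewrite inE mulr1 => /uv; exact: le_trans.
    by move=> _; rewrite mulr0; exact: v0.
  rewrite -!sE.
  apply: ae_eq_integral => //.
  - by apply/measurable_EFinP.
  - by apply/measurable_EFinP.
  - exists N; split => // x /=; apply: contra_notP => xN _.
    by rewrite mindicE mem_set// mulr1.
have eqn (u v : R -> \bar R) : (forall x, 0 <= u x)%E -> (forall x, 0 <= v x)%E ->
    (forall x, ~ N x -> u x = v x) -> (\int[leb]_x u x = \int[leb]_x v x)%E.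
  by move=> u0 v0 uv; apply/eqP; rewrite eq_le !nn// => x /uv ->.
rewrite integralE [RHS]integralE; congr (_ - _)%E.
- rewrite integral_mkcond [RHS]integral_mkcond; apply: eqn.
  + by apply: erestrict_ge0 => x _; exact: funepos_ge0.
  + by apply: erestrict_ge0 => x _; exact: funepos_ge0.
  + by move=> x Nx; rewrite !patchE; case: ifPn => // /set_mem Dx; rewrite !funeposE fg.
- rewrite integral_mkcond [RHS]integral_mkcond; apply: eqn.
  + by apply: erestrict_ge0 => x _; exact: funeneg_ge0.
  + by apply: erestrict_ge0 => x _; exact: funeneg_ge0.
  + by move=> x Nx; rewrite !patchE; case: ifPn => // /set_mem Dx; rewrite !funenegE fg.
Qed.

(** * Speed and energy of paths *)

Section speed.
Context {R : realType} {d : nat} {p : R}.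
Hypothesis p1 : 1 < p.
Local Notation leb := (@lebesgue_measure R).
Implicit Types (sigma : R -> Pp d p) (g : R -> R).

Let p0 : 0 < p. Proof. exact: lt_trans p1. Qed.

(** Young's inequality with exponents p and q = p / (p - 1) for the product of x c^(-1/q) and
    c^(1/q). *)
Lemma young_powR (c x : R) : 0 < c -> 0 <= x ->
  x <= p^-1 * c `^ (1 - p) * x `^ p + (1 - p^-1) * c.
Proof.
move=> c0 x0; have pB : 0 < p - 1 by rewrite subr_gt0.
pose q := p / (p - 1); have q0 : 0 < q by rewrite divr_gt0.
have qV : q^-1 = 1 - p^-1.
  by rewrite /q invf_div mulrBl mul1r divff ?gt_eqF.
have pq : p^-1 + q^-1 = 1 by rewrite qV addrC subrK.
have xc0 : 0 <= x * c `^ (- q^-1) by rewrite mulr_ge0 ?powR_ge0.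
have := conjugate_powR xc0 (powR_ge0 c q^-1) p0 q0 pq.
rewrite -mulrA -powRD; last by apply/implyP => _; rewrite gt_eqF.
rewrite addNr powRr0 mulr1 powRM ?powR_ge0// -!powRrM.
rewrite mulVf ?gt_eqF// powRr1 ?(ltW c0)//.
have -> : - q^-1 * p = 1 - p by rewrite qV; field; rewrite gt_eqF.
by rewrite -qV => /le_trans; apply; rewrite lerD// ?[q^-1 * c]mulrC// mulrC mulrA mulrAC.
Qed.

(* A Borel version of [metric_derivative sigma], which is not shown to be measurable itself. *)
Definition is_speed sigma g :=
  [/\ measurable_fun setT g, forall x, 0 <= g x,
      forall s t, 0 <= s -> s <= t ->
        ((wasserstein (sigma s) (sigma t))%:E <= \int[leb]_(x in `]s, t]) (g x)%:E)%E &
      exists N : set R, [/\ measurable N, leb N = 0%E &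
        forall t, 0 <= t -> ~ N t -> metric_derivative sigma t = g t /\
          wasserstein (sigma (t + h)) (sigma t) / `|h| @[h --> 0^'] --> g t]].

Lemma wasserstein_pseudo_metric sigma :
  pseudo_metric (fun s t => wasserstein (sigma s) (sigma t)).
Proof.
split=> [s t|t|s t|s t u]; [exact: wasserstein_ge0|exact: wassersteinxx|
  exact: wassersteinC|exact: wasserstein_triangle].
Qed.

(** At t > 0 the constraint 0 <= t + h holds for all small h, so the filter in [metric_derivative]
    is the full punctured neighbourhood of 0. *)
Lemma metric_derivativeE sigma (t l : R) : 0 < t ->
  wasserstein (sigma (t + h)) (sigma t) / `|h| @[h --> 0^'] --> l ->
  metric_derivative sigma t = l.
Proof.
move=> t0 cl; rewrite /metric_derivative (_ : within _ _ = 0^'); first exact: cvg_lim.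
apply/funext => P; apply/propext; rewrite /within/=; split=> [tP|]; last first.
  by apply: filterS => x Px _.
near=> h; apply: (near tP h) => //.
have : `|h| < t by near: h; exact: dnbhs0_lt.
by rewrite ltr_norml => /andP[? _]; rewrite /=; lra.
Unshelve. all: by end_near. Qed.

Lemma exists_speed sigma :
  (forall n : nat, exists M : R -> R, [/\ forall x, 0 <= M x,
     leb.-integrable setT (EFin \o M) &
     forall s t, 0 <= s -> s <= t -> t <= n.+1%:R ->
       ((wasserstein (sigma s) (sigma t))%:E <= \int[leb]_(x in `]s, t]) (M x)%:E)%E]) ->
  exists g, is_speed sigma g.
Proof.
move=> /(global_metric_derivative (wasserstein_pseudo_metric sigma)).
move=> [g [mg g0 dg [N [mN N0 Ng]]]]; exists g; split => //.
(* At time 0 a two-sided quotient would involve negative times; 0 is put into the exceptional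
   set. *)
exists (N `|` [set 0]); split.
- exact: measurableU.
- apply/eqP; rewrite -measure_le0; apply: le_trans (measureU2 _ _ _) _ => //.
  by rewrite [X in (X + _)%E]N0 add0e [leq_lhs in (leq_lhs <= _)%E]lebesgue_measure_set1.
- move=> t t0 /not_orP[Nt /eqP tn0]; have tp : 0 < t by rewrite lt_neqAle eq_sym tn0.
  have cg : wasserstein (sigma (t + h)) (sigma t) / `|h| @[h --> 0^'] --> g t.
    by apply: contrapT => ncv; apply: Nt; apply: Ng => /= /(_ tp); exact: ncv.
  by split=> //; exact: metric_derivativeE.
Qed.

(** Since |m| <= 1 + |m|^p, from Young's inequality with c = 1, the function m is integrable on
    bounded intervals; |m| cut off to [0, n + 1] serves as dominating density. *)
Lemma locally_p_ac_speed sigma : locally_p_ac sigma -> exists g, is_speed sigma g.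
Proof.
move=> [m [mm Lm] mW]; apply: exists_speed => n.
have mI : measurable (`[0, n.+1%:R]%classic : set R) by [].
have mmI : measurable_fun (`[0, n.+1%:R]%classic : set R) m.
  by apply: measurable_funS mm => //; apply: subset_itvl.
pose M := (fun x => `|m x|) \_ (`[0, n.+1%:R]%classic).
have M0 x : 0 <= M x by rewrite /M patchE; case: ifP.
have iM : leb.-integrable `[0, n.+1%:R] (EFin \o m).
  apply/integrableP; split; first exact/measurable_EFinP.
  apply: (@le_lt_trans _ _ (\int[leb]_(x in `[0%R, n.+1%:R]) (1 + `|m x| `^ p)%:E)%E).
    apply: ge0_le_integral => //.
    - by apply: measurableT_comp => //; exact/measurable_EFinP.
    - apply/measurable_EFinP; apply: measurable_funD => //.
      by apply: (measurableT_comp (measurable_powR _)); exact: measurableT_comp.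
    - move=> x _; rewrite lee_fin/=; apply: le_trans (young_powR ltr01 _) _ => //.
      have pV : p^-1 <= 1 by rewrite invf_le1// ltW.
      rewrite powR1 !mulr1 addrC lerD ?ler_piMl ?powR_ge0// gerBl invr_ge0 ltW//.
  under eq_integral do rewrite EFinD.
  rewrite ge0_integralD//.
  - rewrite integral_cst// mul1e; apply: lte_add_pinfty; last exact: Lm.
    by rewrite [X in (X < _)%E]lebesgue_measure_itv/=; case: ifP => _; rewrite ?ltry.
  - apply/measurable_EFinP; apply: (measurableT_comp (measurable_powR _)).
    exact: measurableT_comp.
exists M; split => //.
- rewrite (_ : EFin \o M = (fun x => (`|m x|)%:E) \_ (`[0, n.+1%:R]%classic)).
    by apply: (integrable_mkcond _ _).1 => //; exact: (integrable_norm iM).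
  by apply/funext => x; rewrite /= /M !patchE; case: ifP.
- move=> s t s0 st tn; apply: (le_trans (mW s t s0 st)).
  have sub : (`[s, t] `<=` `[0, n.+1%:R])%classic.
    by apply: subset_itv; rewrite bnd_simp.
  apply: (@le_trans _ _ (\int[leb]_(x in `[s, t]) (`|m x|)%:E)%E).
    apply: le_integral => //.
    - exact: integrableS iM.
    - by apply: (@integrableS _ _ _ leb `[0, n.+1%:R]) => //; exact: (integrable_norm iM).
    - by move=> x _; rewrite lee_fin ler_norm.
  rewrite le_eqVlt; apply/orP; left; apply/eqP.
  rewrite -integral_itv_obnd_cbnd; last first.
    apply/measurable_EFinP; apply: measurableT_comp => //.
    apply: measurable_funS mmI => //; apply: subset_trans sub.
    by apply: subset_itv; rewrite bnd_simp.
  apply: eq_integral => x /set_mem xst; rewrite /M patchE mem_set//.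
  by apply: sub; move: xst; apply: subset_itv; rewrite bnd_simp.
Qed.
End speed.

(** * Weighted energy and primitives of the speed *)

Section weighted_energy.
Context {R : realType} {d : nat} {p delta : R}.
Hypotheses (p1 : 1 < p) (delta0 : 0 < delta).
Local Notation leb := (@lebesgue_measure R).
Implicit Types (sigma : R -> Pp d p) (g : R -> R).

Let p0 : 0 < p. Proof. exact: lt_trans p1. Qed.

Definition energy g : \bar R :=
  (\int[leb]_(t in `[0%R, +oo[) (expR (- delta * t) * g t `^ p)%:E)%E.

Lemma measurable_weight : measurable_fun setT (fun t : R => expR (- delta * t)).
Proof. by apply: measurableT_comp => //; exact: measurable_funM. Qed.

Lemma measurable_weighted g : measurable_fun setT g ->
  measurable_fun setT (fun t => expR (- delta * t) * g t `^ p).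
Proof.
move=> mg; apply: measurable_funM; first exact: measurable_weight.
exact: (measurableT_comp (measurable_powR _)).
Qed.

Lemma AC_speedE sigma g : is_speed sigma g ->
  (\int[leb]_(t in `[0%R, +oo[)
     (expR (- delta * t) * metric_derivative sigma t `^ p)%:E = energy g)%E.
Proof.
move=> [_ _ _ [N [mN N0 Ng]]]; apply: (ae_integral_eq_nonmeasurable mN N0).
by move=> t /=; rewrite in_itv/= andbT => t0 /(Ng _ t0) [->].
Qed.

Lemma action_speedE sigma g (V : Pp d p -> R) : is_speed sigma g ->
  (action delta V sigma = \int[leb]_(t in `[0%R, +oo[)
     (expR (- delta * t) * (p^-1 * g t `^ p - V (sigma t)))%:E)%E.
Proof.
move=> [_ _ _ [N [mN N0 Ng]]]; apply: (ae_integral_eq_nonmeasurable mN N0).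
by move=> t /=; rewrite in_itv/= andbT => t0 /(Ng _ t0) [->].
Qed.

Lemma weighted_le (s t : R) : 0 <= s -> s <= t -> 1 <= expR (delta * t) * expR (- delta * s).
Proof.
move=> s0 st; rewrite -expRD -(@expR0 R) ler_expR.
by rewrite mulNr subr_ge0 ler_pM2l.
Qed.

Lemma integral_powR_energy g (s t : R) : measurable_fun setT g -> 0 <= s ->
  (\int[leb]_(x in `]s, t]) (g x `^ p)%:E <= (expR (delta * t))%:E *
     \int[leb]_(x in `]s, t]) (expR (- delta * x) * g x `^ p)%:E)%E.
Proof.
move=> mg s0; have mgp := measurable_weighted mg.
rewrite -ge0_integralZl_EFin ?expR_ge0//; last first.
- by apply/measurable_EFinP; apply: measurable_funTS; exact: mgp.
- by move=> x _; rewrite lee_fin mulr_ge0 ?expR_ge0 ?powR_ge0.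
apply: ge0_le_integral => //.
- by move=> x _; rewrite lee_fin powR_ge0.
- apply/measurable_EFinP; apply: measurable_funTS.
  exact: (measurableT_comp (measurable_powR _)).
- by apply/measurable_EFinP; apply: measurable_funTS; exact: measurable_funM.
- move=> x; rewrite /= in_itv/= => /andP[sx xt]; rewrite lee_fin mulrA ler_peMl ?powR_ge0//.
  by apply: weighted_le => //; rewrite (le_trans s0)// ltW.
Qed.

Lemma integral_le_energy g (s t : R) : measurable_fun setT g -> 0 <= s ->
  (\int[leb]_(x in `]s, t]) (expR (- delta * x) * g x `^ p)%:E <= energy g)%E.
Proof.
move=> mg s0; apply: ge0_subset_integral => //.
- by apply/measurable_EFinP; apply: measurable_funTS; exact: measurable_weighted.
- by move=> x _; rewrite lee_fin mulr_ge0 ?expR_ge0 ?powR_ge0.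
- by move=> x /=; rewrite !in_itv/= andbT => /andP[sx _]; rewrite (le_trans s0)// ltW.
Qed.

Lemma AC_of_speed sigma g : is_speed sigma g -> (energy g < +oo)%E ->
  AC_p_delta delta sigma.
Proof.
move=> sg Eg; split; last by rewrite (AC_speedE sg).
have [mg g0 gW _] := sg; exists g; last first.
  move=> s t s0 st; rewrite -integral_itv_obnd_cbnd; first exact: gW.
  by apply/measurable_EFinP; exact: measurable_funTS.
split; first exact: measurable_funTS.
move=> T; rewrite -integral_itv_obnd_cbnd; last first.
  apply/measurable_EFinP; apply: measurable_funTS.
  by apply: (measurableT_comp (measurable_powR _)); exact: measurableT_comp.
under eq_integral do rewrite ger0_norm//.
apply: le_lt_trans (integral_powR_energy _ mg (lexx 0)) _.
apply: lte_mul_pinfty; rewrite ?lee_fin ?expR_ge0//.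
exact: le_lt_trans (integral_le_energy _ mg (lexx 0)) Eg.
Qed.

(** Young's inequality under the integral; inserting the weight costs the factor e^(delta t), the
    largest value of its inverse on the interval. *)
Lemma integral_young g (s t c : R) : measurable_fun setT g -> (forall x, 0 <= g x) ->
  0 <= s -> s <= t -> 0 < c ->
  (\int[leb]_(x in `]s, t]) (g x)%:E <= (p^-1 * c `^ (1 - p) * expR (delta * t))%:E *
    \int[leb]_(x in `]s, t]) (expR (- delta * x) * g x `^ p)%:E +
    ((1 - p^-1) * c * (t - s))%:E)%E.
Proof.
move=> mg g0 s0 st c0; have mgp := measurable_weighted mg.
have pV : 0 <= 1 - p^-1 by rewrite subr_ge0 invf_le1// ltW.
have mgpp : measurable_fun setT (fun x => g x `^ p).
  exact: (measurableT_comp (measurable_powR _)).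
have pc : 0 <= p^-1 * c `^ (1 - p) by rewrite mulr_ge0 ?powR_ge0 ?invr_ge0 ?ltW.
apply: (@le_trans _ _ (\int[leb]_(x in `]s, t])
    (p^-1 * c `^ (1 - p) * g x `^ p + (1 - p^-1) * c)%:E)%E).
  apply: ge0_le_integral => //.
  - by move=> x _; rewrite lee_fin.
  - by apply/measurable_EFinP; exact: measurable_funTS.
  - apply/measurable_EFinP; apply: measurable_funTS.
    by apply: measurable_funD => //; exact: measurable_funM.
  - by move=> x _; rewrite lee_fin young_powR.
under eq_integral do rewrite EFinD EFinM.
rewrite ge0_integralD//; last 3 first.
- by move=> x _; rewrite -EFinM lee_fin mulr_ge0// powR_ge0.
- apply: measurable_funTS; under eq_fun do rewrite -EFinM.
  by apply/measurable_EFinP; exact: measurable_funM.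
- by move=> x _; rewrite lee_fin mulr_ge0// ltW.
rewrite leeD//.
  rewrite ge0_integralZl_EFin//; last 2 first.
  - by move=> x _; rewrite lee_fin powR_ge0.
  - by apply/measurable_EFinP; exact: measurable_funTS.
  rewrite [X in (_ <= X * _)%E]EFinM -muleA lee_wpmul2l ?lee_fin//.
  exact: integral_powR_energy.
rewrite integral_cst// [X in (_ * X)%E](_ : _ = (t - s)%:E); first by rewrite -EFinM.
rewrite [LHS]lebesgue_measure_itv/= lte_fin; case: ltP => [//|ts].
have -> : t = s by apply/le_anti; rewrite ts st.
by rewrite subrr.
Qed.

Lemma integral_ocD (f : R -> R) (s t : R) : measurable_fun setT f -> (forall x, 0 <= f x) ->
  0 <= s -> s <= t ->
  (\int[leb]_(x in `]0%R, t]) (f x)%:E =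
   \int[leb]_(x in `]0%R, s]) (f x)%:E + \int[leb]_(x in `]s, t]) (f x)%:E)%E.
Proof.
move=> mf f0 s0 st.
rewrite -ge0_integral_setU//=; last 3 first.
- by apply/measurable_EFinP; exact: measurable_funTS.
- by move=> x _; rewrite lee_fin.
- apply/disj_setPS => x [/=]; rewrite !in_itv/= => /andP[_ xs] /andP[sx _].
  by move: (le_lt_trans xs sx); rewrite ltxx.
congr (integral _ _ _); rewrite -itv_bndbnd_setU//; rewrite bnd_simp//.
Qed.

(** Collects what the limit argument uses of a speed, as inequalities between values of two real
    functions; in this form everything passes to pointwise limits. *)
Lemma speed_primitives g : measurable_fun setT g -> (forall x, 0 <= g x) ->
  (energy g < +oo)%E ->
  exists G E : R -> R, [/\ G 0 = 0 /\ E 0 = 0,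
    forall s t, 0 <= s -> s <= t -> E s <= E t /\ E t <= fine (energy g),
    forall s t, 0 <= s -> s <= t -> (\int[leb]_(x in `]s, t]) (g x)%:E)%E = (G t - G s)%:E,
    forall s t, 0 <= s -> s <= t -> G s <= G t &
    forall s t c, 0 <= s -> s <= t -> 0 < c ->
      G t - G s <= p^-1 * c `^ (1 - p) * expR (delta * t) * (E t - E s) +
        (1 - p^-1) * c * (t - s)].
Proof.
move=> mg g0 Eg; have mgp := measurable_weighted mg.
have w0 x : 0 <= expR (- delta * x) * g x `^ p by rewrite mulr_ge0 ?expR_ge0 ?powR_ge0.
pose eE t := (\int[leb]_(x in `]0%R, t]) (expR (- delta * x) * g x `^ p)%:E)%E.
pose eG t := (\int[leb]_(x in `]0%R, t]) (g x)%:E)%E.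
have eEfin t : eE t \is a fin_num.
  rewrite ge0_fin_numE; last by apply: integral_ge0 => x _; rewrite lee_fin.
  exact: le_lt_trans (integral_le_energy _ mg (lexx 0)) Eg.
have eGfin t : 0 <= t -> eG t \is a fin_num.
  move=> t0; rewrite ge0_fin_numE; last by apply: integral_ge0 => x _; rewrite lee_fin.
  apply: le_lt_trans (integral_young mg g0 (lexx 0) t0 ltr01) _.
  by rewrite -/(eE t) -(fineK (eEfin t)) -EFinM -EFinD ltry.
have dE s t : 0 <= s -> s <= t ->
    (\int[leb]_(x in `]s, t]) (expR (- delta * x) * g x `^ p)%:E)%E = (fine (eE t) - fine (eE s))%:E.
  move=> s0 st; rewrite EFinB !fineK// /eE (integral_ocD mgp w0 s0 st).
  by rewrite addeAC subee ?add0e//; exact: eEfin.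
have dG s t : 0 <= s -> s <= t ->
    (\int[leb]_(x in `]s, t]) (g x)%:E)%E = (fine (eG t) - fine (eG s))%:E.
  move=> s0 st; rewrite EFinB !fineK ?eGfin ?(le_trans s0 st)// /eG (integral_ocD mg g0 s0 st).
  by rewrite addeAC subee ?add0e//; exact: eGfin.
exists (fine \o eG), (fine \o eE); split => /=.
- by rewrite /eG /eE set_itv_ge ?bnd_simp// !integral_set0.
- move=> s t s0 st; split.
    by rewrite -subr_ge0 -lee_fin -dE// integral_ge0// => x _; rewrite lee_fin.
  rewrite fine_le ?eEfin//; last exact: integral_le_energy.
  rewrite ge0_fin_numE//; apply: integral_ge0 => x _; rewrite lee_fin//.
- exact: dG.
- move=> s t s0 st; rewrite -subr_ge0 -lee_fin -dG// integral_ge0// => x _; rewrite lee_fin//.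
- move=> s t c s0 st c0; rewrite -lee_fin -dG// EFinD EFinM -dE//.
  exact: integral_young.
Qed.

End weighted_energy.
Arguments energy {R} p delta g.

(** * Compactness of paths *)

Section right_limits.
Context {R : realType}.
Implicit Types (F : rat -> R) (t : R).

(* [F q] only matters for [q >= 0]; the limit is constant on negative times. *)
Definition right_limit F t : R := inf [set F q | q in [set q : rat | Num.max 0 t < ratr q]].

Definition rat_nondecreasing F :=
  forall q q' : rat, 0 <= (ratr q : R) -> (ratr q : R) <= ratr q' -> 0 <= F q /\ F q <= F q'.

Let rat_gt (t : R) : exists q : rat, t < ratr q.
Proof.
have /rat_in_itvoo[q] : t < t + 1 by rewrite ltrDl.
by rewrite in_itv/= => /andP[tq _]; exists q.
Qed.

Variables (F : rat -> R) (ndF : rat_nondecreasing F).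

Let lbF t : has_inf [set F q | q in [set q : rat | Num.max 0 t < ratr q]].
Proof.
split; first by have [q tq] := rat_gt (Num.max 0 t); exists (F q), q.
exists 0 => _ [q /= + <-]; rewrite gt_max => /andP[q0 _].
by have [] := ndF (ltW q0) (lexx _).
Qed.

Lemma right_limit_le t q : Num.max 0 t < ratr q -> right_limit F t <= F q.
Proof. by move=> tq; apply: ge_inf; [have [] := lbF t|exists q]. Qed.

Lemma right_limit_ge t q : 0 <= (ratr q : R) <= Num.max 0 t -> F q <= right_limit F t.
Proof.
move=> /andP[q0 qt]; apply: lb_le_inf; first by have [] := lbF t.
move=> _ [q' /= tq' <-]; have [] := ndF q0 (ltW (le_lt_trans qt tq')) => //.
Qed.

Lemma right_limit_ge0 t : 0 <= right_limit F t.
Proof.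
have q0 : 0 <= (ratr (0 : rat) : R) by rewrite rmorph0.
have [F0 _] := ndF q0 (lexx _); apply: le_trans F0 _.
by apply: right_limit_ge; rewrite rmorph0 lexx le_max lexx.
Qed.

Lemma right_limit_near t e : 0 < e -> exists2 y, Num.max 0 t < y &
  forall q, Num.max 0 t < ratr q -> ratr q < y -> F q < right_limit F t + e.
Proof.
move=> e0; have [_ [q /= tq <-] Fq] := inf_adherent e0 (lbF t).
exists (ratr q) => // q' tq' q'q; apply: le_lt_trans Fq.
have q'0 : 0 <= (ratr q' : R) by apply: ltW; apply: le_lt_trans tq'; rewrite le_max lexx.
by have [] := ndF q'0 (ltW q'q).
Qed.

Lemma right_limit_nd : {homo right_limit F : s t / s <= t}.
Proof.
move=> s t st; apply: lb_le_inf; first by have [] := lbF t.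
move=> _ [q /= tq <-]; apply: right_limit_le; apply: le_lt_trans tq.
by rewrite le_max2.
Qed.

Lemma right_limit_continuous : right_continuous (right_limit F).
Proof.
move=> t; apply/cvgrPdist_le => e e0; have [y ty hy] := right_limit_near t e0.
near=> s; have ts : t < s by near: s; exact: nbhs_right_gt.
have sy : s < y by near: s; apply: nbhs_right_lt; apply: le_lt_trans ty; rewrite le_max lexx orbT.
have sy' : Num.max 0 s < y by rewrite gt_max sy andbT (le_lt_trans _ ty)// le_max lexx.
have /rat_in_itvoo[q] := sy'; rewrite in_itv/= => /andP[sq qy].
have tq : Num.max 0 t < ratr q by apply: le_lt_trans sq; rewrite le_max2// ltW.
rewrite distrC ger0_norm ?subr_ge0 ?right_limit_nd ?(ltW ts)// lerBlDl.
apply: le_trans (right_limit_le sq) _; exact: ltW (hy _ tq qy).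
Unshelve. all: by end_near. Qed.

End right_limits.

(** * Absolute continuity by domination, and an estimate for shifts *)

Section absolute_continuity.
Context {R : realType}.
Local Notation leb := (@lebesgue_measure R).

Lemma lebesgue_measure_oc (a b : R) : a <= b -> leb `]a, b]%classic = (b - a)%:E.
Proof.
move=> ab; rewrite lebesgue_measure_itv/= lte_fin; case: ltP => [//|ba].
by have -> : b = a; [apply/le_anti; rewrite ba ab|rewrite subrr].
Qed.

Lemma measure_setT_le (nu : {measure set (measurableTypeR R) -> \bar R}) (C : R) :
  (forall a b : R, (a <= b)%R -> nu `]a, b]%classic <= C%:E)%E -> (nu setT <= C%:E)%E.
Proof.
move=> nuC; pose A n : set R := (`](- n%:R), n%:R]%classic).
have UA : \bigcup_n A n = setT.
  rewrite -subTset => x _; have := truncnS_gt `|x|; rewrite ltr_norml => /andP[h1 h2].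
  by exists (Num.truncn `|x|).+1 => //; rewrite /A/= in_itv/= h1 ltW.
have ndA : nondecreasing_seq A.
  move=> m n mn; apply/subsetPset; apply: subset_itv; rewrite bnd_simp ?lerN2 ler_nat//.
have mA n : measurable (A n : set (measurableTypeR R)) by exact: measurable_itv.
have := nondecreasing_cvg_mu (mu := nu) mA.
rewrite UA => /(_ measurableT ndA) cnu.
rewrite -(cvg_lim _ cnu)//; apply: lime_le; first by apply/cvg_ex; eexists; exact: cnu.
by apply: nearW => n; rewrite /= nuC// (le_trans (y := 0)) ?oppr_le0.
Qed.

(** The hypothesis says dG <= a dt + e dE for every e, with a depending on e. On a Lebesgue null set
    this leaves at most e (E T - E 0), so dG vanishes there and Radon-Nikodym applies. *)
Lemma ac_stieltjes_density (G E : R -> R) (T : R) : 0 <= T ->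
  nondecreasing G -> nondecreasing E -> right_continuous G -> right_continuous E ->
  (forall e, 0 < e -> exists2 a, 0 <= a & forall s t, 0 <= s -> s <= t -> t <= T ->
     G t - G s <= a * (t - s) + e * (E t - E s)) ->
  exists M : R -> R, [/\ forall x, 0 <= M x, leb.-integrable setT (EFin \o M) &
    forall s t, 0 <= s -> s <= t -> t <= T ->
      (G t - G s)%:E = (\int[leb]_(x in `]s, t]) (M x)%:E)%E].
Proof.
move=> T0 ndG ndE rcG rcE GE.
pose c t := Num.max 0 (Num.min t T).
have c0 t : 0 <= c t by rewrite /c le_max lexx.
have cT t : c t <= T by rewrite /c ge_max T0 ge_min lexx orbT.
have cid t : 0 <= t -> t <= T -> c t = t.
  by move=> t0 tT; rewrite /c (min_idPl tT) (max_idPr t0).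
have cnd s t : s <= t -> c s <= c t by move=> st; rewrite /c le_max2// le_min2.
have cLip s t : s <= t -> c t - c s <= t - s.
  by rewrite /c !maxEle !minEle => st; do !case: ifPn; rewrite -?ltNge; lra.
have rcc (F : R -> R) : right_continuous F -> right_continuous (F \o c).
  move=> rcF t; apply/cvgrPdist_le => e e0.
  have /cvgrPdist_le/(_ _ e0)[r /= r0 hr] := rcF (c t).
  near=> s; have ts : t < s by near: s; exact: nbhs_right_gt.
  have sr : s < t + r by near: s; apply: nbhs_right_lt; rewrite ltrDl.
  rewrite /=; have := cnd _ _ (ltW ts); rewrite le_eqVlt => /orP[/eqP->|cts].
    by rewrite subrr normr0 ltW.
  apply: hr => //=; rewrite distrC gtr0_norm ?subr_gt0//.
  by have := cLip _ _ (ltW ts); lra.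
have ndc (F : R -> R) : nondecreasing F -> nondecreasing (F \o c).
  by move=> ndF s t st; apply: ndF; exact: cnd.
have [nuG nuGE] := exists_stieltjes (ndc _ ndG) (rcc _ rcG).
have [nuE nuEE] := exists_stieltjes (ndc _ ndE) (rcc _ rcE).
have bnd (F : R -> R) (nu : {measure set (measurableTypeR R) -> \bar R}) : nondecreasing F ->
    (forall a b, a <= b -> nu `]a, b]%classic = ((F \o c) b - (F \o c) a)%:E) ->
    (nu setT <= (F T - F 0)%:E)%E.
  move=> ndF nuF; apply: measure_setT_le => a b ab; rewrite nuF// lee_fin/= lerB//; exact: ndF.
have nuE_fin := bnd _ _ ndE nuEE; have nuG_fin := bnd _ _ ndG nuGE.
have [||M [M0 Mi ME]] := @stieltjes_density R nuG.
- by apply: le_lt_trans nuG_fin _; rewrite ltry.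
- move=> N mN N0; apply/eqP; rewrite -measure_le0; apply/lee_addgt0Pr => e e0; rewrite add0e.
  (* The summand 1 keeps the divisor positive when E is constant. *)
  pose D := E T - E 0 + 1.
  have D0 : 0 < D by rewrite ltr_pwDr// subr_ge0 ndE.
  have eD : 0 < e / D by rewrite divr_gt0.
  have [a a0 ha] := GE _ eD.
  (* The slack of the domination. Being nondecreasing, it has a Stieltjes measure, and the
     inequality becomes an equality of sums of measures, which can be checked on half-open
     intervals. *)
  pose K t := a * t + (e / D) * E (c t) - G (c t).
  have ndK : nondecreasing K.
    move=> s t st; rewrite /K.
    have /(ha _ _ (c0 s) (cnd _ _ st)) := cT t.
    have := ler_wpM2l a0 (cLip _ _ st); lra.
  have rcK : right_continuous K.
    move=> t; apply: cvgB; last exact: rcc.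
    apply: cvgD; last by apply: cvgMl_tmp; exact: rcc.
    by apply: cvgMl_tmp; apply: cvg_at_right_filter; exact: cvg_id.
  have [nuK nuKE] := exists_stieltjes ndK rcK.
  have eD0 := ltW eD.
  pose m1 : {measure set (measurableTypeR R) -> \bar R} := measure_add nuG nuK.
  pose m2 : {measure set (measurableTypeR R) -> \bar R} :=
    measure_add (mscale (NngNum a0) leb) (mscale (NngNum eD0) nuE).
  have m1E A : m1 A = (nuG A + nuK A)%E by exact: measure_addE.
  have m2E A : m2 A = (a%:E * leb A + (e / D)%:E * nuE A)%E by exact: measure_addE.
  have m12 : m1 N = m2 N.
    apply: measure_ocitv_unique => //.
    - move=> x y xy; rewrite m1E m2E nuGE// nuKE// nuEE// lebesgue_measure_oc//.
      by rewrite -!EFinM -!EFinD; congr EFin; rewrite /K /=; ring.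
    - by move=> x y xy; rewrite m1E nuGE// nuKE// -EFinD ltry.
  have : (nuG N <= m1 N)%E by rewrite m1E leeDl.
  rewrite m12 m2E [leb N]N0 mule0 add0e => /le_trans; apply.
  apply: (@le_trans _ _ ((e / D)%:E * (E T - E 0)%:E)%E).
    rewrite lee_wpmul2l ?lee_fin//; apply: le_trans nuE_fin; apply: le_measure => //; rewrite inE//.
  rewrite -EFinM lee_fin mulrAC ler_pdivrMr// ler_wpM2l ?(ltW e0)// /D lerDl//.
- exists M; split=> // s t s0 st tT; rewrite -ME// nuGE//= !cid//; [exact: le_trans st tT|exact: le_trans s0 st].
Unshelve. all: by end_near. Qed.

(** After a translation the left side telescopes to the integral of E over ]T, T + h] minus that
    over ]0, h]; the former is at most h L. *)
Lemma integral_shift_le (E : R -> R) (L h T : R) : nondecreasing E ->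
  (forall t, 0 <= E t <= L) -> 0 < h -> 0 <= T ->
  (\int[leb]_(t in `]0%R, T]) (E (t + h) - E t)%:E <= (h * L)%:E)%E.
Proof.
move=> ndE EL h0 T0.
have mE : measurable_fun setT E by apply: nondecreasing_measurable.
have mh : measurable_fun setT (fun t : R => t + h) by exact: measurable_funD.
have mEh : measurable_fun setT (fun t : R => E (t + h)) by exact: measurableT_comp.
have shift : (\int[leb]_(t in `]0%R, T]) (E (t + h))%:E = \int[leb]_(t in `]h, (T + h)%R]) (E t)%:E)%E.
  pose phi (t : measurableTypeR R) : measurableTypeR R := t + h.
  (* The image of Lebesgue measure under the translation, shown below to be Lebesgue measure
     again. *)
  have [mu muphi] : exists mu : {measure set (measurableTypeR R) -> \bar R},
      forall D (f : R -> \bar R), measurable D -> measurable_fun D f -> {in D, forall y, 0 <= f y}%E ->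
        (\int[mu]_(y in D) f y = \int[leb]_(x in phi @^-1` D) f (phi x))%E /\ mu D = leb (phi @^-1` D).
    unshelve refine (ex_intro _ (pushforward leb phi : {measure set _ -> \bar R}) _).
      exact: mh.
    by move=> D f mD mf f0; split=> //; exact: ge0_integral_pushforward.
  have muE D : measurable D -> mu D = leb (phi @^-1` D).
    by move=> mD; have [] := muphi D (cst 0%E) mD (measurable_cst _).
  have pre (a b : R) : phi @^-1` `]a, b]%classic = `]a - h, b - h]%classic.
    by apply/seteqP; split=> x /=; rewrite !in_itv/= ltrBlDr lerBrDr.
  have preE a b : a <= b -> leb `]a - h, b - h]%classic = (b - a)%:E.
    by move=> ab; rewrite lebesgue_measure_oc ?lerD2r//; congr EFin; ring.
  have muleb A : measurable A -> mu A = leb A.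
    apply: measure_ocitv_unique.
    - by move=> a b ab; rewrite muE// pre; apply: etrans (preE _ _ ab) (esym (lebesgue_measure_oc ab)).
    - by move=> a b ab; rewrite muE// pre [X in (X < _)%E](preE _ _ ab) ltry.
  transitivity (\int[mu]_(t in `]h, (T + h)%R]) (E t)%:E)%E; last first.
    by apply: eq_measure_integral => A mA _; exact: muleb.
  rewrite (muphi _ _ _ _ _).1//.
  - congr (integral _ _ _); apply/seteqP; split=> x /=; rewrite !in_itv/= /phi; lra.
  - by apply/measurable_EFinP; exact: measurable_funTS.
  - by move=> x _; rewrite lee_fin; have /andP[] := EL x.
have E0 x : 0 <= E x by have /andP[] := EL x.
have meas (f : R -> R) (D : set R) : measurable D -> measurable_fun setT f ->
    measurable_fun (D : set (measurableTypeR R)) (EFin \o f).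
  by move=> mD mf; apply: measurable_funTS; exact/measurable_EFinP.
have Lh : (\int[leb]_(t in `]T, (T + h)%R]) (E t)%:E <= (h * L)%:E)%E.
  apply: (@le_trans _ _ (\int[leb]_(t in `]T, (T + h)%R]) (cst L%:E t))%E).
    apply: ge0_le_integral => //.
    - by move=> x _; rewrite lee_fin.
    - exact: meas.
    - by move=> x _; rewrite lee_fin; have /andP[] := EL x.
  have TTh : T <= T + h by rewrite lerDl ltW.
  rewrite integral_cst// [X in (_ * X)%E](lebesgue_measure_oc TTh).
  by rewrite -EFinM lee_fin mulrC addrAC subrr add0r.
have fin : (\int[leb]_(t in `]0%R, T]) (E t)%:E)%E \is a fin_num.
  rewrite ge0_fin_numE; last by apply: integral_ge0 => x _; rewrite lee_fin.
  apply: (@le_lt_trans _ _ (\int[leb]_(t in `]0%R, T]) (cst L%:E t))%E).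
    apply: ge0_le_integral => //.
    - by move=> x _; rewrite lee_fin.
    - exact: meas.
    - by move=> x _; rewrite lee_fin; have /andP[] := EL x.
  by rewrite integral_cst// [X in (_ * X)%E](lebesgue_measure_oc T0) -EFinM ltry.
suff : (\int[leb]_(t in `]0%R, T]) (E (t + h) - E t)%:E + \int[leb]_(t in `]0%R, T]) (E t)%:E <=
    (h * L)%:E + \int[leb]_(t in `]0%R, T]) (E t)%:E)%E by rewrite leeD2rE.
rewrite -ge0_integralD//; last 4 first.
- by move=> x _; rewrite lee_fin subr_ge0 ndE// lerDl ltW.
- by apply: meas => //; exact: measurable_funB.
- by move=> x _; rewrite lee_fin.
- exact: meas.
under eq_integral do rewrite -EFinD subrK.
rewrite shift; apply: (@le_trans _ _ (\int[leb]_(t in `]0%R, (T + h)%R]) (E t)%:E)%E).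
  apply: ge0_subset_integral => //; first exact: meas.
  - by move=> x _; rewrite lee_fin.
  - by apply: subset_itv; rewrite bnd_simp// ltW.
rewrite addeC; apply: le_trans (leeD2l _ Lh).
rewrite -ge0_integral_setU//=; last 3 first.
- by apply: meas => //; exact: measurableU.
- by move=> x _; rewrite lee_fin.
- apply/disj_setPS => x [/=]; rewrite !in_itv/= => /andP[_ xs] /andP[sx _].
  by move: (le_lt_trans xs sx); rewrite ltxx.
rewrite -itv_bndbnd_setU// bnd_simp// lerDl ltW//.
Qed.

End absolute_continuity.

Lemma bounded_subsequence (R : realType) (I : countType) (a : nat -> I -> R) (B : I -> R) :
  (forall k i, 0 <= a k i <= B i) ->
  exists2 f : nat -> nat, {homo f : m n / (m < n)%N} & forall i, cvgn (fun k => a (f k) i).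
Proof.
move=> aB; have B0 i : 0 < B i + 1.
  by have /andP[h1 h2] := aB 0%N i; rewrite ltr_pwDr// (le_trans h1).
pose b k n := if @unpickle I n is Some i then a k i / (B i + 1) else 0.
have [|f hf fc] := @diagonal_subsequence R b.
  move=> k n; rewrite /b; case: unpickle => [i|]; last by rewrite lexx ler01.
  have /andP[h1 h2] := aB k i; rewrite divr_ge0 ?(ltW (B0 i))//= ler_pdivrMr// mul1r.
  by rewrite (le_trans h2)// lerDl.
exists f => // i; have /cvg_ex[/= l cl] := fc (pickle i).
rewrite (_ : (fun k => a (f k) i) = fun k => b (f k) (pickle i) * (B i + 1)).
  by apply/cvg_ex; exists (l * (B i + 1)); exact: cvgMr_tmp.
by apply/funext => k; rewrite /b pickleK divfK// gt_eqF.
Qed.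

(** The exponent 1 - p is negative, so a large c works; the chosen one gives K e / (K + 1). *)
Lemma exists_powR_small (R : realType) (p K e : R) : 1 < p -> 0 <= K -> 0 < e ->
  exists2 c, 0 < c & K * c `^ (1 - p) <= e.
Proof.
move=> p1 K0 e0; have pB : 0 < p - 1 by rewrite subr_gt0.
pose B := (K + 1) / e; have B0 : 0 < B by rewrite divr_gt0// ltr_pwDr.
exists (B `^ (p - 1)^-1); first by rewrite powR_gt0.
rewrite -powRrM (_ : _ * (1 - p) = - 1); last first.
  by rewrite -[1 - p]opprB mulrN mulVf// gt_eqF.
rewrite powR_inv1 ?(ltW B0)// /B invf_div mulrCA ger_pMr//.
by rewrite ler_pdivrMr ?mul1r ?lerDl// ltr_pwDr.
Qed.

(** * Limits of sequences of paths with bounded energy *)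

Section path_limit.
Context {R : realType} {d : nat} {p delta : R}.
Hypotheses (p1 : 1 < p) (delta0 : 0 < delta).

Let p0 : 0 < p. Proof. exact: lt_trans p1. Qed.

Lemma moment_wasserstein (mu nu : Pp d p) (D : R) : wasserstein mu nu < D ->
  (\int[nu]_x (enorm x `^ p)%:E <=
   (2 `^ p)%:E * (\int[mu]_x (enorm x `^ p)%:E + (D `^ p)%:E))%E.
Proof.
move=> WD; have D0 : 0 < D by apply: le_lt_trans WD; exact: wasserstein_ge0.
have [pi cpi costD] := wasserstein_lt_coupling p1 WD.
rewrite (moment_law measurable_snd (coupling_snd cpi)).
rewrite (moment_law measurable_fst (coupling_fst cpi)).
apply: (@le_trans _ _ ((2 `^ p)%:E * (\int[pi]_z (enorm z.1 `^ p)%:E + transport_cost p pi))%E).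
  apply: (integral_powR_le p1).
  - by apply: measurableT_comp; [exact: measurable_enorm|exact: measurable_snd].
  - by apply: measurableT_comp; [exact: measurable_enorm|exact: measurable_fst].
  - exact: measurable_edist12.
  - by move=> z; exact: enorm_ge0.
  - by move=> z; exact: enorm_ge0.
  - by move=> z; exact: edist_ge0.
  - by move=> z; rewrite edistC; exact: enorm_le_edist.
rewrite lee_wpmul2l ?lee_fin ?powR_ge0// leeD2l//.
have c0 := @transport_cost_ge0 _ _ p pi.
have cf := transport_cost_fin p1 cpi.
move: costD; rewrite -(fineK cf) poweR_EFin lte_fin lee_fin => h.
have x0 : 0 <= fine (transport_cost p pi) by exact: fine_ge0.
have -> : fine (transport_cost p pi) = (fine (transport_cost p pi) `^ p^-1) `^ p.
  by rewrite -powRrM mulVf ?gt_eqF// powRr1.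
by rewrite ge0_ler_powR ?nnegrE ?powR_ge0 ?(ltW D0) ?(ltW h) ?ltW.
Qed.

Variables (sigma : nat -> R -> Pp d p) (mu : Pp d p) (G E : nat -> R -> R) (C : R).
Hypothesis sigma0 : forall k, sigma k 0 = mu.
Hypothesis WG : forall k s t, 0 <= s -> s <= t ->
  wasserstein (sigma k s) (sigma k t) <= G k t - G k s.
Hypothesis G0 : forall k, G k 0 = 0.
Hypothesis E0 : forall k, E k 0 = 0.
Hypothesis ndG : forall k s t, 0 <= s -> s <= t -> G k s <= G k t.
Hypothesis ndE : forall k s t, 0 <= s -> s <= t -> E k s <= E k t.
Hypothesis EC : forall k t, 0 <= t -> E k t <= C.
Hypothesis young : forall k s t c, 0 <= s -> s <= t -> 0 < c ->
  G k t - G k s <= p^-1 * c `^ (1 - p) * expR (delta * t) * (E k t - E k s) +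
    (1 - p^-1) * c * (t - s).

Let C0 : 0 <= C. Proof. by rewrite -(E0 0%N) EC. Qed.
Let pV : 0 <= p^-1. Proof. by rewrite invr_ge0 ltW. Qed.
Let pV1 : 0 <= 1 - p^-1. Proof. by rewrite subr_ge0 invf_le1// ltW. Qed.
Let E_ge0 k t : 0 <= t -> 0 <= E k t. Proof. by move=> t0; rewrite -(E0 k) ndE. Qed.

Lemma young_bound k s t T c : 0 <= s -> s <= t -> t <= T -> 0 < c ->
  G k t - G k s <= p^-1 * c `^ (1 - p) * expR (delta * T) * (E k t - E k s) +
    (1 - p^-1) * c * (t - s).
Proof.
move=> s0 st tT c0; apply: le_trans (young k s0 st c0) _.
rewrite lerD2r ler_wpM2r ?subr_ge0 ?ndE// ler_wpM2l ?mulr_ge0 ?powR_ge0//.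
by rewrite ler_expR ler_pM2l.
Qed.

(** First [c] is taken so large that the energy term is at most e / 2 for all k at once; for this
    [c] the other term is linear in t - s, which determines [eta]. *)
Lemma equicontinuity (T e : R) : 0 < e -> exists2 eta, 0 < eta &
  forall k s t, 0 <= s -> s <= t -> t <= T -> t - s < eta -> G k t - G k s <= e.
Proof.
move=> e0; have e2 : 0 < e / 2 by rewrite divr_gt0.
have K0 : 0 <= p^-1 * expR (delta * T) * C by rewrite !mulr_ge0 ?expR_ge0.
have [c c0 hc] := exists_powR_small p1 K0 e2.
have D0 : 0 < (1 - p^-1) * c + 1 by rewrite ltr_pwDr// mulr_ge0// ltW.
exists (e / 2 / ((1 - p^-1) * c + 1)); first by rewrite divr_gt0.
move=> k s t s0 st tT; rewrite ltr_pdivlMr// => h.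
apply: le_trans (young_bound k s0 st tT c0) _.
have EkC : E k t - E k s <= C.
  by rewrite lerBlDr (le_trans (EC k (le_trans s0 st)))// lerDl E_ge0.
have h1 : p^-1 * c `^ (1 - p) * expR (delta * T) * (E k t - E k s) <= e / 2.
  apply: le_trans hc.
  rewrite [leRHS](_ : _ = p^-1 * c `^ (1 - p) * expR (delta * T) * C); last by ring.
  by rewrite ler_wpM2l// !mulr_ge0 ?powR_ge0 ?expR_ge0.
have h2 : (1 - p^-1) * c * (t - s) <= e / 2.
  apply: le_trans (ltW h); rewrite mulrC ler_wpM2l ?subr_ge0// lerDl//.
by move: h1 h2; lra.
Qed.

Let bnd T := p^-1 * 1 `^ (1 - p) * expR (delta * T) * C + (1 - p^-1) * 1 * T.

Lemma G_bound k t T : 0 <= t -> t <= T -> 0 <= G k t <= bnd T.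
Proof.
move=> t0 tT; rewrite -{1}(G0 k) ndG//=.
have := young_bound k (lexx 0) t0 tT ltr01; rewrite G0 E0 !subr0 => /le_trans; apply.
rewrite /bnd lerD//; first by rewrite ler_wpM2l ?EC// !mulr_ge0 ?powR_ge0 ?expR_ge0.
by rewrite ler_wpM2l// mulr1.
Qed.

Lemma path_moment T : exists B : R, forall k t, 0 <= t -> t <= T ->
  (\int[sigma k t]_x (enorm x `^ p)%:E <= B%:E)%E.
Proof.
have mfin : (\int[mu]_x (enorm x `^ p)%:E)%E \is a fin_num.
  by rewrite ge0_fin_numE ?Pp_moment// integral_ge0// => x _; rewrite lee_fin powR_ge0.
exists (2 `^ p * (fine (\int[mu]_x (enorm x `^ p)%:E) + (bnd T + 1) `^ p)) => k t t0 tT.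
rewrite EFinM EFinD fineK//; apply: moment_wasserstein.
rewrite -(sigma0 k); apply: le_lt_trans (WG k (lexx 0) t0) _.
rewrite G0 subr0; have /andP[_ h] := G_bound k t0 tT.
by apply: le_lt_trans h _; rewrite ltrDl.
Qed.

(** Taking absolute values keeps the index type [rat] while only nonnegative times are visited. *)
Let absq (q : rat) : R := `|ratr q|.

Lemma path_subsequence : exists2 f : nat -> nat, {homo f : m n / (m < n)%N} &
  forall q, [/\ forall r : rat, cvgn (fun k => code_quantile (sigma (f k) (absq q)) (ratr r)),
    cvgn (fun k => G (f k) (absq q)) & cvgn (fun k => E (f k) (absq q))].
Proof.
have [f hf cf] := code_quantile_subsequence (fun k q => Pp_meas (sigma k (absq q))).
pose a k (i : rat + rat) := match i with inl q => G (f k) (absq q) | inr q => E (f k) (absq q) end.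
pose B (i : rat + rat) := match i with inl q => bnd (absq q) | inr q => C end.
have [|f' hf' cf'] := @bounded_subsequence R _ a B.
  move=> k [q|q] /=; first by rewrite G_bound// normr_ge0.
  by rewrite E_ge0 ?EC ?normr_ge0.
exists (f \o f') => [m n mn|q]; first by rewrite /= hf// hf'.
split; [move=> r|exact: cf' (inl q)|exact: cf' (inr q)].
have /cvg_ex[l cl] := cf q r; apply/cvg_ex; exists l.
exact: (cvg_subseq hf' cl).
Qed.

Hypothesis cq : forall q, [/\ forall r : rat, cvgn (fun k => code_quantile (sigma k (absq q)) (ratr r)),
    cvgn (fun k => G k (absq q)) & cvgn (fun k => E k (absq q))].

Lemma levy_prokhorov_equicontinuity (T e : R) : 0 < e -> exists2 eta, 0 < eta &
  forall k s t, 0 <= s -> s <= t -> t <= T -> t - s < eta ->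
    levy_prokhorov (sigma k s) (sigma k t) <= e.
Proof.
move=> e0; have [e' e'0 he'] := @levy_prokhorov_wasserstein R d p p1 _ e0.
have e2 : 0 < e' / 2 by rewrite divr_gt0.
have [eta eta0 heta] := equicontinuity T e2.
exists eta => // k s t s0 st tT h; apply: he'; apply: le_lt_trans (WG k s0 st) _.
by apply: le_lt_trans (heta _ _ _ s0 st tT h) _; lra.
Qed.

Let rat_limit (t : R) : 0 <= t -> forall q, t < ratr q -> absq q = ratr q.
Proof. by move=> t0 q tq; rewrite /absq ger0_norm// (le_trans t0)// ltW. Qed.

(** At an arbitrary time compactness gives only a subsequential limit [nu]. The whole sequence
    follows by comparison with a nearby rational time, where it converges: from time t to q, to the
    limit at q, to a member of the subsequence at q, back to time t, and to [nu]. Each of the five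
    steps costs e / 5. *)
Lemma pointwise_limit t : 0 <= t ->
  exists nu : Pp d p, levy_prokhorov (sigma k t) nu @[k --> \oo] --> 0.
Proof.
move=> t0; have [B hB] := path_moment (t + 1).
have tt1 : t <= t + 1 by rewrite lerDl.
have [f hf cf] := code_quantile_subsequence (fun k (_ : unit) => Pp_meas (sigma k t)).
have [||nu hnu] := @code_quantile_compactness R d p p1 (fun k => sigma (f k) t) B.
- by move=> k; exact: hB.
- by move=> r _; exact: cf tt r.
exists nu; apply/cvgrPdist_le => e e0; have e5 : 0 < e / 5 by rewrite divr_gt0.
have [eta eta0 heta] := levy_prokhorov_equicontinuity (t + 1) e5.
have [q /andP[tq qt]] : exists q : rat, t < ratr q < t + Num.min eta 1.
  have /rat_in_itvoo[q] : t < t + Num.min eta 1 by rewrite ltrDl lt_min eta0 ltr01.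
  by rewrite in_itv/=; exists q.
have q1 : (ratr q : R) <= t + 1 by apply: le_trans (ltW qt) _; rewrite lerD2l ge_min lexx orbT.
have qeta : ratr q - t < eta by rewrite ltrBlDl (lt_le_trans qt)// lerD2l ge_min lexx.
have close k : levy_prokhorov (sigma k t) (sigma k (ratr q)) <= e / 5.
  by apply: heta => //; exact: ltW.
have [cqq _ _] := cq q; rewrite (rat_limit t0 tq) in cqq.
have [||nuq hnuq] := @code_quantile_compactness R d p p1 (fun k => sigma k (ratr q)) B.
- by move=> k; apply: hB => //; exact: le_trans t0 (ltW tq).
- by move=> r _; exact: cqq.
have /cvgrPdist_le/(_ _ e5)[K _ hK] := hnuq.
have /cvgrPdist_le/(_ _ e5)[K' _ hK'] := hnu.
exists K => // k Kk; rewrite /= dist0_levy_prokhorov.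
pose j := maxn K K'.
have fj : (K <= f j)%N by apply: leq_trans (subseq_ge hf j); exact: leq_maxl.
have := hK k Kk; have := hK _ fj; have := hK' j (leq_maxr _ _).
rewrite /= !dist0_levy_prokhorov => a1 a2 a3.
have b1 := levy_prokhorov_triangle (sigma k t) (sigma k (ratr q)) nu.
have b2 := levy_prokhorov_triangle (sigma k (ratr q)) nuq nu.
have b3 := levy_prokhorov_triangle nuq (sigma (f j) (ratr q)) nu.
have b4 := levy_prokhorov_triangle (sigma (f j) (ratr q)) (sigma (f j) t) nu.
have c1 := close k; have c2 := close (f j).
rewrite (levy_prokhorovC nuq (sigma (f j) (ratr q))) in b3; rewrite (levy_prokhorovC _ (sigma (f j) t)) in b4.
lra.
Qed.

(** [G] and [E] converge at rational times only; their right limits are nondecreasing and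
    right-continuous, as Stieltjes measures require. Estimates at real times are read off at
    rationals slightly to the right, whence the strict bound t < T. The clause on [I] and [L] bounds
    [El] by the limit of any converging bounds of [E k]. *)
Lemma path_limit : exists (sig : R -> Pp d p) (Gl El : R -> R),
  [/\ sig 0 = mu /\ forall t, 0 <= t -> levy_prokhorov (sigma k t) (sig t) @[k --> \oo] --> 0,
      [/\ nondecreasing Gl, nondecreasing El, right_continuous Gl & right_continuous El],
      forall t, 0 <= El t /\ forall (I : R^nat) L, (forall k t, 0 <= t -> E k t <= I k) ->
        I @ \oo --> L -> El t <= L,
      forall s t, 0 <= s -> s <= t -> wasserstein (sig s) (sig t) <= Gl t - Gl s &
      forall s t T c, 0 <= s -> s <= t -> t < T -> 0 < c ->
        Gl t - Gl s <= p^-1 * c `^ (1 - p) * expR (delta * T) * (El t - El s) +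
          (1 - p^-1) * c * (t - s)].
Proof.
have sig_ex t : exists nu : Pp d p, 0 <= t -> levy_prokhorov (sigma k t) nu @[k --> \oo] --> 0.
  have [/pointwise_limit[nu h]|_] := leP 0 t; first by exists nu.
  by exists mu.
have [sig' sig'P] := choice sig_ex.
(* A limit is characterized only by its values on Borel sets, whereas [sig 0 = mu] is an equality of
   records; the value at 0 is therefore prescribed. *)
pose sig t := if t == 0 then mu else sig' t.
have sigP t : 0 <= t -> levy_prokhorov (sigma k t) (sig t) @[k --> \oo] --> 0.
  move=> t0; rewrite /sig; case: eqP => [->|_]; last exact: sig'P.
  under eq_fun do rewrite sigma0.
  rewrite (_ : (fun=> _) = cst 0); first exact: cvg_cst.
  apply/funext => k /=; apply/le_anti; rewrite levy_prokhorov_ge0 andbT.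
  apply/ler_addgt0Pr => e e0; rewrite add0r.
  have [eta eta0] := @levy_prokhorov_wasserstein R d p p1 _ e0; apply.
  by rewrite wassersteinxx.
pose Go q := limn (fun k => G k (absq q)); pose Eo q := limn (fun k => E k (absq q)).
have cG q : G k (absq q) @[k --> \oo] --> Go q by have [_] := cq q.
have cE q : E k (absq q) @[k --> \oo] --> Eo q by have [_ _] := cq q.
have ndlim (F : nat -> R -> R) Fo : (forall q, F k (absq q) @[k --> \oo] --> Fo q) ->
    (forall k, F k 0 = 0) -> (forall k s t, 0 <= s -> s <= t -> F k s <= F k t) ->
    rat_nondecreasing Fo.
  move=> cF F0 ndF q q' q0 qq'; have aq : absq q = ratr q by rewrite /absq ger0_norm.
  have aq' : absq q' = ratr q' by rewrite /absq ger0_norm// (le_trans q0).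
  split.
    apply: (ler_cvg_to (@cvg_cst _ (0 : R) _ _ _) (cF q)); apply: nearW => k.
    by rewrite -(F0 k) ndF// aq.
  apply: (ler_cvg_to (cF q) (cF q')); apply: nearW => k.
  by rewrite ndF// ?aq ?aq'.
have ndGo := ndlim G Go cG G0 ndG; have ndEo := ndlim E Eo cE E0 ndE.
exists sig, (right_limit Go), (right_limit Eo); split.
- by rewrite /sig eqxx.
- by split; [exact: right_limit_nd|exact: right_limit_nd|
    exact: right_limit_continuous|exact: right_limit_continuous].
- move=> t; split; first exact: right_limit_ge0.
  move=> I L EI IL; have /rat_in_itvoo[q] : Num.max 0 t < Num.max 0 t + 1 by rewrite ltrDl.
  rewrite in_itv/= => /andP[tq _]; apply: le_trans (right_limit_le ndEo tq) _.
  by apply: (ler_cvg_to (cE q) IL); apply: nearW => k; rewrite EI// normr_ge0.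
- move=> s t s0 st; have t0 := le_trans s0 st.
  apply/ler_addgt0Pr => e e0; have e2 : 0 < e / 2 by rewrite divr_gt0.
  (* The rational q lies to the right of s, where G may already have grown; equicontinuity bounds
     this loss by e / 2 uniformly in k. *)
  have [eta eta0 heta] := equicontinuity (s + 1) e2.
  have [y + hy] := right_limit_near ndGo t e2; rewrite (max_idPr t0) in hy * => ty.
  have /rat_in_itvoo[q'] := ty; rewrite in_itv/= => /andP[tq' q'y].
  have /rat_in_itvoo[q] : s < s + Num.min eta 1 by rewrite ltrDl lt_min eta0 ltr01.
  rewrite in_itv/= => /andP[sq qs].
  have q1 : ratr q <= s + 1 by apply: le_trans (ltW qs) _; rewrite lerD2l ge_min lexx orbT.
  have qeta : ratr q - s < eta by rewrite ltrBlDl (lt_le_trans qs)// lerD2l ge_min lexx.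
  have [B hB] := path_moment t.
  have Ww k : wasserstein (sigma k s) (sigma k t) <= G k (absq q') - G k (absq q) + e / 2.
    rewrite (rat_limit t0 tq') (rat_limit s0 sq); apply: le_trans (WG k s0 st) _.
    have := heta k _ _ s0 (ltW sq) q1 qeta; have := ndG k t0 (ltW tq'); lra.
  have Wl : wasserstein (sig s) (sig t) <= Go q' - Go q + e / 2.
    apply: (wasserstein_lsc p1 _ _ (sigP _ s0) (sigP _ t0) Ww) => [k|k|].
    - exact: hB.
    - exact: hB.
    - by apply: cvgD; [apply: cvgB; exact: cG|exact: cvg_cst].
  have sq0 : Num.max 0 s < ratr q by rewrite (max_idPr s0).
  have := right_limit_le ndGo sq0; have := hy _ tq' q'y; lra.
- move=> s t T c s0 st tT c0; have t0 := le_trans s0 st.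
  have := st; rewrite le_eqVlt => /orP[/eqP->|{}st]; first by rewrite !subrr !mulr0 addr0.
  set A := p^-1 * c `^ (1 - p) * expR (delta * T); set D := (1 - p^-1) * c.
  have A0 : 0 <= A by rewrite !mulr_ge0 ?powR_ge0 ?expR_ge0.
  have D0 : 0 <= D by rewrite mulr_ge0// ltW.
  (* The error e' occurs once for G, [A] times for E and [D] times for the rational time near t. *)
  apply/ler_addgt0Pr => e e0; pose e' := e / (A + D + 1).
  have ADe : (A + D + 1) * e' = e by rewrite /e' mulrC divfK// gt_eqF// ltr_pwDr// addr_ge0.
  have e'0 : 0 < e' by rewrite divr_gt0// ltr_pwDr// addr_ge0.
  have [y + hy] := right_limit_near ndGo s e'0; rewrite (max_idPr s0) in hy * => sy.
  have [z + hz] := right_limit_near ndEo t e'0; rewrite (max_idPr t0) in hz * => tz.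
  have /rat_in_itvoo[q] : s < Num.min y t by rewrite lt_min sy st.
  rewrite in_itv/= lt_min => /andP[sq /andP[qy qt]].
  have /rat_in_itvoo[q'] : t < Num.min z (Num.min T (t + e')).
    by rewrite !lt_min tz tT ltrDl.
  rewrite in_itv/= !lt_min => /andP[tq' /andP[q'z /andP[q'T q'e]]].
  have qq' : (ratr q : R) <= ratr q' by apply: ltW; exact: lt_trans qt tq'.
  have yl : Go q' - Go q <= A * (Eo q' - Eo q) + D * (ratr q' - ratr q).
    apply: (ler_cvg_to (a := \oo) (f := fun k => G k (absq q') - G k (absq q))
      (g := fun k => A * (E k (absq q') - E k (absq q)) + D * (ratr q' - ratr q))).
    - by apply: cvgB; exact: cG.
    - by apply: cvgD; [apply: cvgMl_tmp; apply: cvgB; exact: cE|exact: cvg_cst].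
    - apply: nearW => k; rewrite (rat_limit t0 tq') (rat_limit s0 sq).
      by apply: young_bound => //; [exact: le_trans s0 (ltW sq)|exact: ltW].
  have h1 := hy _ sq qy; have h2 := hz _ tq' q'z.
  have h3 : right_limit Go t <= Go q' by apply: right_limit_le; rewrite ?(max_idPr t0).
  have h4 : right_limit Eo s <= Eo q by apply: right_limit_le; rewrite ?(max_idPr s0).
  have h5 : A * (Eo q' - Eo q) <= A * (right_limit Eo t - right_limit Eo s + e').
    by rewrite ler_wpM2l//; lra.
  have h6 : D * (ratr q' - ratr q) <= D * (t - s + e') by rewrite ler_wpM2l//; lra.
  rewrite -ADe; move: yl h1 h3 h5 h6; lra.
Qed.

End path_limit.

(** * Speed and energy of the limit path *)

Section limit_energy.
Context {R : realType} {d : nat} {p delta : R}.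
Hypotheses (p1 : 1 < p) (delta0 : 0 < delta).
Local Notation leb := (@lebesgue_measure R).

Let p0 : 0 < p. Proof. exact: lt_trans p1. Qed.
Let pV : 0 <= p^-1. Proof. by rewrite invr_ge0 ltW. Qed.
Let pV1 : 0 <= 1 - p^-1. Proof. by rewrite subr_ge0 invf_le1// ltW. Qed.

(** The infimum over c of the right-hand side is A^(1/p) h^(1 - 1/p), so the family of linear bounds
    amounts to Hölder's inequality. *)
Lemma young_optimal (X A h : R) : 0 <= X -> 0 <= A -> 0 < h ->
  (forall c, 0 < c -> X <= p^-1 * c `^ (1 - p) * A + (1 - p^-1) * c * h) ->
  (X / h) `^ p <= A / h.
Proof.
move=> X0 A0 h0 Xc; apply/ler_addgt0Pr => e e0.
have B0 : 0 < A / h + e by rewrite ltr_wpDl// divr_ge0// ltW.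
(* The optimal [c] is [(A / h) `^ p^-1], perturbed because [A] may vanish. *)
pose c := (A / h + e) `^ p^-1; have c0 : 0 < c by rewrite powR_gt0.
have cp : c `^ p = A / h + e by rewrite -powRrM mulVf ?gt_eqF// powRr1// ltW.
rewrite -cp ge0_ler_powR ?nnegrE ?(ltW p0) ?(ltW c0) ?divr_ge0 ?(ltW h0)//.
rewrite ler_pdivrMr//; apply: le_trans (Xc _ c0) _.
have h1 : c `^ (1 - p) * A <= c * h.
  have cc : c `^ (1 - p) * c `^ p = c.
    by rewrite -powRD ?subrK ?powRr1 ?(ltW c0)//; apply/implyP => _; rewrite gt_eqF.
  rewrite -[X in _ <= X * h]cc cp -mulrA ler_wpM2l ?powR_ge0// mulrDl divfK ?gt_eqF//.
  by rewrite lerDl mulr_ge0// ltW.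
have := ler_wpM2l pV h1; rewrite !mulrA; lra.
Qed.

Lemma harmonic_dnbhs : (fun n : nat => n.+1%:R^-1 : R) @ \oo --> (0 : R)^'.
Proof.
move=> P hP; have : \forall n \near \oo, (n.+1%:R^-1 : R) != 0 -> P n.+1%:R^-1.
  exact: (@cvg_harmonic R _ hP).
by apply: filterS => n; apply; rewrite invr_eq0 pnatr_eq0.
Qed.

Variables (sig : R -> Pp d p) (G E : R -> R) (L : R).
Hypotheses (ndG : nondecreasing G) (ndE : nondecreasing E)
  (rcG : right_continuous G) (rcE : right_continuous E)
  (EL : forall t, 0 <= E t <= L).
Hypothesis WG : forall s t, 0 <= s -> s <= t -> wasserstein (sig s) (sig t) <= G t - G s.
Hypothesis young : forall s t T c, 0 <= s -> s <= t -> t < T -> 0 < c ->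
  G t - G s <= p^-1 * c `^ (1 - p) * expR (delta * T) * (E t - E s) +
    (1 - p^-1) * c * (t - s).

(** For large [c] the coefficient of the increment of E in [young] is at most e, and the other term
    is linear in t - s: this is the domination that makes dG absolutely continuous. *)
Lemma limit_speed : exists g, is_speed sig g.
Proof.
apply: (exists_speed p1) => n.
have T0 : 0 <= n.+1%:R :> R by [].
have [|M [M0 Mi ME]] := ac_stieltjes_density T0 ndG ndE rcG rcE; last first.
  exists M; split=> // s t s0 st tn; rewrite -ME// lee_fin; exact: WG.
move=> e e0; have K0 : 0 <= p^-1 * expR (delta * (n.+1%:R + 1)) by rewrite mulr_ge0 ?expR_ge0.
have [c c0 hc] := exists_powR_small p1 K0 e0.
exists ((1 - p^-1) * c); first by rewrite mulr_ge0// ltW.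
move=> s t s0 st tn; apply: le_trans (young (T := n.+1%:R + 1) s0 st _ c0) _.
  by apply: le_lt_trans tn _; rewrite ltrDl.
have dE : 0 <= E t - E s by rewrite subr_ge0 ndE.
by have := ler_wpM2r dE hc; lra.
Qed.

(** [young] requires a time T strictly after t + h; the choice T = t + 2 h is the origin of the
    factor e^(2 delta h). *)
Lemma difference_quotient (t h : R) : 0 <= t -> 0 < h ->
  expR (- delta * t) * (wasserstein (sig (t + h)) (sig t) / h) `^ p <=
    expR (2 * delta * h) * ((E (t + h) - E t) / h).
Proof.
move=> t0 h0; have th : t <= t + h by rewrite lerDl ltW.
have dE : 0 <= E (t + h) - E t by rewrite subr_ge0 ndE.
have := @young_optimal (wasserstein (sig t) (sig (t + h)))
  (expR (delta * (t + 2 * h)) * (E (t + h) - E t)) h.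
rewrite (wassersteinC p1) => /(_ (wasserstein_ge0 p1 _ _)) hW.
have {}hW := hW (mulr_ge0 (expR_ge0 _) dE) h0.
apply: le_trans (ler_wpM2l (expR_ge0 _) (hW _)) _.
  move=> c c0; rewrite (wassersteinC p1); apply: le_trans (WG t0 th) _.
  have th2 : t + h < t + 2 * h by rewrite ltrD2l; lra.
  by have := young t0 th th2 c0; rewrite [t + h - t]addrAC subrr add0r mulrA.
rewrite !mulrA -expRD (_ : - delta * t + delta * (t + 2 * h) = 2 * delta * h)//; ring.
Qed.

Lemma limit_energy : exists2 g, is_speed sig g & (energy p delta g <= L%:E)%E.
Proof.
have [g sg] := limit_speed; exists g => //.
have [mg g0 _ [N [mN N0 Ng]]] := sg.
have FL : Filter (nbhs (almost_everywhere leb)) := ae_filter_ringOfSetsType leb.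
have L0 : 0 <= L by have /andP[h1 h2] := EL 0; exact: le_trans h1 h2.
pose h (n : nat) : R := n.+1%:R^-1.
have h0 n : 0 < h n by rewrite invr_gt0.
pose F n (t : R) := expR (2 * delta * h n) * ((E (t + h n) - E t) / h n).
(* The shift estimate concerns bounded intervals, hence the cut-off at n + 1, which every t > 0
   passes for large n. *)
pose f n := (fun t => (F n t)%:E) \_ (`]0%R, n.+1%:R]%classic).
have F0 n t : 0 <= F n t.
  by rewrite mulr_ge0 ?expR_ge0// divr_ge0 ?(ltW (h0 n))// subr_ge0 ndE// lerDl ltW.
have f0 n t : (0 <= f n t)%E by apply: erestrict_ge0 => x _; rewrite lee_fin.
have mE : measurable_fun setT E by exact: nondecreasing_measurable.
have mdE n : measurable_fun setT (fun t : R => E (t + h n) - E t).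
  apply: measurable_funB => //; apply: measurableT_comp => //; exact: measurable_funD.
have mF n : measurable_fun setT (F n).
  by apply: measurable_funM => //; exact: measurable_funM.
have mf n : measurable_fun setT (f n).
  apply/(measurable_restrictT _ _).1 => //; apply: measurable_funTS; exact/measurable_EFinP.
pose u (t : R) := (expR (- delta * t) * g t `^ p)%:E.
have u0 t : (0 <= u t)%E by rewrite lee_fin mulr_ge0 ?expR_ge0 ?powR_ge0.
have mu : measurable_fun setT u by apply/measurable_EFinP; exact: measurable_weighted.
have uf : {ae leb, forall t, `]0, +oo[%classic t -> (u t <= limn_einf (f ^~ t))%E}.
  exists N; split=> // t /=; apply: contra_notP => Nt; rewrite in_itv/= andbT => t0.
  have [_ cg] := Ng t (ltW t0) Nt.
  rewrite leNgt; apply/negP => lt_fu.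
  have cu : expR (- delta * t) * (wasserstein (sig (t + h n)) (sig t) / h n) `^ p @[n --> \oo]
      --> expR (- delta * t) * g t `^ p.
    apply: cvgMl_tmp; apply: cvg_powR => //.
      by move=> n; rewrite divr_ge0 ?(ltW (h0 n)) ?wasserstein_ge0.
    have := cvg_comp _ _ harmonic_dnbhs cg.
    by apply: cvg_trans; apply: near_eq_cvg; apply: nearW => n /=; rewrite gtr0_norm.
  (* The weighted quotients eventually exceed [v], while [f k t] is below [v] for arbitrarily large
     k, although it dominates the quotient. *)
  have [v /andP[v1 v2]] : exists v : R, (limn_einf (f ^~ t) < v%:E < u t)%E.
    move: lt_fu (@limn_einf_ge0 _ (f ^~ t) (f0 ^~ t)).
    case: (limn_einf (f ^~ t)) => [l| |]; last by [].
    - rewrite lte_fin => lu _; exists ((l + expR (- delta * t) * g t `^ p) / 2).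
      by rewrite /u !lte_fin !midf_lt.
    - by rewrite ltNge leey.
  have vu : v < expR (- delta * t) * g t `^ p by rewrite -lte_fin.
  have /cvgr_gt/(_ _ vu) [K _ hK] := cu.
  have [k kK] := lt_limn_einf v1 (maxn K (Num.truncn t)).
  apply/negP; rewrite -leNgt.
  have tk : t <= k.+1%:R.
    apply: le_trans (ltW (truncnS_gt t)) _; rewrite ler_nat ltnS.
    by apply: leq_trans kK; exact: leq_maxr.
  rewrite /f patchE mem_set; last by rewrite /= in_itv/= t0.
  rewrite lee_fin; apply: le_trans (difference_quotient (ltW t0) (h0 k)).
  by apply/ltW/hK => /=; apply: leq_trans kK; exact: leq_maxl.
have shift n : (\int[leb]_(t in `]0%R, +oo[) f n t <= (expR (2 * delta * h n) * L)%:E)%E.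
  have -> : (\int[leb]_(t in `]0%R, +oo[) f n t = \int[leb]_(t in `]0%R, n.+1%:R]) (F n t)%:E)%E.
    rewrite [RHS]integral_mkcond [LHS]integral_mkcond; apply: eq_integral => t _.
    rewrite /f !patchE; case: ifPn => //; rewrite notin_setE => /= t0; case: ifPn => //.
    by move=> /set_mem /=; rewrite in_itv/= => /andP[t1 _]; exfalso; apply: t0; rewrite in_itv/= t1.
  have c0 : 0 <= expR (2 * delta * h n) / h n by rewrite divr_ge0 ?expR_ge0 ?(ltW (h0 n)).
  under eq_integral do rewrite /F mulrCA mulrC EFinM.
  rewrite ge0_integralZl_EFin//; last 2 first.
  - by move=> t _; rewrite lee_fin subr_ge0 ndE// lerDl ltW.
  - by apply: measurable_funTS; apply/measurable_EFinP; exact: mdE.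
  apply: (@le_trans _ _ ((expR (2 * delta * h n) / h n)%:E * (h n * L)%:E)%E).
    by rewrite lee_wpmul2l// ?lee_fin// integral_shift_le.
  by rewrite -EFinM mulrA divfK// gt_eqF.
rewrite /energy -integral_itv_obnd_cbnd; last by exact: measurable_funTS.
apply: (@le_trans _ _ (\int[leb]_(t in `]0%R, +oo[) limn_einf (f ^~ t))%E).
  apply: ae_ge0_le_integral => //.
  - by move=> t _; exact: u0.
  - exact: measurable_funTS.
  - by move=> t _; apply: limn_einf_ge0.
  - by apply: measurable_funTS; exact: measurable_fun_limn_einf.
apply: le_trans (fatou leb _ _ _) _ => //.
- by move=> n; apply: measurable_funTS; exact: mf.
apply/lee_addgt0Pr => e e0; apply: limn_einf_le => K.
have cL : expR (2 * delta * h n) * L @[n --> \oo] --> L.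
  rewrite -[X in _ --> X]mul1r; apply: cvgMr_tmp; rewrite -[X in _ --> X](@expR0 R).
  have ch : 2 * delta * h n @[n --> \oo] --> 0.
    by rewrite -[X in _ --> X](mulr0 (2 * delta)); apply: cvgMl_tmp; exact: cvg_harmonic.
  by apply: (continuous_cvg (h := expR) _ _ ch); exact: continuous_expR.
have Le : L < L + e by rewrite ltrDl.
have /cvgr_lt/(_ _ Le)[K' _ hK'] := cL.
exists (maxn K K'); first exact: leq_maxl.
by apply: le_trans (shift _) _; rewrite lee_fin ltW//; apply: hK'; exact: leq_maxr.
Qed.

End limit_energy.

(** * Existence of minimizers *)

Section direct_method.
Context {R : realType} {d : nat} {p delta : R}.
Hypotheses (p1 : 1 < p) (delta0 : 0 < delta).
Local Notation leb := (@lebesgue_measure R).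
Local Notation halfline := (`[0%R, +oo[%classic : set (measurableTypeR R)).

Let p0 : 0 < p. Proof. exact: lt_trans p1. Qed.

(** Up to the factor K / delta the weight is the density of the exponential law of rate delta. *)
Lemma integrable_weight (K : R) :
  leb.-integrable halfline (fun t => (expR (- delta * t) * K)%:E).
Proof.
have Kd := integrableZl (measurableT) (delta^-1 * K) (integrable_exponential_pdf delta0).
have : leb.-integrable halfline
    (fun t => (delta^-1 * K)%:E * (EFin \o exponential_pdf delta) t)%E.
  by apply: integrableS Kd.
apply: eq_integrable => // t; rewrite inE/= in_itv/= andbT => t0.
by rewrite exponential_pdfE// -EFinM; congr EFin; field; rewrite gt_eqF.
Qed.

Variables (V : Pp d p -> R) (K : R).
Hypotheses (V_cont : levy_prokhorov_continuous V) (VK : forall mu, `|V mu| <= K).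

Hypothesis K0 : 0 <= K.

Definition potential (sigma : R -> Pp d p) : \bar R :=
  (\int[leb]_(t in `[0%R, +oo[) (expR (- delta * t) * V (sigma t))%:E)%E.

Definition total_weight : R := fine (\int[leb]_(t in `[0%R, +oo[) (expR (- delta * t) * K)%:E)%E.

(** Finite energy makes the path continuous for the Lévy-Prokhorov metric, so V along the path,
    frozen at negative times, is continuous. *)
Lemma measurable_potential sigma g : is_speed sigma g -> (energy p delta g < +oo)%E ->
  measurable_fun halfline (V \o sigma).
Proof.
move=> sg Eg; have [mg g0 gW _] := sg.
have [G [E [[G0 E0] ndE dG ndG young]]] := speed_primitives p1 delta0 mg g0 Eg.
pose c (t : R) := Num.max 0 t.
have c0 t : 0 <= c t by rewrite /c le_max lexx.
have cLip s t : s <= t -> c s <= c t /\ c t - c s <= t - s.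
  by move=> st; rewrite /c !maxEle; do !case: ifPn; rewrite -?ltNge => *; split; lra.
have WG s t : 0 <= s -> s <= t -> wasserstein (sigma s) (sigma t) <= G t - G s.
  by move=> s0 st; rewrite -lee_fin -dG// gW.
(* Equicontinuity of a constant sequence of paths is uniform continuity of the path on bounded
   intervals. *)
have lpeq := @levy_prokhorov_equicontinuity R d p delta p1 delta0 (fun=> sigma)
  (fun=> G) (fun=> E) (fine (energy p delta g)) (fun=> WG) (fun=> E0)
  (fun=> fun s t s0 st => (ndE s t s0 st).1) (fun=> fun t t0 => (ndE t t t0 (lexx t)).2)
  (fun=> young).
have cont : continuous (V \o sigma \o c).
  move=> t; apply/cvgrPdist_lt => e e0; have [eta eta0 heta] := V_cont (sigma (c t)) e0.
  have eta2 : 0 < eta / 2 by rewrite divr_gt0.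
  have [r r0 hr] := lpeq (c t + 1) _ eta2.
  have m0 : 0 < Num.min r 1 by rewrite lt_min r0 ltr01.
  exists (Num.min r 1) => //= s; rewrite /= lt_min => /andP[sr s1].
  rewrite distrC; apply: heta; apply: (@le_lt_trans _ _ (eta / 2)); last by lra.
  move: sr s1; have [st|/ltW ts] := leP s t.
    rewrite (ger0_norm (_ : 0 <= t - s)) ?subr_ge0// => sr s1.
    have [h1 h2] := cLip _ _ st.
    by apply: (hr 0%N) => //; [rewrite lerDl|exact: le_lt_trans h2 sr].
  rewrite distrC (ger0_norm (_ : 0 <= s - t)) ?subr_ge0// => sr s1.
  have [h1 h2] := cLip _ _ ts; rewrite levy_prokhorovC.
  by apply: (hr 0%N) => //; [lra|exact: le_lt_trans h2 sr].
apply: (eq_measurable_fun (V \o sigma \o c)).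
  by move=> t; rewrite inE/= in_itv/= andbT /c => t0; rewrite (max_idPr t0).
by apply: measurable_funTS; exact: continuous_measurable_fun.
Qed.

Lemma integrable_potential sigma g : is_speed sigma g -> (energy p delta g < +oo)%E ->
  leb.-integrable halfline (fun t => (expR (- delta * t) * V (sigma t))%:E).
Proof.
move=> sg Eg; apply: le_integrable (integrable_weight K) => //.
- apply/measurable_EFinP; apply: measurable_funM; last exact: measurable_potential sg Eg.
  by apply: measurable_funTS; exact: measurable_weight.
- move=> t _; rewrite /= lee_fin !normrM ler_wpM2l// (ger0_norm K0); exact: VK.
Qed.

Lemma potential_bound sigma g : is_speed sigma g -> (energy p delta g < +oo)%E ->
  potential sigma \is a fin_num /\ `|fine (potential sigma)| <= total_weight.
Proof.
move=> sg Eg; have Pi := integrable_potential sg Eg.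
have Pf : potential sigma \is a fin_num by exact: integrable_fin_num.
split=> //; rewrite -lee_fin /total_weight fineK; last first.
  by apply: integrable_fin_num => //; exact: integrable_weight.
rewrite -fine_abse// fineK ?abse_fin_num//.
apply: le_trans (le_abse_integral _ _ _) _ => //; first by case/integrableP: Pi.
apply: ge0_le_integral => //.
- by apply: measurableT_comp => //; case/integrableP: Pi.
- by case/integrableP: (integrable_weight K).
- move=> t _; rewrite /= lee_fin normrM ger0_norm ?expR_ge0// ler_wpM2l ?expR_ge0//; exact: VK.
Qed.

Lemma action_energy sigma g : is_speed sigma g -> (energy p delta g < +oo)%E ->
  action delta V sigma =
    (p^-1 * fine (energy p delta g) - fine (potential sigma))%:E.
Proof.
move=> sg Eg; rewrite (action_speedE _ sg).
have [mg g0 _ _] := sg.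
have Ei : leb.-integrable halfline (fun t => (expR (- delta * t) * g t `^ p)%:E).
  apply/integrableP; split.
    by apply/measurable_EFinP; apply: measurable_funTS; exact: measurable_weighted.
  under eq_integral do rewrite gee0_abs ?lee_fin ?mulr_ge0 ?expR_ge0 ?powR_ge0//.
  exact: Eg.
have Ef : energy p delta g \is a fin_num by exact: integrable_fin_num.
have [Pf _] := potential_bound sg Eg.
rewrite EFinB EFinM !fineK// /energy /potential -integralZl//.
rewrite -integralB//; last 2 first.
- exact: integrableZl.
- exact: integrable_potential sg Eg.
by apply: eq_integral => t _; rewrite -EFinM -EFinB; congr EFin; ring.
Qed.

Lemma constant_path (mu : Pp d p) :
  is_speed (fun=> mu) (cst 0) /\ energy p delta (cst 0 : R -> R) = 0%E.
Proof.
split; last first.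
  by apply: integral0_eq => t _; rewrite /= powR0 ?gt_eqF// mulr0.
split => //.
- by move=> s t _ _; rewrite wassersteinxx// integral_ge0.
- exists [set 0]; split => //; first exact: lebesgue_measure_set1.
  move=> t t0 /eqP tn0.
  have cg : wasserstein mu mu / `|h| @[h --> (0 : R)^'] --> (0 : R).
    by rewrite wassersteinxx//; under eq_fun do rewrite mul0r; exact: cvg_cst.
  by split=> //; apply: metric_derivativeE => //; rewrite lt_neqAle eq_sym tn0.
Qed.

Lemma potential_cvg (sigma : nat -> R -> Pp d p) (g : nat -> R -> R) (sig : R -> Pp d p) (h : R -> R) :
  (forall k, is_speed (sigma k) (g k)) -> (forall k, energy p delta (g k) < +oo)%E ->
  is_speed sig h -> (energy p delta h < +oo)%E ->
  (forall t, 0 <= t -> levy_prokhorov (sigma k t) (sig t) @[k --> \oo] --> 0) ->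
  fine (potential (sigma k)) @[k --> \oo] --> fine (potential sig).
Proof.
move=> sg Eg sh Eh lp0; apply: fine_cvg; rewrite fineK; last by have [] := potential_bound sh Eh.
have mP s f : is_speed s f -> (energy p delta f < +oo)%E ->
    measurable_fun halfline (fun t => (expR (- delta * t) * V (s t))%:E).
  by move=> ss Es; case/integrableP: (integrable_potential ss Es).
have [||] := @dominated_convergence _ _ _ leb halfline (measurable_itv _)
  (fun k t => (expR (- delta * t) * V (sigma k t))%:E)
  (fun t => (expR (- delta * t) * V (sig t))%:E) (fun t => (expR (- delta * t) * K)%:E)
  (fun k => mP _ _ (sg k) (Eg k)) (mP _ _ sh Eh) _ (integrable_weight K) _; last by [].
- apply: aeW => t /=; rewrite in_itv/= andbT => t0.
  apply: cvg_EFin; first by apply: nearW.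
  apply: cvgMl_tmp; apply/cvgrPdist_lt => e e0.
  have [eta eta0 heta] := V_cont (sig t) e0.
  have /cvgrPdist_lt/(_ _ eta0) := lp0 t t0.
  by apply: filterS => k; rewrite /= dist0_levy_prokhorov distrC; exact: heta.
- apply: aeW => t k _; rewrite /= lee_fin normrM ger0_norm ?expR_ge0// ler_wpM2l ?expR_ge0//.
Qed.

End direct_method.
Arguments potential {R d p} delta V sigma.
Arguments total_weight {R} delta K.

(** The last clause admits every converging energy bound [I], so that it can be used twice for the
    same limit path: with a constant bound, for finiteness of the energy, and with the sharp
    limit. *)
Lemma energy_compactness (R : realType) (d : nat) (p delta : R) (p1 : 1 < p) (delta0 : 0 < delta)
    (mu : Pp d p) (sigma : nat -> R -> Pp d p) (g : nat -> R -> R) (C : R) :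
  (forall k, sigma k 0 = mu) -> (forall k, is_speed (sigma k) (g k)) ->
  (forall k, energy p delta (g k) <= C%:E)%E ->
  exists (f : nat -> nat) (sig : R -> Pp d p),
  [/\ {homo f : m n / (m < n)%N}, sig 0 = mu,
      forall t, 0 <= t -> levy_prokhorov (sigma (f k) t) (sig t) @[k --> \oo] --> 0 &
      forall (I : R^nat) L, (forall k, energy p delta (g (f k)) <= (I k)%:E)%E ->
        I @ \oo --> L ->
        exists2 h, is_speed sig h & (energy p delta h <= L%:E)%E].
Proof.
move=> sigma0 sg EC.
have Efin k : (energy p delta (g k) < +oo)%E by apply: le_lt_trans (EC k) _; rewrite ltry.
have e0 k : (0 <= energy p delta (g k))%E.
  by apply: integral_ge0 => t _; rewrite lee_fin mulr_ge0 ?expR_ge0 ?powR_ge0.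
have Efn k : energy p delta (g k) \is a fin_num by rewrite ge0_fin_numE.
have prim k : exists GE : (R -> R) * (R -> R), [/\ GE.1 0 = 0 /\ GE.2 0 = 0,
    forall s t, 0 <= s -> s <= t -> GE.2 s <= GE.2 t /\ GE.2 t <= fine (energy p delta (g k)),
    forall s t, 0 <= s -> s <= t -> wasserstein (sigma k s) (sigma k t) <= GE.1 t - GE.1 s,
    forall s t, 0 <= s -> s <= t -> GE.1 s <= GE.1 t &
    forall s t c, 0 <= s -> s <= t -> 0 < c ->
      GE.1 t - GE.1 s <= p^-1 * c `^ (1 - p) * expR (delta * t) * (GE.2 t - GE.2 s) +
        (1 - p^-1) * c * (t - s)].
  have [mg g0 gW _] := sg k.
  have [G [E [h1 h2 h3 h4 h5]]] := speed_primitives p1 delta0 mg g0 (Efin k).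
  exists (G, E); split=> //= s t s0 st; rewrite -lee_fin -h3//; exact: gW.
have [GE GEP] := choice prim.
pose G k := (GE k).1; pose E k := (GE k).2.
have G0 k : G k 0 = 0 by have [[]] := GEP k.
have E0 k : E k 0 = 0 by have [[]] := GEP k.
have ndE k s t : 0 <= s -> s <= t -> E k s <= E k t.
  by move=> s0 st; have [_ /(_ s t s0 st)[]] := GEP k.
have EI k t : 0 <= t -> E k t <= fine (energy p delta (g k)).
  by move=> t0; have [_ /(_ t t t0 (lexx t))[]] := GEP k.
have EkC k t : 0 <= t -> E k t <= C.
  by move=> t0; apply: le_trans (EI k t t0) _; rewrite -lee_fin fineK.
have WG k s t : 0 <= s -> s <= t -> wasserstein (sigma k s) (sigma k t) <= G k t - G k s.
  by have [_ _ h _ _] := GEP k; exact: h.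
have ndG k s t : 0 <= s -> s <= t -> G k s <= G k t by have [_ _ _ h _] := GEP k; exact: h.
have young k s t c : 0 <= s -> s <= t -> 0 < c ->
    G k t - G k s <= p^-1 * c `^ (1 - p) * expR (delta * t) * (E k t - E k s) +
      (1 - p^-1) * c * (t - s) by have [_ _ _ _ h] := GEP k; exact: h.
have [f hf cf] := path_subsequence p1 delta0 sigma G0 E0 ndG ndE EkC young.
have [sig [Gl [El [[sig0 lp0] [ndGl ndEl rcGl rcEl] ElL WGl youngl]]]] :=
  path_limit p1 delta0 (fun k => sigma0 (f k)) (fun k => WG (f k)) (fun k => G0 (f k))
    (fun k => E0 (f k)) (fun k => ndG (f k)) (fun k => ndE (f k)) (fun k => EkC (f k))
    (fun k => young (f k)) cf.
exists f, sig; split=> // I L EI' IL.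
have ELb t : 0 <= El t <= L.
  have [-> h] := ElL t; apply: (h I) => // k s s0; apply: le_trans (EI (f k) s s0) _.
  by rewrite -lee_fin fineK.
exact: (limit_energy p1 ndGl ndEl rcGl rcEl ELb WGl youngl).
Qed.

(** The infimum is finite: energies are nonnegative and potential terms bounded by [W], while the
    constant path is admissible. A minimizing sequence therefore has bounded energies. *)
Lemma exists_minimizing_path (R : realType) (d : nat) (p delta : R) (p1 : 1 < p)
    (delta0 : 0 < delta) (V : Pp d p -> R) (K : R) (V_cont : levy_prokhorov_continuous V)
    (K0 : 0 <= K) (VK : forall mu, `|V mu| <= K) (mu : Pp d p) :
  exists sigma : R -> @Pp R d p,
    [/\ AC_p_delta delta sigma, sigma 0 = mu &
        action delta V sigma = value_function delta V mu].
Proof.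
have p0 : 0 < p by exact: lt_trans p1.
pose W := total_weight delta K.
have AC_speed (sigma : R -> Pp d p) : AC_p_delta delta sigma ->
    exists2 g, is_speed sigma g & (energy p delta g < +oo)%E.
  move=> [lac Ef]; have [g sg] := locally_p_ac_speed p1 lac.
  by exists g => //; rewrite -(AC_speedE sg).
have e0 g : (0 <= energy p delta g)%E.
  by apply: integral_ge0 => t _; rewrite lee_fin mulr_ge0 ?expR_ge0 ?powR_ge0.
have actionE (sigma : R -> Pp d p) g : is_speed sigma g -> (energy p delta g < +oo)%E ->
    action delta V sigma = (p^-1 * fine (energy p delta g) - fine (potential delta V sigma))%:E.
  exact: (action_energy p1 delta0 V_cont VK K0).
have potW (sigma : R -> Pp d p) g : is_speed sigma g -> (energy p delta g < +oo)%E ->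
    `|fine (potential delta V sigma)| <= W.
  by move=> sg Eg; have [] := potential_bound p1 delta0 V_cont VK K0 sg Eg.
pose Adm := [set sigma : R -> Pp d p | AC_p_delta delta sigma /\ sigma 0 = mu].
have U_le (sigma : R -> Pp d p) : Adm sigma -> (value_function delta V mu <= action delta V sigma)%E.
  by move=> As; apply: ereal_inf_lbound; exists sigma.
have U_ge : ((- W)%:E <= value_function delta V mu)%E.
  apply: le_ereal_inf_tmp => _ [sigma [/AC_speed[g sg Eg] _] <-].
  rewrite (actionE _ _ sg Eg) lee_fin.
  have := potW _ _ sg Eg; rewrite ler_norml => /andP[_ h].
  have : 0 <= p^-1 * fine (energy p delta g) by rewrite mulr_ge0 ?invr_ge0 ?fine_ge0 ?(ltW p0).
  lra.
have [sc Ec] := constant_path (delta := delta) p1 mu.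
have Ac : Adm (fun=> mu) by split=> //; apply: (AC_of_speed delta0 sc); rewrite Ec.
have Ufin : value_function delta V mu \is a fin_num.
  rewrite fin_numElt (lt_le_trans _ U_ge) ?ltNyr//=.
  by apply: le_lt_trans (U_le _ Ac) _; rewrite (actionE _ _ sc) ?Ec// ltry.
set U := value_function delta V mu in Ufin U_le U_ge *.
have seq k : exists sg : (R -> Pp d p) * (R -> R), [/\ is_speed sg.1 sg.2,
    (energy p delta sg.2 < +oo)%E, sg.1 0 = mu &
    (action delta V sg.1 < U + (k.+1%:R^-1)%:E)%E].
  have k0 : 0 < k.+1%:R^-1 :> R by rewrite invr_gt0.
  have [_ [s [AC s0] <-] sU] := lb_ereal_inf_adherent k0 Ufin.
  by have [g sg Eg] := AC_speed _ AC; exists (s, g).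
have [SG SGP] := choice seq.
pose sigma k := (SG k).1; pose g k := (SG k).2.
have sg k : is_speed (sigma k) (g k) by have [] := SGP k.
have Eg k : (energy p delta (g k) < +oo)%E by have [] := SGP k.
have sigma0 k : sigma k 0 = mu by have [] := SGP k.
pose a k := p^-1 * fine (energy p delta (g k)) - fine (potential delta V (sigma k)).
have aE k : action delta V (sigma k) = (a k)%:E by exact: actionE.
have aU k : fine U <= a k /\ a k < fine U + k.+1%:R^-1.
  split; last by rewrite -lte_fin [X in (_ < X)%E]EFinD fineK// -aE; have [] := SGP k.
  rewrite -lee_fin fineK// -aE; apply: U_le; split=> //.
  exact: (AC_of_speed delta0 (sg k) (Eg k)).
have Efn k : energy p delta (g k) \is a fin_num by rewrite ge0_fin_numE.
(* Energies are expressed by actions and potential terms, both of which converge; no limit of the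
   energies has to be assumed. *)
have EgE k : energy p delta (g k) =
    (p * (a k + fine (potential delta V (sigma k))))%:E.
  by rewrite /a subrK mulrA mulfV ?gt_eqF// mul1r fineK.
have EC k : (energy p delta (g k) <= (p * (fine U + 1 + W))%:E)%E.
  rewrite EgE lee_fin ler_pM2l//.
  have := potW _ _ (sg k) (Eg k); rewrite ler_norml => /andP[_ h].
  have k1 : k.+1%:R^-1 <= 1 :> R by rewrite invf_le1// ler1n.
  have [_ h'] := aU k; apply: lerD => //; apply: le_trans (ltW h') _; exact: lerD.
have [f [sig [hf sig0 lp0 lsc]]] := energy_compactness p1 delta0 sigma0 sg EC.
have a_cvg : a @ \oo --> fine U.
  apply: (@squeeze_cvgr _ _ _ _ (cst (fine U)) (fun k => fine U + k.+1%:R^-1)).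
  - by apply: nearW => k; have [-> /ltW] := aU k.
  - exact: cvg_cst.
  - by rewrite -[X in _ --> X]addr0; apply: cvgD; [exact: cvg_cst|exact: cvg_harmonic].
(* The crude bound provides [sig] with a speed of finite energy, as required for passing to the
   limit in the potential; that limit then enters the sharp bound. *)
have [||h0 sh0 Eh0] := lsc (cst (p * (fine U + 1 + W))) (p * (fine U + 1 + W)).
- by move=> k; exact: EC.
- exact: cvg_cst.
have {}Eh0 : (energy p delta h0 < +oo)%E by apply: le_lt_trans Eh0 _; rewrite ltry.
pose P := fine (potential delta V sig).
have Pcvg : fine (potential delta V (sigma (f k))) @[k --> \oo] --> P.
  exact: (potential_cvg p1 delta0 V_cont VK K0 (fun k => sg (f k)) (fun k => Eg (f k)) sh0 Eh0 lp0).
have [||h sh Eh] := lsc (fun k => p * (a (f k) + fine (potential delta V (sigma (f k)))))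
    (p * (fine U + P)).
- by move=> k; rewrite EgE.
- by apply: cvgMl_tmp; apply: cvgD => //; exact: (cvg_subseq hf a_cvg).
have Ehoo : (energy p delta h < +oo)%E by apply: le_lt_trans Eh _; rewrite ltry.
have ACs := AC_of_speed delta0 sh Ehoo.
exists sig; split=> //; apply/le_anti/andP; split; last exact: U_le.
rewrite (actionE _ _ sh Ehoo) -[leRHS](fineK Ufin) lee_fin lerBlDr -/P.
rewrite mulrC ler_pdivrMr// mulrC -lee_fin fineK// ge0_fin_numE//; exact: e0.
Qed.

Theorem theorem1p1 (R : realType) (d : nat) (p delta : R)
    (d_ge1 : (1 <= d)%N) (p_gt1 : 1 < p) (delta_gt0 : 0 < delta)
    (V : @Pp R d p -> R) (V_cont : levy_prokhorov_continuous V)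
    (alpha beta r : R) (r_ge1 : 1 <= r) (r_lt_p : r < p) (rho : @Pp R d p)
    (V_growth : forall mu : @Pp R d p,
      `|V mu| <= alpha * levy_prokhorov mu rho `^ (2 * r) + beta) :
  forall mu : @Pp R d p, exists sigma : R -> @Pp R d p,
    [/\ AC_p_delta delta sigma, sigma 0 = mu &
        action delta V sigma = value_function delta V mu].
Proof.
have VK mu : `|V mu| <= `|alpha| + `|beta|.
  apply: le_trans (V_growth mu) _; rewrite lerD ?ler_norm//.
  apply: le_trans (ler_norm _) _; rewrite normrM (ger0_norm (powR_ge0 _ _)) ler_piMr//.
  have r0 : 0 <= 2 * r by lra.
  have := @ge0_ler_powR _ (2 * r) r0 (levy_prokhorov mu rho) 1.
  by rewrite !nnegrE powR1 levy_prokhorov_ge0 levy_prokhorov_le1; apply.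
exact: (exists_minimizing_path p_gt1 delta_gt0 V_cont (addr_ge0 (normr_ge0 _) (normr_ge0 _)) VK).
Qed.
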